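(* Let $\Gamma$ be a modular pattern and $n=|\Gamma|$. There are continuous maps $\Lambda\colon \square(\Gamma)\to CS(S^n)$, $f\mapsto \Lambda_f$, and $\rho\colon \square(\Gamma)\to \mathrm{Mon}(PSL_2(\mathbb Z),\mathrm{PL}(S^n))$, $f\mapsto\rho_f$, such that for every $f\in\square(\Gamma)$ the set $\Lambda_f$ is the limit set of $\rho_f(PSL_2(\mathbb Z))$ and $\Lambda_f$ is homeomorphic to $Q_{\Gamma'}$, where $\Gamma'=f^{-1}(1)$.
   Context: The modular group $PSL_2(\mathbb Z)$ acts on the hyperbolic plane $\mathbf H^2$ (disk model), whose ideal boundary is the circle $S^1$. A modular pattern is a collection $\Gamma$ of complete geodesics of $\mathbf H^2$ which is invariant under $PSL_2(\mathbb Z)$, consists of only finitely many $PSL_2(\mathbb Z)$-orbits, and such that each geodesic of $\Gamma$ is stabilized by an infinite-order subgroup of $PSL_2(\mathbb Z)$. The modular tiling $T$ is the $PSL_2(\mathbb Z)$-invariant tiling of $\mathbf H^2$ by ideal triangles obtained as the orbit of one ideal triangle (with ideal vertices corresponding to $0,1,\infty$ in the upper half-plane model) under the group generated by reflections in its sides. $|\Gamma|$ denotes one more than the number of geodesics of $\Gamma$ which intersect a given edge of $T$. For any $PSL_2(\mathbb Z)$-invariant collection $\Gamma'$ of geodesics (a sub-pattern of a modular pattern, possibly empty) write $p\sim q$ for $p,q\in S^1$ if $p=q$ or $p,q$ are the endpoints of a geodesic of $\Gamma'$, and $Q_{\Gamma'}=S^1/\!\sim$ (so $Q_\emptyset=S^1$).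 $\square(\Gamma)$ is the set of $PSL_2(\mathbb Z)$-invariant maps $f\colon\Gamma\to(0,1]$, topologized as a subset of $(0,1]^r$ via the values on the $r$ orbits. The sphere $S^n$ is $\Delta_+\cup\Delta_-$, two copies of the standard $n$-simplex glued along their boundaries, with its piecewise Euclidean metric. $\mathrm{PL}(S^n)$ is the group of homeomorphisms of $S^n$ that are affine on each simplex of some finite triangulation (simplices being sub-simplices of $\Delta_\pm$), with the compact-open topology. $CS(S^n)$ is the space of closed subsets of $S^n$ with the Hausdorff topology. $\mathrm{Mon}(PSL_2(\mathbb Z),\mathrm{PL}(S^n))$ is the space of injective homomorphisms with the algebraic topology (two monomorphisms are close if they send the generators of $PSL_2(\mathbb Z)$ to nearby elements of $\mathrm{PL}(S^n)$). A compact $\Lambda\subset S^n$ is the limit set of a subgroup $H\subset\mathrm{PL}(S^n)$ if $H$ preserves $\Lambda$, every $H$-orbit in $\Lambda$ is dense in $\Lambda$, and for every compact $K\subset S^n\setminus\Lambda$ only finitely many $h\in H$ satisfy $h(K)\cap K\ne\emptyset$. *)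

(* Defs.v *)
From HB Require Import structures.
From mathcomp Require Import all_boot all_order all_algebra.
From mathcomp Require Import boolp classical_sets reals.
From Stdlib Require Import Relations.

Set Implicit Arguments.
Unset Strict Implicit.
Unset Printing Implicit Defensive.

Import Order.TTheory GRing.Theory Num.Theory.
Local Open Scope ring_scope.
Local Open Scope classical_set_scope.

Section ModularPatterns.
Variable R : realType.

(* The modular group.  PSL_2(Z) = SL_2(Z)/{+-1}; elements are represented  *)
(* by integer 2x2 matrices of determinant 1, identified up to sign.        *)
Definition isSL (A : 'M[int]_2) : Prop := \det A = 1.
Definition psl_eq (A B : 'M[int]_2) : Prop := A = B \/ A = - B.

Definition finite_psl (P : 'M[int]_2 -> Prop) : Prop :=
  exists L : seq 'M[int]_2,
    forall A, isSL A -> P A -> exists2 B, B \in L & psl_eq A B.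

Definition mx2 (a b c d : int) : 'M[int]_2 :=
  \matrix_(i < 2, j < 2)
     (if i == 0 then (if j == 0 then a else b) else (if j == 0 then c else d)).

(* standard generators of PSL_2(Z): S (order 2) and U = ST (order 3) *)
Definition genS : 'M[int]_2 := mx2 0 (-1) 1 0.
Definition genU : 'M[int]_2 := mx2 0 (-1) 1 1.

(* The ideal boundary S^1 of H^2, as the projective line R u {oo}         *)
(* (None = oo), with the Moebius action of PSL_2(Z).                       *)
Definition P1 := option R.

Definition ent (A : 'M[int]_2) (i j : 'I_2) : R := (A i j)%:~R.

Definition mob (A : 'M[int]_2) (p : P1) : P1 :=
  match p with
  | Some x =>
      let den := ent A 1 0 * x + ent A 1 1 in
      if den == 0 then None else Some ((ent A 0 0 * x + ent A 0 1) / den)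
  | None => if ent A 1 0 == 0 then None else Some (ent A 0 0 / ent A 1 0)
  end.

(* topology of S^1: the chordal metric via the stereographic identification
   of R u {oo} with the unit circle *)
Definition stereo (p : P1) : R * R :=
  match p with
  | Some x => (2 * x / (1 + x ^+ 2), (x ^+ 2 - 1) / (1 + x ^+ 2))
  | None => (0, 1)
  end.

Definition cdist (p q : P1) : R :=
  Num.sqrt (((stereo p).1 - (stereo q).1) ^+ 2 + ((stereo p).2 - (stereo q).2) ^+ 2).

(* Complete geodesics of H^2 = unordered pairs of distinct ideal points.  *)
Definition geod_of (p q : P1) : set P1 := [set x | x = p \/ x = q].

Definition is_geod (g : set P1) : Prop := exists p q, p <> q /\ g = geod_of p q.

Definition gact (A : 'M[int]_2) (g : set P1) : set P1 := mob A @` g.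

Definition modular_pattern (Gam : set (set P1)) : Prop :=
  (forall g, Gam g -> is_geod g) /\
  (forall A g, isSL A -> Gam g -> Gam (gact A g)) /\
  (exists (m : nat) (reps : 'I_m -> set P1),
      (forall i, Gam (reps i)) /\
      forall g, Gam g -> exists i A, isSL A /\ g = gact A (reps i)) /\
  (forall g, Gam g -> ~ finite_psl (fun A => gact A g = g)).

(* geodesics crossing the edge of the modular tiling T joining 0 and oo *)
Definition crosses_edge (g : set P1) : Prop :=
  exists p q : R, p * q < 0 /\ g = geod_of (Some p) (Some q).

(* exactly k geodesics of Gam cross the edge (0,oo), i.e. |Gam| = k + 1 *)
Definition crossing_count (Gam : set (set P1)) (k : nat) : Prop :=
  exists e : 'I_k -> set P1,
    injective e /\ (forall i, Gam (e i) /\ crosses_edge (e i)) /\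
    (forall g, Gam g -> crosses_edge g -> exists i, e i = g).

Definition box (Gam : set (set P1)) (f : set P1 -> R) : Prop :=
  (forall g, Gam g -> 0 < f g <= 1) /\
  (forall A g, isSL A -> Gam g -> f (gact A g) = f g).

Definition level1 (Gam : set (set P1)) (f : set P1 -> R) : set (set P1) :=
  [set g | Gam g /\ f g = 1].

(* p ~ q iff p = q or p, q are the endpoints of a geodesic of Gam' ;
   Q_{Gam'} is the quotient of S^1 by the equivalence relation generated *)
Definition pat_rel (Gam' : set (set P1)) (p q : P1) : Prop :=
  p = q \/ exists g, Gam' g /\ p <> q /\ g = geod_of p q.

Definition pat_eqv (Gam' : set (set P1)) : relation P1 :=
  clos_refl_sym_trans P1 (pat_rel Gam').

(* The sphere S^n = Delta_+ u Delta_-, glued along the boundary.           *)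
(* A point is a pair (side, x) with x in the standard n-simplex in         *)
(* R^{n+1}; boundary points are normalised to side = true.                 *)
Definition spt (n : nat) := (bool * ('I_n.+1 -> R))%type.

Definition in_simplex (m : nat) (x : 'I_m -> R) : Prop :=
  (forall i, 0 <= x i) /\ \sum_i x i = 1.

Definition on_bdry (n : nat) (x : 'I_n.+1 -> R) : Prop := exists i, x i = 0.

Definition Sn (n : nat) : set (spt n) :=
  [set p | in_simplex p.2 /\ (on_bdry p.2 -> p.1 = true)].

Definition mkpt (n : nat) (s : bool) (x : 'I_n.+1 -> R) : spt n :=
  (if pselect (on_bdry x) then true else s, x).

Definition enorm (n : nat) (x : 'I_n.+1 -> R) : R := Num.sqrt (\sum_i x i ^+ 2).
Definition dvec (n : nat) (x y : 'I_n.+1 -> R) : 'I_n.+1 -> R := fun i => x i - y i.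

(* d(p,q) < e for the piecewise Euclidean (path) metric of S^n *)
Definition sdist_lt (n : nat) (p q : spt n) (e : R) : Prop :=
  (p.1 = q.1 /\ enorm (dvec p.2 q.2) < e) \/
  (exists z, in_simplex z /\ on_bdry z /\
             enorm (dvec p.2 z) + enorm (dvec z q.2) < e).

Definition openS (n : nat) (U : set (spt n)) : Prop :=
  forall p, @Sn n p -> U p ->
    exists2 d : R, 0 < d & forall q, @Sn n q -> sdist_lt p q d -> U q.

Definition closedS (n : nat) (K : set (spt n)) : Prop :=
  K `<=` @Sn n /\ openS (@Sn n `\` K).

Definition compactS (n : nat) (K : set (spt n)) : Prop :=
  K `<=` @Sn n /\
  forall (I : Type) (U : I -> set (spt n)),
    (forall i, openS (U i)) -> (forall p, K p -> exists i, U i p) ->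
    exists (m : nat) (c : 'I_m -> I), forall p, K p -> exists j, U (c j) p.

Definition contS (n : nat) (h : spt n -> spt n) : Prop :=
  forall p, @Sn n p -> forall e : R, 0 < e ->
    exists2 d : R, 0 < d & forall q, @Sn n q -> sdist_lt p q d -> sdist_lt (h p) (h q) e.

Definition homeoS (n : nat) (h : spt n -> spt n) : Prop :=
  (forall p, @Sn n p -> @Sn n (h p)) /\
  exists g : spt n -> spt n,
    (forall p, @Sn n p -> @Sn n (g p)) /\
    (forall p, @Sn n p -> g (h p) = p /\ h (g p) = p) /\
    contS h /\ contS g.

Definition bary (n : nat) (v : 'I_n.+1 -> 'I_n.+1 -> R) (lam : 'I_n.+1 -> R) :
  'I_n.+1 -> R := fun i => \sum_j lam j * v j i.

Definition simplex_pt (n : nat) (s : bool) (v : 'I_n.+1 -> 'I_n.+1 -> R)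
  (lam : 'I_n.+1 -> R) : spt n := mkpt s (bary v lam).

Definition aff_indep (n : nat) (v : 'I_n.+1 -> 'I_n.+1 -> R) : Prop :=
  forall c : 'I_n.+1 -> R,
    \sum_j c j = 0 -> (forall i, \sum_j c j * v j i = 0) -> forall j, c j = 0.

Definition sface (n : nat) (s : bool) (v : 'I_n.+1 -> 'I_n.+1 -> R)
  (W : set 'I_n.+1) : set (spt n) :=
  [set p | exists lam, in_simplex lam /\ (forall j, ~ W j -> lam j = 0) /\
                       p = simplex_pt s v lam].

Definition ssimplex (n : nat) (s : bool) (v : 'I_n.+1 -> 'I_n.+1 -> R) : set (spt n) :=
  sface s v setT.

Definition triangulation (n m : nat) (side : 'I_m -> bool)
  (vert : 'I_m -> 'I_n.+1 -> 'I_n.+1 -> R) : Prop :=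
  (forall j k, in_simplex (vert j k)) /\
  (forall j, aff_indep (vert j)) /\
  (forall p, @Sn n p -> exists j, ssimplex (side j) (vert j) p) /\
  (forall j k, exists Wj Wk : set 'I_n.+1,
      ssimplex (side j) (vert j) `&` ssimplex (side k) (vert k)
        = sface (side j) (vert j) Wj /\
      ssimplex (side j) (vert j) `&` ssimplex (side k) (vert k)
        = sface (side k) (vert k) Wk).

Definition PLS (n : nat) (h : spt n -> spt n) : Prop :=
  homeoS h /\
  exists (m : nat) (side : 'I_m -> bool) (vert : 'I_m -> 'I_n.+1 -> 'I_n.+1 -> R),
    triangulation side vert /\
    forall j, exists (t : bool) (M : 'I_n.+1 -> 'I_n.+1 -> R) (c : 'I_n.+1 -> R),
      forall lam, in_simplex lam ->
        h (simplex_pt (side j) (vert j) lam) =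
        mkpt t (fun i => \sum_l M i l * bary (vert j) lam l + c i).

Definition mono_PL (n : nat) (r : 'M[int]_2 -> spt n -> spt n) : Prop :=
  (forall A, isSL A -> PLS (r A)) /\
  (forall A, isSL A -> forall p, @Sn n p -> r (- A) p = r A p) /\
  (forall A B, isSL A -> isSL B -> forall p, @Sn n p -> r (A *m B) p = r A (r B p)) /\
  (forall A, isSL A -> (forall p, @Sn n p -> r A p = p) -> psl_eq A 1%:M).

Definition limit_set (n : nat) (r : 'M[int]_2 -> spt n -> spt n) (Lam : set (spt n))
  : Prop :=
  compactS Lam /\
  (forall A, isSL A -> forall p, Lam p -> Lam (r A p)) /\
  (forall p q, Lam p -> Lam q -> forall e : R, 0 < e ->
      exists A, isSL A /\ sdist_lt (r A p) q e) /\
  (forall K, compactS K -> K `<=` @Sn n `\` Lam ->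
      finite_psl (fun A => exists p, K p /\ K (r A p))).

Definition hclose (n : nat) (A B : set (spt n)) (e : R) : Prop :=
  (forall p, A p -> exists q, B q /\ sdist_lt p q e) /\
  (forall q, B q -> exists p, A p /\ sdist_lt q p e).

(* Lam is homeomorphic to the quotient Q_{Gam'} = S^1 / ~ : a map phi from
   S^1 inducing a bijection Q -> Lam which is continuous for the quotient
   topology (i.e. phi continuous) with continuous inverse (i.e. images of
   saturated open sets are open in Lam) *)
Definition openP (V : set P1) : Prop :=
  forall p, V p -> exists2 d : R, 0 < d & forall q, cdist p q < d -> V q.

Definition homeomorphic_to_quotient (n : nat) (Gam' : set (set P1))
  (Lam : set (spt n)) : Prop :=
  exists phi : P1 -> spt n,
    (forall p, Lam (phi p)) /\
    (forall q, Lam q -> exists p, phi p = q) /\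
    (forall p p', phi p = phi p' <-> pat_eqv Gam' p p') /\
    (forall p (e : R), 0 < e -> exists2 d : R, 0 < d &
        forall q, cdist p q < d -> sdist_lt (phi p) (phi q) e) /\
    (forall V, openP V -> (forall p p', pat_eqv Gam' p p' -> V p -> V p') ->
       forall q, (phi @` V) q ->
         exists2 d : R, 0 < d & forall q', Lam q' -> sdist_lt q q' d -> (phi @` V) q').

End ModularPatterns.

(* Main.v *)
From mathcomp Require Import fingroup perm.
Require Import Defs.
From HB Require Import structures.
From Stdlib Require Import Relations.
From mathcomp Require Import all_boot all_order all_algebra.
From mathcomp Require Import boolp classical_sets reals.
From mathcomp Require Import ring lra zify.
Set Implicit Arguments.
Unset Strict Implicit.
Unset Printing Implicit Defensive.
Import Order.TTheory GRing.Theory Num.Theory.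
Local Open Scope ring_scope.
Local Open Scope classical_set_scope.

(** The vertices of the n-simplex are labelled by the two cusps of the edge (0, oo) of the modular
    tiling and by the n - 1 geodesics of the pattern crossing that edge.  S exchanges the two copies
    of the simplex and permutes the labels.  U is realised by writing the sphere as a join of
    triangles, one for each pair of labels lying over the two sides of the ideal triangle
    (0, -1, oo) other than the base edge, and by rotating every triangle after a distortion of size
    s = (1 - f) / 4 depending on the geodesic.  The words S U and S U U then act on one copy of the
    simplex by stochastic matrices; their products contract, because two distinct labels have
    distinct itineraries (a geodesic is determined by its cutting sequence), so every Stern-Brocot
    path has a limit point, and the limit set is the set of these points.  A vertex v is a limit
    point exactly when s v = 0, and it is then the image of both end points of the geodesic
    labelled v: this is the only way in which the map from the circle to the limit set fails to be
    injective, which identifies the limit set with the quotient by the geodesics where f = 1. *)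


(** The base simplex is the join of the base edges of the triangles, so the rest of the join has to
    fill exactly one other simplex. The map [bend] does this: given [eps], the coefficient [beta] is
    forced by coordinates summing to 1, and [eps < beta] makes all coordinates positive off the
    base. This positivity is also the source of contraction. Each triangle is turned by a conjugate
    of a rotation, so order three is automatic; the conjugating map is the identity where the
    rotated base edge lands, which makes U and U U linear on the base simplex. The obstacle is that
    matrix entries have no uniform lower bound: the two cusps always have s = 0, so some vertices
    are sent to vertices by arbitrarily long words. What survives is a bound below on a whole
    column, namely the column of a vertex that persists longest, and a bounded column suffices for
    contraction in the l1 distance. A second obstacle is that [PLS] asks for a genuine triangulation
    of the doubled simplex. Maps are therefore described by finite lists of hyperplanes, closed
    under composition, and a triangulation adapted to such a list is built once, by splitting
    edges. *)

(** * Triangulations of a simplex and the subdivision of an edge *)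

Section Triangulations.
Variables (R : realType) (n : nat).
Local Notation pt := ('I_n.+1 -> R).
Local Notation mx := 'M[R]_n.+1.
Local Notation rv := 'rV[R]_n.+1.

Definition lin (l : rv) (x : pt) : R := \sum_i l 0 i * x i.

Lemma sum_delta (j : 'I_n.+1) (al : pt) : \sum_i (i == j)%:R * al i = al j.
Proof.
by rewrite (bigD1 j) //= eqxx mul1r big1 ?addr0 // => l /negbTE ->; rewrite mul0r.
Qed.

Lemma delta_simplex (j : 'I_n.+1) : in_simplex (fun i : 'I_n.+1 => (i == j)%:R : R).
Proof.
split=> [i|]; first by rewrite ler0n.
by rewrite -[RHS](sum_delta j (fun=> 1)); apply: eq_bigr => i _; rewrite mulr1.
Qed.

(** Cells are closed, so a point on a hyperplane lies in several of them; [sg] is any choice of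
    signs, and many cells are empty. *)
Definition cell (Phi : seq rv) (sg : rv -> bool) (x : pt) : Prop :=
  forall l, l \in Phi -> if sg l then 0 <= lin l x else lin l x <= 0.

Definition wt (lam : pt) (V : mx) (r : rv) : R :=
  \sum_i lam i * (row i V == r)%:R.

(* The last clause says that barycentric coordinates, read as weights on the
   vertex points, do not depend on the simplex: this is equivalent to simplices
   meeting along common faces, and is stable under subdivision. *)
Definition simplicial (T : seq mx) : Prop :=
  [/\ forall V, V \in T -> forall j, in_simplex (V j),
      forall V, V \in T -> forall c : pt,
        (forall i, bary V c i = 0) -> forall j, c j = 0,
      forall x : pt, in_simplex x ->
        exists V, exists2 lam, V \in T /\ in_simplex lam & x = bary V lam
    & forall V W lam mu, V \in T -> W \in T -> in_simplex lam -> in_simplex mu ->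
        bary V lam = bary W mu -> wt lam V =1 wt mu W].

Definition refines (T' T : seq mx) : Prop :=
  forall V', V' \in T' -> exists V, exists2 E : mx,
    V \in T /\ (forall i, in_simplex (E i)) & V' = E *m V.

Definition vertex_of (V : mx) (r : rv) : Prop := exists j, row j V = r.

Lemma row_inj (V : mx) :
  (forall c : pt, (forall i, bary V c i = 0) -> forall j, c j = 0) ->
  injective (fun j => row j V).
Proof.
move=> HV j k Ejk; apply/eqP/negPn/negP => jk.
have := HV (fun i => (i == j)%:R - (i == k)%:R) _ j.
rewrite eqxx (negbTE jk) subr0 => H; have /eqP : (1 : R) = 0.
  apply: H => i; rewrite /bary.
  under eq_bigr do rewrite mulrBl.
  rewrite sumrB !sum_delta.
  by have := congr1 (fun r : rv => r 0 i) Ejk; rewrite !mxE => ->; rewrite subrr.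
by rewrite oner_eq0.
Qed.

Definition repl (V : mx) (j : 'I_n.+1) (c : rv) : mx :=
  \matrix_(i, k) if i == j then c 0 k else V i k.

Lemma row_repl V j c i : row i (repl V j c) = if i == j then c else row i V.
Proof. by apply/rowP => k; rewrite !mxE; case: (i == j); rewrite ?mxE. Qed.

(** Change of barycentric coordinates: [lam] refers to the simplex whose vertex [ja] has been moved
    to the point dividing the edge from [ja] to [jb] in the ratio t, and the result refers to the
    old simplex. *)
Definition push (ja jb : 'I_n.+1) (t : R) (lam : pt) : pt := fun i =>
  if i == ja then (1 - t) * lam ja
  else if i == jb then lam jb + t * lam ja else lam i.

Lemma sum_push ja jb t (lam al : pt) : ja != jb ->
  \sum_i push ja jb t lam i * al i =
  \sum_i lam i * (if i == ja then (1 - t) * al ja + t * al jb else al i).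
Proof.
move=> jab; rewrite (bigD1 ja) //= (bigD1 jb) /=; last by rewrite eq_sym.
rewrite [RHS](bigD1 ja) //= [in RHS](bigD1 jb) /=; last by rewrite eq_sym.
rewrite /push !eqxx [jb == ja]eq_sym (negbTE jab).
rewrite (eq_bigr (fun i => lam i * (if i == ja then (1 - t) * al ja + t * al jb else al i))).
  by ring.
by move=> i /andP[/negbTE -> /negbTE ->].
Qed.

Section Edge.
Variables (V : mx) (ja jb : 'I_n.+1) (t : R).
Hypothesis jab : ja != jb.
Hypothesis t01 : 0 < t < 1.
Let a := row ja V.
Let b := row jb V.
Let c := (1 - t) *: a + t *: b.
Let V' := repl V ja c.

Lemma push_simplex lam : in_simplex lam -> in_simplex (push ja jb t lam).
Proof.
move=> [l0 l1]; split => [i|].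
  have /andP[t0 t1] := t01; rewrite /push.
  case: ifP => _; first by rewrite mulr_ge0 // subr_ge0 ltW.
  by case: ifP => _ //; rewrite addr_ge0 // mulr_ge0 // ltW.
have /= := @sum_push ja jb t lam (fun=> 1) jab.
under eq_bigr do rewrite mulr1.
move=> ->; rewrite -[RHS]l1; apply: eq_bigr => i _.
by case: (i == ja); rewrite !mulr1 ?subrK ?mulr1.
Qed.

Lemma bary_push lam i : bary V (push ja jb t lam) i = bary V' lam i.
Proof.
rewrite /bary sum_push //; apply: eq_bigr => j _; congr (_ * _).
by rewrite /V' !mxE; case: (j == ja); rewrite ?mxE.
Qed.

Lemma wt_push lam r : ~ vertex_of V c ->
  wt (push ja jb t lam) V r =
  (r != c)%:R * wt lam V' r + wt lam V' c * ((1 - t) * (a == r)%:R + t * (b == r)%:R).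
Proof.
move=> Hc; rewrite /wt sum_push //.
have Hc' i : (row i V == c) = false by apply/negP => /eqP E; apply: Hc; exists i.
have -> : \sum_i lam i * (row i V' == c)%:R = lam ja.
  rewrite (bigD1 ja) //= big1 ?row_repl ?eqxx ?mulr1 ?addr0 // => i ij.
  by rewrite row_repl (negbTE ij) Hc' mulr0.
rewrite (bigD1 ja) //= eqxx addrC; congr (_ + _) => //.
rewrite mulr_sumr [RHS](bigD1 ja) //= row_repl eqxx.
have -> : (r != c)%:R * (lam ja * (c == r)%:R) = 0 :> R.
  by rewrite eq_sym; case: (c == r); rewrite ?mul0r ?mulr0.
rewrite add0r; apply: eq_bigr => i ij; rewrite (negbTE ij) row_repl (negbTE ij).
case: (altP (r =P c)) => [->|]; last by rewrite mul1r.
by rewrite Hc' !mulr0.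
Qed.

Lemma free_repl :
  (forall c : pt, (forall i, bary V c i = 0) -> forall j, c j = 0) ->
  forall c : pt, (forall i, bary V' c i = 0) -> forall j, c j = 0.
Proof.
move=> HV lam Hl; have Hp := HV (push ja jb t lam) _.
have {}Hp : forall j, push ja jb t lam j = 0 by apply: Hp => i; rewrite bary_push.
have la : lam ja = 0.
  have /andP[_ t1] := t01; have := Hp ja; rewrite /push eqxx => /eqP.
  by rewrite mulf_eq0 subr_eq0 gt_eqF //= => /eqP.
move=> j; have := Hp j; rewrite /push.
case: eqP => [->|_]; first by [].
by case: eqP => [->|_ //]; rewrite la mulr0 addr0.
Qed.

Lemma repl_simplex : (forall j, in_simplex (V j)) -> forall j, in_simplex (V' j).
Proof.
move=> HV j; rewrite /V' /repl; have /andP[t0 t1] := t01; have [[a0 a1] [b0 b1]] := (HV ja, HV jb).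
case: (eqVneq j ja) => [->|jja].
  split => [i|].
    rewrite mxE eqxx /c !mxE.
    by rewrite addr_ge0 // mulr_ge0 ?subr_ge0 // ltW.
  under eq_bigr do rewrite mxE eqxx /c !mxE.
  by rewrite big_split /= -!mulr_sumr a1 b1; lra.
have [v0 v1] := HV j; split => [i|]; first by rewrite mxE (negbTE jja).
by under eq_bigr do rewrite mxE (negbTE jja).
Qed.

Lemma repl_mulmx : exists2 E : mx, (forall i, in_simplex (E i)) & V' = E *m V.
Proof.
have /andP[t0 t1] := t01.
exists (\matrix_(i, k) if i == ja then (1 - t) * (k == ja)%:R + t * (k == jb)%:R
                       else (k == i)%:R).
  move=> i; split => [k|].
    by rewrite mxE; case: ifP; case: (k == ja); case: (k == jb); case: (k == i) => //= *; lra.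
  have D j : \sum_(k < n.+1) (k == j)%:R = 1 :> R by have [] := delta_simplex j.
  under eq_bigr do rewrite mxE.
  by case: (i == ja); rewrite ?D // big_split /= -!mulr_sumr !D; lra.
apply/matrixP => i k; rewrite !mxE.
have D j : \sum_(l < n.+1) (l == j)%:R * V l k = V j k.
  exact: (sum_delta j (fun l => V l k)).
under eq_bigr do rewrite mxE.
case: (i == ja); last by rewrite D.
under eq_bigr do rewrite mulrDl -!mulrA.
by rewrite big_split /= -!mulr_sumr !D ?mxE.
Qed.

(** The inequality places the point on the [b] side of the hyperplane through [c] and the vertices
    other than [a] and [b]; solving [push] for [mu] then gives non-negative coordinates. *)
Lemma cover_repl lam : in_simplex lam -> lam ja * t <= lam jb * (1 - t) ->
  exists2 mu, in_simplex mu & bary V lam = bary V' mu.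
Proof.
move=> [l0 l1] Hle; have /andP[t0 t1'] := t01.
pose mu : pt := fun i => if i == ja then lam ja / (1 - t)
  else if i == jb then lam jb - t * (lam ja / (1 - t)) else lam i.
have t1 : 1 - t != 0 by rewrite gt_eqF //; lra.
have Epush : push ja jb t mu = lam.
  apply/funext => i; rewrite /push /mu !eqxx [jb == ja]eq_sym (negbTE jab).
  case: eqP => [->|_]; first by field.
  by case: eqP => [->|_] //; ring.
have m0 i : 0 <= mu i.
  rewrite /mu; case: ifP => _; first by rewrite divr_ge0 //; lra.
  case: ifP => // _; rewrite subr_ge0 mulrA ler_pdivrMr; last by lra.
  by rewrite mulrC.
exists mu; last by apply/funext => i; rewrite -bary_push Epush.
split => //; rewrite -[RHS]l1.
have /= := @sum_push ja jb t mu (fun=> 1) jab; rewrite Epush.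
under eq_bigr do rewrite mulr1.
move=> ->; apply: eq_bigr => i _.
by case: (i == ja); rewrite !mulr1 ?subrK ?mulr1.
Qed.

End Edge.

Definition split_edge (a b c : rv) (V : mx) : seq mx :=
  if [pick j | row j V == a] is Some ja then
    if [pick j | row j V == b] is Some jb then [:: repl V ja c; repl V jb c]
    else [:: V]
  else [:: V].

Definition subdiv (a b c : rv) (T : seq mx) : seq mx :=
  flatten [seq split_edge a b c V | V <- T].

Lemma subdivP (a b c : rv) T V' : a != b -> V' \in subdiv a b c T ->
  exists2 V, V \in T &
   (V' = V /\ ~ (vertex_of V a /\ vertex_of V b)) \/
   exists ja jb, [/\ row ja V = a, row jb V = b, ja != jb &
      V' = repl V ja c \/ V' = repl V jb c].
Proof.
move=> ab /flatten_mapP[V VT]; rewrite /split_edge.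
case: pickP => [ja /eqP Ea|Na]; last first.
  rewrite inE => /eqP ->; exists V => //; left; split=> // -[[j Ej] _].
  by have := Na j; rewrite Ej eqxx.
case: pickP => [jb /eqP Eb|Nb]; last first.
  rewrite inE => /eqP ->; exists V => //; left; split=> // -[_ [j Ej]].
  by have := Nb j; rewrite Ej eqxx.
rewrite !inE => H; exists V => //; right; exists ja, jb; split => //.
  by apply: contra_neq ab => jj; rewrite -Ea -Eb jj.
by case/orP: H => /eqP ->; [left|right].
Qed.

(** After the split no simplex contains both [a] and [b], so one of these two weights vanishes, and
    this is what lets the weight at [c] be recovered from the old weights. The last clause, by which
    edges avoiding [c] are old edges, makes [cut_by] terminate. *)
Lemma subdiv_simplicial T V0 ja0 jb0 (t : R) : simplicial T -> V0 \in T ->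
  let a := row ja0 V0 in let b := row jb0 V0 in
  a != b -> 0 < t < 1 -> let c := (1 - t) *: a + t *: b in
  [/\ simplicial (subdiv a b c T), refines (subdiv a b c T) T &
      forall V', V' \in subdiv a b c T ->
        ~ (vertex_of V' a /\ vertex_of V' b) /\
        forall r1 r2, vertex_of V' r1 -> vertex_of V' r2 -> r1 != c -> r2 != c ->
          exists2 V, V \in T & vertex_of V r1 /\ vertex_of V r2].
Proof.
move=> [Ts Tf Tc Tu] V0T a b ab t01 c; have /andP[t0 t1] := t01.
have jab0 : ja0 != jb0 by apply: contra_neq ab => jj; rewrite /a /b jj.
have ac : a != c.
  apply: contra_neq ab => E; apply/rowP => i.
  have := congr1 (fun r : rv => r 0 i) E; rewrite !mxE => H.
  by apply: (@mulfI _ t); [rewrite gt_eqF //; lra | lra].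
have bc : b != c.
  apply: contra_neq ab => E; apply/rowP => i.
  have := congr1 (fun r : rv => r 0 i) E; rewrite !mxE => H.
  by apply: (@mulfI _ (1 - t)); [rewrite gt_eqF //; lra | lra].
have D := sum_delta; have Ds := delta_simplex.
(* Were [c] already a vertex, the same point would have weight 1 - t at [a] when read in [V0] and
   weight 0 when read in [V]. *)
have cT V : V \in T -> ~ vertex_of V c.
  move=> VT [j Ej].
  have E1 : bary V (fun i => (i == j)%:R) =
            bary V0 (push ja0 jb0 t (fun i => (i == ja0)%:R)).
    apply/funext => i; rewrite bary_push // /bary !D !mxE eqxx.
    by have := congr1 (fun r : rv => r 0 i) Ej; rewrite !mxE.
  have := Tu _ _ _ _ VT V0T (Ds j) (push_simplex jab0 t01 (Ds ja0)) E1 a.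
  rewrite /wt D Ej eq_sym (negbTE ac) sum_push // => H.
  have : (0 : R) = 1 - t.
    rewrite [LHS]H (bigD1 ja0) //= !eqxx big1 ?addr0; last first.
      by move=> i ij; rewrite (negbTE ij) mul0r.
    by rewrite eq_sym (negbTE ab) mul1r mulr1 mulr0 addr0.
  by lra.
have cE (V : mx) ja jb : row ja V = a -> row jb V = b ->
   c = (1 - t) *: row ja V + t *: row jb V by move=> -> ->.
have cE' (V : mx) ja jb : row ja V = a -> row jb V = b ->
   c = (1 - (1 - t)) *: row jb V + (1 - t) *: row ja V.
  by move=> -> ->; rewrite subKr addrC.
have t01' : 0 < 1 - t < 1 by lra.
have wt0 lam V r : ~ vertex_of V r -> wt lam V r = 0.
  move=> Hr; rewrite /wt big1 // => i _; case: eqP => [E|_]; last by rewrite mulr0.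
  by case: Hr; exists i.
have rN V ja r : V \in T -> row ja V = r -> r != c -> ~ vertex_of (repl V ja c) r.
  move=> VT Ea rc [j]; rewrite row_repl; case: eqP => [_ E|/eqP jj E].
    by move/eqP: rc; rewrite E.
  by move/eqP: jj; apply; apply: (row_inj (Tf _ VT)); rewrite E Ea.
have Hw V' lam : V' \in subdiv a b c T -> in_simplex lam ->
  exists V mu, [/\ V \in T, in_simplex mu, bary V mu = bary V' lam,
    (forall r, wt mu V r = (r != c)%:R * wt lam V' r +
       wt lam V' c * ((1 - t) * (a == r)%:R + t * (b == r)%:R)) &
    wt lam V' a = 0 \/ wt lam V' b = 0].
  move=> /(subdivP ab) [V VT [[-> Nab] ls|[ja [jb [Ea Eb jab [->|->]]]] ls]].
  - exists V, lam; split => // [r|].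
      rewrite (wt0 _ _ c (cT V VT)) mul0r addr0.
      by case: (altP (r =P c)) => [->|_]; rewrite ?mul1r // mul0r wt0 //; apply: cT.
    case: (pselect (vertex_of V a)) => [va|/(wt0 lam) ->]; last by left.
    by right; apply: wt0 => vb; apply: Nab.
  - exists V, (push ja jb t lam); split => //.
    + exact: push_simplex.
    + by apply/funext => i; rewrite bary_push // -(cE _ _ _ Ea Eb).
    + move=> r; rewrite wt_push // -?(cE _ _ _ Ea Eb) ?Ea ?Eb //; exact: cT.
    + by left; apply: wt0; apply: rN.
  - have jba : jb != ja by rewrite eq_sym.
    exists V, (push jb ja (1 - t) lam); split => //.
    + exact: push_simplex.
    + by apply/funext => i; rewrite bary_push // -(cE' _ _ _ Ea Eb).
    + move=> r; rewrite wt_push // -?(cE' _ _ _ Ea Eb) ?Ea ?Eb; last exact: cT.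
      by rewrite subKr [X in wt _ _ c * X]addrC.
    + by right; apply: wt0; apply: rN.
have wtge lam V r : in_simplex lam -> 0 <= wt lam V r.
  by move=> [l0 _]; apply: sumr_ge0 => i _; rewrite mulr_ge0.
split.
- split.
  + move=> V' /(subdivP ab) [V VT [[-> _]|[ja [jb [Ea Eb jab [->|->]]]]]].
    * exact: Ts.
    * by rewrite (cE _ _ _ Ea Eb); apply: repl_simplex => //; apply: Ts.
    * by rewrite (cE' _ _ _ Ea Eb); apply: repl_simplex => //; apply: Ts.
  + move=> V' /(subdivP ab) [V VT [[-> _]|[ja [jb [Ea Eb jab [->|->]]]]]].
    * exact: Tf.
    * by rewrite (cE _ _ _ Ea Eb); apply: free_repl => //; apply: Tf.
    * by rewrite (cE' _ _ _ Ea Eb); apply: free_repl; rewrite 1?eq_sym //; apply: Tf.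
  + move=> x /Tc [V [lam [VT ls] Ex]].
    case E1: [pick j | row j V == a] => [ja|]; last first.
      exists V, lam => //; split => //; apply/flatten_mapP; exists V => //.
      by rewrite /split_edge E1 inE.
    case E2: [pick j | row j V == b] => [jb|]; last first.
      exists V, lam => //; split => //; apply/flatten_mapP; exists V => //.
      by rewrite /split_edge E1 E2 inE.
    have Ea : row ja V = a by move: E1; case: pickP => // j /eqP Ej [<-].
    have Eb : row jb V = b by move: E2; case: pickP => // j /eqP Ej [<-].
    have jab : ja != jb by apply: contra_neq ab => jj; rewrite -Ea -Eb jj.
    case: (leP (lam ja * t) (lam jb * (1 - t))) => Hl.
      have [mu ms Em] := cover_repl V jab t01 ls Hl.
      exists (repl V ja c), mu; last by rewrite Ex Em -(cE _ _ _ Ea Eb).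
      split => //; apply/flatten_mapP; exists V => //.
      by rewrite /split_edge E1 E2 !inE eqxx.
    have jba : jb != ja by rewrite eq_sym.
    have [|mu ms Em] := @cover_repl V jb ja (1 - t) jba t01' lam ls; first by lra.
    exists (repl V jb c), mu; last by rewrite Ex Em -(cE' _ _ _ Ea Eb).
    split => //; apply/flatten_mapP; exists V => //.
    by rewrite /split_edge E1 E2 !inE eqxx orbT.
  + move=> V' W' lam mu /Hw HV /Hw HW ls ms Eb.
    have [V [l' [VT l's El Hl Zl]]] := HV _ ls.
    have [W [m' [WT m's Em Hm Zm]]] := HW _ ms.
    have Ewt := Tu _ _ _ _ VT WT l's m's (etrans El (etrans Eb (esym Em))).
    have H r : (r != c)%:R * wt lam V' r +
       wt lam V' c * ((1 - t) * (a == r)%:R + t * (b == r)%:R) =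
       (r != c)%:R * wt mu W' r +
       wt mu W' c * ((1 - t) * (a == r)%:R + t * (b == r)%:R).
      by rewrite -Hl -Hm Ewt.
    have Ha := H a; have Hb := H b.
    rewrite ac eqxx eq_sym (negbTE ab) /= in Ha.
    rewrite bc eqxx (negbTE ab) /= in Hb.
    (* The side with the smaller weight at [c] would have positive weights at both [a] and [b],
       against [Zl] or [Zm]. *)
    have Ec : wt lam V' c = wt mu W' c.
      have la := wtge lam V' a ls; have lb := wtge lam V' b ls.
      have ma := wtge mu W' a ms; have mb := wtge mu W' b ms.
      have t1' : 0 < 1 - t by lra.
      have Ha' : wt lam V' a - wt mu W' a = (1 - t) * (wt mu W' c - wt lam V' c) by lra.
      have Hb' : wt lam V' b - wt mu W' b = t * (wt mu W' c - wt lam V' c) by lra.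
      case: (ltgtP (wt lam V' c) (wt mu W' c)) => // Hlt.
        have : 0 < (1 - t) * (wt mu W' c - wt lam V' c) by rewrite mulr_gt0 // subr_gt0.
        have : 0 < t * (wt mu W' c - wt lam V' c) by rewrite mulr_gt0 // subr_gt0.
        by case: Zl => Z; lra.
      have : 0 < (1 - t) * (wt lam V' c - wt mu W' c) by rewrite mulr_gt0 // subr_gt0.
      have : 0 < t * (wt lam V' c - wt mu W' c) by rewrite mulr_gt0 // subr_gt0.
      by case: Zm => Z; lra.
    move=> r; case: (altP (r =P c)) => [->|rc] //.
    by have := H r; rewrite rc Ec !mul1r => /addIr.
- move=> V' /(subdivP ab) [V VT [[-> _]|[ja [jb [Ea Eb jab [->|->]]]]]].
  + exists V, 1%:M; last by rewrite mul1mx.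
    split=> // i; have [H0 H1] := Ds i; split=> [j|].
      by rewrite mxE ler0n.
    by rewrite -[RHS]H1; apply: eq_bigr => j _; rewrite mxE eq_sym.
  + have [E HE HE'] := @repl_mulmx V ja jb t t01.
    by exists V, E => //; rewrite (cE _ _ _ Ea Eb).
  + have [E HE HE'] := @repl_mulmx V jb ja (1 - t) t01'.
    by exists V, E => //; rewrite (cE' _ _ _ Ea Eb).
- move=> V' /(subdivP ab) [V VT [[-> Nab]|[ja [jb [Ea Eb jab Hr]]]]].
    by split => // r1 r2 v1 v2 _ _; exists V.
  split.
    by case: Hr => -> [Ha Hb]; [apply: (rN V ja a)|apply: (rN V jb b)].
  have sub j r : vertex_of (repl V j c) r -> r != c -> vertex_of V r.
    by move=> [i]; rewrite row_repl; case: eqP => [_ -> /eqP|_ <- _] //; exists i.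
  by move=> r1 r2 v1 v2 c1 c2; exists V => //; case: Hr v1 v2 => -> v1 v2; split;
    apply: sub; eassumption.
Qed.

End Triangulations.

(** * Refinement along hyperplanes and triangulation of the doubled simplex *)

Section Refinement.
Variables (R : realType) (n : nat).
Local Notation pt := ('I_n.+1 -> R).
Local Notation mx := 'M[R]_n.+1.
Local Notation rv := 'rV[R]_n.+1.

Lemma lin_row (l : rv) (V : mx) j : lin l (row j V 0) = lin l (V j).
Proof. by apply: eq_bigr => i _; rewrite mxE. Qed.

Lemma lin_bary (l : rv) (V : mx) lam :
  lin l (bary V lam) = \sum_j lam j * lin l (V j).
Proof.
rewrite /lin /bary; under eq_bigr do rewrite mulr_sumr.
rewrite exchange_big /=; apply: eq_bigr => j _; rewrite mulr_sumr.
by apply: eq_bigr => i _; ring.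
Qed.

Lemma mulmx_bary (E V : mx) i : (E *m V) i = bary V (E i).
Proof. by apply/funext => k; rewrite mxE. Qed.

Lemma bary_simplex (V : mx) lam : (forall j, in_simplex (V j)) -> in_simplex lam ->
  in_simplex (bary V lam).
Proof.
move=> HV [l0 l1]; split=> [i|].
  by apply: sumr_ge0 => j _; rewrite mulr_ge0 //; have [] := HV j.
rewrite /bary exchange_big /= -[RHS]l1; apply: eq_bigr => j _.
by rewrite -mulr_sumr; have [_ ->] := HV j; rewrite mulr1.
Qed.

Lemma refines_refl (T : seq mx) : refines T T.
Proof.
move=> V VT; exists V, 1%:M; last by rewrite mul1mx.
split=> // i; have [H0 H1] := delta_simplex R i; split=> [j|].
  by rewrite mxE ler0n.
by rewrite -[RHS]H1; apply: eq_bigr => j _; rewrite mxE eq_sym.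
Qed.

Lemma refines_trans (T2 T1 T0 : seq mx) : refines T2 T1 -> refines T1 T0 -> refines T2 T0.
Proof.
move=> H2 H1 V2 /H2 [V1 [E2 [/H1 [V0 [E1 [V0T HE1] ->]] HE2] ->]].
exists V0, (E2 *m E1); last by rewrite mulmxA.
by split=> // i; rewrite mulmx_bary; apply: bary_simplex.
Qed.

Definition one_signed (l : rv) (V : mx) : Prop :=
  (forall j, 0 <= lin l (V j)) \/ (forall j, lin l (V j) <= 0).

Lemma refines_signed T' T l : refines T' T ->
  (forall V, V \in T -> one_signed l V) -> forall V, V \in T' -> one_signed l V.
Proof.
move=> Href HT V' /Href [V [E [VT HE] ->]].
by case: (HT V VT) => H; [left|right] => j; rewrite mulmx_bary lin_bary;
  [apply: sumr_ge0|apply: sumr_le0] => i _; have [E0 _] := HE j;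
  [rewrite mulr_ge0|rewrite mulr_ge0_le0].
Qed.

(** The list [L] bounds the edges that cross the hyperplane. Splitting one of them at its crossing
    point removes it everywhere, and the new vertex lies on the hyperplane, so no crossing edge is
    created and the list gets shorter. *)
Lemma cut_by (l : rv) (L : seq (rv * rv)) (T : seq mx) : simplicial T ->
  (forall V, V \in T -> forall ja jb, lin l (V ja) < 0 -> 0 < lin l (V jb) ->
     (row ja V, row jb V) \in L) ->
  exists2 T', simplicial T' /\ refines T' T & forall V, V \in T' -> one_signed l V.
Proof.
have [m] := ubnP (size L); elim: m L T => // m IH L T sL HT HL.
have [[V0 [ja [jb [V0T Ha Hb]]]]|Hno] := pselect (exists V0 ja jb,
    [/\ V0 \in T, lin l (V0 ja) < 0 & 0 < lin l (V0 jb)]); last first.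
  exists T; first by split=> //; apply: refines_refl.
  move=> V VT; have [Hn|Hn] := pselect (forall j, 0 <= lin l (V j)); first by left.
  right=> j; rewrite leNgt; apply/negP => Hj; apply: Hn => i.
  by rewrite leNgt; apply/negP => Hi; apply: Hno; exists V, i, j.
set la := lin l (V0 ja) in Ha; set lb := lin l (V0 jb) in Hb.
pose t := - la / (lb - la).
have D0 : 0 < lb - la by lra.
have t01 : 0 < t < 1 by rewrite /t divr_gt0 ?oppr_gt0 //= ltr_pdivrMr //; lra.
have ab : row ja V0 != row jb V0.
  apply: contraTneq Ha => E; rewrite -leNgt /la -lin_row E lin_row; exact: ltW.
have [HT' Href HV'] := subdiv_simplicial HT V0T ab t01.
move: HT' Href HV'; set c := _ + _; set T' := subdiv _ _ _ _ => HT' Href HV'.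
have lc : lin l (c 0) = 0.
  have -> : lin l (c 0) = (1 - t) * la + t * lb.
    rewrite /la /lb -!(lin_row l V0) /lin !mulr_sumr -big_split /=.
    by apply: eq_bigr => i _; rewrite !mxE; ring.
  by rewrite /t; field; rewrite gt_eqF.
have [||T'' [sT'' rT''] H''] := IH (rem (row ja V0, row jb V0) L) T' _ HT'.
- by rewrite size_rem ?HL //; move: sL; case: (L) (HL _ V0T _ _ Ha Hb) => //= *; lia.
- move=> V VT' i j Hi Hj; have [Nab Hr] := HV' V VT'.
  have [||||W WT [[wi Ei] [wj Ej]]] := Hr (row i V) (row j V).
  + by exists i.
  + by exists j.
  + by apply: contraTneq Hi => E; rewrite -leNgt -lin_row E lc.
  + by apply: contraTneq Hj => E; rewrite -leNgt -lin_row E lc.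
  have HinL : (row i V, row j V) \in L.
    rewrite -Ei -Ej; apply: HL => //.
      by rewrite -lin_row Ei lin_row.
    by rewrite -lin_row Ej lin_row.
  have [E|NE] := eqVneq (row i V, row j V) (row ja V0, row jb V0).
    by case: E => E1 E2; case: Nab; split; [exists i|exists j].
  have := perm_to_rem (HL _ V0T _ _ Ha Hb); move/perm_mem/(_ (row i V, row j V)).
  by rewrite HinL inE (negbTE NE) /= => <-.
exists T''; first by split=> //; apply: refines_trans rT'' Href.
exact: H''.
Qed.

Lemma simplicial1 : simplicial [:: 1%:M : mx].
Proof.
have D (lam : pt) : bary (1%:M : mx) lam = lam.
  apply/funext => i; rewrite /bary -[RHS](sum_delta i lam).
  by apply: eq_bigr => j _; rewrite mxE mulrC.
split.
- move=> V; rewrite inE => /eqP -> j; have [H0 H1] := delta_simplex R j.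
  split=> [i|]; first by rewrite mxE ler0n.
  by rewrite -[RHS]H1; apply: eq_bigr => i _; rewrite mxE eq_sym.
- by move=> V; rewrite inE => /eqP -> c H j; have := H j; rewrite D.
- by move=> x Hx; exists 1%:M, x; rewrite ?inE.
- by move=> V W lam mu; rewrite !inE => /eqP -> /eqP -> _ _; rewrite !D => ->.
Qed.

Lemma refinement (Phi : seq rv) :
  exists2 T : seq mx, simplicial T & forall V l, V \in T -> l \in Phi -> one_signed l V.
Proof.
elim: Phi => [|l Phi [T sT HT]]; first by exists [:: 1%:M] => //; apply: simplicial1.
pose L := flatten [seq [seq (row i V, row j V) | i <- enum 'I_n.+1, j <- enum 'I_n.+1] | V <- T].
have [|T' [sT' rT'] HT'] := @cut_by l L T sT.
  move=> V VT ja jb _ _; apply/flatten_mapP; exists V => //.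
  by apply/allpairsP; exists (ja, jb); rewrite !mem_enum.
exists T' => // V l' VT'; rewrite inE => /orP[/eqP ->|l'P]; first exact: HT'.
by apply: (refines_signed rT') => // W WT; apply: HT.
Qed.

Lemma mkpt_inj s s' (x x' : pt) : mkpt s x = mkpt s' x' ->
  x = x' /\ (s <> s' -> on_bdry x).
Proof.
rewrite /mkpt => -[H Ex]; rewrite -{}Ex in H *; split=> // ss.
by move: H; case: pselect => // Nb E; case: (ss E).
Qed.

Lemma mkpt_bdry s s' (x : pt) : on_bdry x -> mkpt s x = mkpt s' x.
Proof. by rewrite /mkpt; case: pselect. Qed.

Lemma mkptK (p : spt R n) : Sn p -> mkpt p.1 p.2 = p.
Proof.
case: p => s x [Hx Hb]; rewrite /mkpt /=; case: pselect => // Hx'.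
by have /= -> := Hb Hx'.
Qed.

Lemma mkpt_Sn s (x : pt) : in_simplex x -> Sn (mkpt s x).
Proof. by move=> Hx; split => //=; case: pselect. Qed.

(** A coordinate that is least at every vertex is least on the whole simplex, so the part of the
    simplex lying on the boundary of the big one is a face. This is what the gluing of the two
    copies along the boundary requires. *)
Definition has_least (V : mx) : Prop := exists i0, forall j i, V j i0 <= V j i.

(** The coordinate with the least sum over the vertices works: a comparison of constant but wrong
    sign must be an equality, because the sums compare the other way. *)
Lemma has_least_signed (V : mx) :
  (forall i k : 'I_n.+1, one_signed (\row_j ((j == i)%:R - (j == k)%:R)) V) -> has_least V.
Proof.
move=> H.
case: (@arg_minP _ _ _ ord0 xpredT (fun i => \sum_j V j i)) => // i0 _ Hmin.
exists i0 => j i.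
have E l : lin (\row_j ((j == i)%:R - (j == i0)%:R)) (V l) = V l i - V l i0.
  rewrite /lin -(sum_delta i (V l)) -(sum_delta i0 (V l)) -sumrB.
  by apply: eq_bigr => k _; rewrite mxE; ring.
case: (H i i0) => [/(_ j)|Hle]; first by rewrite E subr_ge0.
have Hs : \sum_j (V j i0 - V j i) = 0.
  apply/eqP; rewrite eq_le sumrB subr_le0 Hmin //=.
  by rewrite -sumrB sumr_ge0 // => l _; have := Hle l; rewrite E; lra.
have := psumr_eq0P _ Hs => /(_ _ j isT) H0.
have : V j i0 - V j i = 0 by apply: H0 => l _; have := Hle l; rewrite E; lra.
by lra.
Qed.

Lemma on_bdry_least (V : mx) i0 lam : (forall j, in_simplex (V j)) ->
  (forall j i, V j i0 <= V j i) -> in_simplex lam ->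
  on_bdry (bary V lam) <-> forall j, lam j * V j i0 = 0.
Proof.
move=> HV Hm [l0 l1]; split.
  move=> [i Hi] j; have : bary V lam i0 = 0.
    apply/eqP; rewrite eq_le; apply/andP; split.
      by rewrite -Hi; apply: ler_sum => k _; rewrite ler_wpM2l.
    by apply: sumr_ge0 => k _; rewrite mulr_ge0 //; have [] := HV k.
  move=> /psumr_eq0P -> // k _; rewrite mulr_ge0 //; have [] := HV k => //.
by move=> H; exists i0; rewrite /bary big1.
Qed.

(** Agreement of weights shows that a common point is carried by vertices common to both simplices.
    On different sides the point is moreover on the boundary, and by [on_bdry_least] only boundary
    vertices can then carry weight. *)
Lemma sface_meet (T : seq mx) s s' V V' : simplicial T ->
  (forall V, V \in T -> has_least V) -> V \in T -> V' \in T ->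
  ssimplex s V `&` ssimplex s' V' =
  sface s V [set j | vertex_of V' (row j V) /\ (s <> s' -> on_bdry (V j))].
Proof.
move=> [Ts Tf Tc Tu] Tm VT V'T; have [i0 Hi0] := Tm V VT.
apply/seteqP; split=> p.
  move=> [[lam [ls [_ ->]]] [mu [ms [_ /mkpt_inj [Eb Hb]]]]].
  exists lam; split=> //; split=> // j; have [l0 l1] := ls.
  have HW := Tu _ _ _ _ VT V'T ls ms Eb (row j V).
  apply: contra_notP => lj; split.
    apply: contrapT => Hv; apply: lj; move: HW; rewrite [RHS]big1; last first.
      by move=> i _; case: eqP => [E|]; [case: Hv; exists i|rewrite mulr0].
    rewrite /wt => /psumr_eq0P H; have := H _ j isT; rewrite eqxx mulr1; apply=> i _.
    by rewrite mulr_ge0.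
  move=> /Hb /(on_bdry_least (Ts _ VT) Hi0 ls) /(_ j) /eqP.
  by rewrite mulf_eq0 => /orP[/eqP/lj //|/eqP ?]; exists i0.
move=> [lam [ls [Hsupp ->]]]; split; first by exists lam; do 2![split=> //]; move=> j [].
have [l0 l1] := ls.
(* For the converse, [kap] matches each vertex of [V] that carries weight with the equal vertex of
   [V'], and [mu] transports the weights along it. *)
have /choice [kap Hk] : forall j, exists k, lam j <> 0 -> row k V' = row j V.
  move=> j; have [E|NE] := pselect (lam j = 0); first by exists j.
  have [[k Hk] _] : [set j | vertex_of V' (row j V) /\ (s <> s' -> on_bdry (V j))] j.
    by apply: contrapT => /Hsupp.
  by exists k.
pose mu : pt := fun k => \sum_j lam j * (kap j == k)%:R.
have Hmu (G : pt) : \sum_k mu k * G k = \sum_j lam j * G (kap j).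
  under eq_bigr do rewrite mulr_suml.
  rewrite exchange_big /=; apply: eq_bigr => j _.
  rewrite -(sum_delta (kap j) G) mulr_sumr; apply: eq_bigr => k _.
  by rewrite eq_sym; ring.
have Eb : bary V' mu = bary V lam.
  apply/funext => i; rewrite /bary (Hmu (fun k => V' k i)); apply: eq_bigr => j _.
  have [->|/eqP/Hk E] := eqVneq (lam j) 0; first by rewrite !mul0r.
  by have := congr1 (fun r : rv => r 0 i) E; rewrite !mxE => ->.
have ms : in_simplex mu.
  split=> [k|]; first by apply: sumr_ge0 => j _; rewrite mulr_ge0.
  have /= := Hmu (fun=> 1); under eq_bigr do rewrite mulr1.
  by move=> ->; under eq_bigr do rewrite mulr1.
exists mu; split=> //; split; [by move=> j []|rewrite /simplex_pt Eb].
have [<-//|ss] := eqVneq s s'; apply: mkpt_bdry.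
apply/(on_bdry_least (Ts _ VT) Hi0 ls) => j.
have [->|/eqP NE] := eqVneq (lam j) 0; first by rewrite mul0r.
have [_ Hb] : [set j | vertex_of V' (row j V) /\ (s <> s' -> on_bdry (V j))] j.
  by apply: contrapT => /Hsupp.
have [i Hi] := Hb (elimN eqP ss).
have -> : V j i0 = 0; last by rewrite mulr0.
by have [V0 _] := Ts _ VT j; apply/eqP; rewrite eq_le V0 andbT -Hi Hi0.
Qed.

Lemma double_triangulation (T : seq mx) : simplicial T ->
  (forall V, V \in T -> has_least V) ->
  exists m (side : 'I_m -> bool) (vert : 'I_m -> 'I_n.+1 -> pt),
    triangulation side vert /\ forall j, exists2 V, V \in T & vert j = V.
Proof.
move=> sT Tm; have [Ts Tf Tc Tu] := sT.
pose D := [seq (s, V) | s <- [:: true; false], V <- T].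
pose d := nth (true, 1%:M : mx) D.
have HD (j : 'I_(size D)) : (d j).2 \in T.
  have : d j \in D by rewrite mem_nth.
  by case/allpairsP => -[s V] /= [_ VT ->].
exists (size D), (fun j => (d j).1), (fun j => (d j).2); split; last by move=> j; exists (d j).2.
split; first by move=> j k; apply: Ts.
split; first by move=> j c _ Hc; apply: (Tf _ (HD j)).
split.
  move=> p Hp; have [V [lam [VT ls] E]] := Tc p.2 (proj1 Hp).
  have HinD : (p.1, V) \in D.
    by apply/allpairsP; exists (p.1, V); split=> //=; case: (p.1).
  have HiD : (index (p.1, V) D < size D)%N by rewrite index_mem.
  exists (Ordinal HiD) => /=; rewrite /d nth_index //=; exists lam; split=> //; split; first by move=> j [].
  by rewrite /simplex_pt -E mkptK.
move=> j k; eexists; eexists; split; first exact: (sface_meet _ _ sT Tm).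
by rewrite setIC; apply: (sface_meet _ _ sT Tm).
Qed.

End Refinement.

(** * Piecewise linear functions and maps described by hyperplanes *)

Section PiecewiseLinear.
Variables (R : realType) (n : nat).
Local Notation pt := ('I_n.+1 -> R).
Local Notation mx := 'M[R]_n.+1.
Local Notation rv := 'rV[R]_n.+1.

(** Only the values of [sg] on the finite list [Phi] matter. The finite list of pieces obtained this
    way is needed in order to add hyperplanes that depend on all pieces at once. *)
Lemma finite_choices (Phi : seq rv) (A : eqType) (P : (rv -> bool) -> A -> Prop) :
  (forall sg sg' a, {in Phi, sg =1 sg'} -> P sg a -> P sg' a) ->
  (forall sg, exists a, P sg a) ->
  exists As : seq A, forall sg, exists2 a, a \in As & P sg a.
Proof.
elim: Phi P => [|l Phi IH] P Hext Hex.
  have [a Pa] := Hex (fun=> true); exists [:: a] => sg; exists a; rewrite ?inE //.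
  exact: Hext Pa.
pose upd (sg : rv -> bool) b x := if x == l then b else sg x.
have Hupd b : exists As : seq A, forall sg, exists2 a, a \in As & P (upd sg b) a.
  apply: (IH (fun sg a => P (upd sg b) a)) => [sg sg' a E|sg]; last exact: Hex.
  by apply: Hext => x; rewrite inE /upd; case: eqP => //= _ /E ->.
have [[At Ht] [Af Hf]] := (Hupd true, Hupd false).
exists (At ++ Af) => sg.
have [a Ha Pa] : exists2 a, a \in At ++ Af & P (upd sg (sg l)) a.
  by case: (sg l); [have [a aA Pa] := Ht sg|have [a aA Pa] := Hf sg];
    exists a => //; rewrite mem_cat aA ?orbT.
by exists a => //; apply: Hext Pa => x _; rewrite /upd; case: eqP => [->|].
Qed.

Lemma cell_ext Phi (sg sg' : rv -> bool) (x : pt) :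
  {in Phi, sg =1 sg'} -> cell Phi sg x -> cell Phi sg' x.
Proof. by move=> E H l lP; rewrite -E //; apply: H. Qed.

Lemma cell_cat Phi1 Phi2 (sg : rv -> bool) (x : pt) :
  cell (Phi1 ++ Phi2) sg x -> cell Phi1 sg x /\ cell Phi2 sg x.
Proof. by move=> H; split=> l lP; apply: H; rewrite mem_cat lP ?orbT. Qed.

(** Linear forms are enough to describe affine functions, because coordinates sum to 1. Continuity
    is built in, since the closed cells overlap and the forms must agree there. *)
Definition PL (phi : pt -> R) : Prop := exists Phi, forall sg, exists al : rv,
  forall x, in_simplex x -> cell Phi sg x -> phi x = lin al x.

Lemma PL_pieces phi : PL phi -> exists Phi, exists As : seq rv, forall sg,
  exists2 al, al \in As & forall x, in_simplex x -> cell Phi sg x -> phi x = lin al x.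
Proof.
move=> [Phi H]; exists Phi; apply: (finite_choices (Phi := Phi) _ H) => sg sg' a E H' x Hx Hc.
by apply: H' => //; apply: cell_ext Hc => l lP; rewrite E.
Qed.

Lemma PL_ext phi psi : (forall x, in_simplex x -> phi x = psi x) -> PL phi -> PL psi.
Proof.
move=> E [Phi H]; exists Phi => sg; have [al Hal] := H sg.
by exists al => x Hx Hc; rewrite -E // Hal.
Qed.

Lemma PL_lin (al : pt) : PL (fun x => \sum_i al i * x i).
Proof.
exists [::] => sg; exists (\row_i al i) => x _ _.
by apply: eq_bigr => i _; rewrite mxE.
Qed.

Lemma PL_coord i : PL (fun x => x i).
Proof.
apply: (PL_ext _ (PL_lin (fun k => (k == i)%:R))) => x _; exact: sum_delta.
Qed.

Lemma PL_const c : PL (fun=> c).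
Proof.
apply: (PL_ext _ (PL_lin (fun=> c))) => x [_ E].
by rewrite -mulr_sumr E mulr1.
Qed.

(** The linear forms of all pieces of [psi] join the list of hyperplanes, so the sign of [psi] on a
    cell is read off from [sg]. *)
Lemma PL_if psi phi1 phi2 phi : PL psi -> PL phi1 -> PL phi2 ->
  (forall x, in_simplex x -> 0 <= psi x -> phi x = phi1 x) ->
  (forall x, in_simplex x -> psi x <= 0 -> phi x = phi2 x) -> PL phi.
Proof.
move=> /PL_pieces [Phi0 [As H0]] [Phi1 H1] [Phi2 H2] E1 E2.
exists (Phi0 ++ Phi1 ++ Phi2 ++ As) => sg.
have [ga gaA Hga] := H0 sg; have [al Hal] := H1 sg; have [be Hbe] := H2 sg.
case Eg: (sg ga); [exists al|exists be] => x Hx /cell_cat [/(Hga x Hx) Eps];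
  move=> /cell_cat [C1 /cell_cat [C2 /(_ ga gaA)]]; rewrite Eg -Eps => Hs.
  by rewrite E1 // Hal.
by rewrite E2 // Hbe.
Qed.

Lemma PL_if3 psi1 psi2 phi1 phi2 phi3 phi :
  PL psi1 -> PL psi2 -> PL phi1 -> PL phi2 -> PL phi3 ->
  (forall x, in_simplex x -> 0 <= psi1 x -> phi x = phi1 x) ->
  (forall x, in_simplex x -> psi1 x <= 0 -> 0 <= psi2 x -> phi x = phi2 x) ->
  (forall x, in_simplex x -> psi1 x <= 0 -> psi2 x <= 0 -> phi x = phi3 x) -> PL phi.
Proof.
move=> /PL_pieces [P1 [A1 H1]] /PL_pieces [P2 [A2 H2]] [Q1 K1] [Q2 K2] [Q3 K3] E1 E2 E3.
exists (P1 ++ P2 ++ A1 ++ A2 ++ Q1 ++ Q2 ++ Q3) => sg.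
have [g1 g1A Hg1] := H1 sg; have [g2 g2A Hg2] := H2 sg.
have [a1 Ha1] := K1 sg; have [a2 Ha2] := K2 sg; have [a3 Ha3] := K3 sg.
exists (if sg g1 then a1 else if sg g2 then a2 else a3) => x Hx.
move=> /cell_cat [/(Hg1 x Hx) e1] /cell_cat [/(Hg2 x Hx) e2].
move=> /cell_cat [/(_ g1 g1A) s1] /cell_cat [/(_ g2 g2A) s2].
move=> /cell_cat [C1] /cell_cat [C2 C3]; rewrite -e1 in s1; rewrite -e2 in s2.
case: (sg g1) s1 => s1; first by rewrite E1 // Ha1.
by case: (sg g2) s2 => s2; [rewrite E2 // Ha2|rewrite E3 // Ha3].
Qed.

Lemma PL_add phi psi : PL phi -> PL psi -> PL (fun x => phi x + psi x).
Proof.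
move=> [Phi1 H1] [Phi2 H2]; exists (Phi1 ++ Phi2) => sg.
have [al Hal] := H1 sg; have [be Hbe] := H2 sg.
exists (al + be) => x Hx /cell_cat [C1 C2]; rewrite Hal // Hbe // /lin -big_split /=.
by apply: eq_bigr => i _; rewrite mxE mulrDl.
Qed.

Lemma PL_scale c phi : PL phi -> PL (fun x => c * phi x).
Proof.
move=> [Phi1 H1]; exists Phi1 => sg; have [al Hal] := H1 sg.
exists (c *: al) => x Hx C; rewrite Hal // /lin mulr_sumr.
by apply: eq_bigr => i _; rewrite mxE mulrA.
Qed.

Lemma PL_opp phi : PL phi -> PL (fun x => - phi x).
Proof. by move=> /(PL_scale (-1)); apply: PL_ext => x _; rewrite mulN1r. Qed.

Lemma PL_sub phi psi : PL phi -> PL psi -> PL (fun x => phi x - psi x).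
Proof. by move=> H1 /PL_opp; apply: PL_add. Qed.

Lemma PL_min phi psi : PL phi -> PL psi -> PL (fun x => Num.min (phi x) (psi x)).
Proof.
move=> H1 H2; apply: (PL_if (PL_sub H2 H1) H1 H2) => x _.
  by rewrite subr_ge0 => /min_idPl.
by rewrite subr_le0 => /min_idPr.
Qed.

Lemma PL_max phi psi : PL phi -> PL psi -> PL (fun x => Num.max (phi x) (psi x)).
Proof.
move=> H1 H2; apply: (PL_if (PL_sub H2 H1) H2 H1) => x _.
  by rewrite subr_ge0 => /max_idPr.
by rewrite subr_le0 => /max_idPl.
Qed.

Lemma PL_sum (I : Type) (r : seq I) (P : pred I) (phi : I -> pt -> R) :
  (forall i, PL (phi i)) -> PL (fun x => \sum_(i <- r | P i) phi i x).
Proof.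
move=> H; elim: r => [|i r IH].
  by apply: (PL_ext _ (PL_const 0)) => x _; rewrite big_nil.
case EP: (P i).
  by apply: (PL_ext _ (PL_add (H i) IH)) => x _; rewrite big_cons EP.
by apply: (PL_ext _ IH) => x _; rewrite big_cons EP.
Qed.

Lemma PL_bigmin (I : Type) (r : seq I) (P : pred I) (phi0 : pt -> R) (phi : I -> pt -> R) :
  PL phi0 -> (forall i, PL (phi i)) ->
  PL (fun x => \big[Num.min/phi0 x]_(i <- r | P i) phi i x).
Proof.
move=> H0 H; elim: r => [|i r IH].
  by apply: (PL_ext _ H0) => x _; rewrite big_nil.
case EP: (P i).
  by apply: (PL_ext _ (PL_min (H i) IH)) => x _; rewrite big_cons EP.
by apply: (PL_ext _ IH) => x _; rewrite big_cons EP.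
Qed.

Lemma PL_family (I : finType) (phi : I -> pt -> R) : (forall i, PL (phi i)) ->
  exists Phi, forall sg, exists al : I -> rv,
    forall x i, in_simplex x -> cell Phi sg x -> phi i x = lin (al i) x.
Proof.
move=> /choice [Phi H]; exists (flatten [seq Phi i | i <- enum I]) => sg.
have /choice [al Hal] : forall i, exists al : rv, forall x, in_simplex x ->
  cell (Phi i) sg x -> phi i x = lin al x by move=> i; apply: H.
exists al => x i Hx Hc; apply: Hal => // l lP; apply: Hc.
by apply/flatten_mapP; exists i; rewrite ?mem_enum.
Qed.

Definition mlin (M : mx) (x : pt) : pt := fun i => \sum_l M i l * x l.

Lemma lin_mlin l (M : mx) x : lin l (mlin M x) = lin (l *m M) x.
Proof.
rewrite /lin /mlin; under eq_bigr do rewrite mulr_sumr.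
rewrite exchange_big /=; apply: eq_bigr => j _; rewrite mxE mulr_suml.
by apply: eq_bigr => i _; rewrite mulrA.
Qed.

Lemma mlin_mul (M M' : mx) x : mlin M (mlin M' x) = mlin (M *m M') x.
Proof.
apply/funext => i; rewrite /mlin; under eq_bigr do rewrite mulr_sumr.
rewrite exchange_big /=; apply: eq_bigr => j _; rewrite mxE mulr_suml.
by apply: eq_bigr => l _; rewrite mulrA.
Qed.

(** The target side is constant on each closed cell. This is no restriction where the image touches
    the boundary, because [mkpt] forgets the side there. *)
Definition PA (h : spt R n -> spt R n) : Prop := exists Phi, forall s sg,
  exists tM : bool * mx, forall x, in_simplex x -> cell Phi sg x ->
    h (mkpt s x) = mkpt tM.1 (mlin tM.2 x).

Lemma PA_pieces h : PA h -> exists Phi, exists As : seq (bool * mx), forall s sg,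
  exists2 tM, tM \in As & forall x, in_simplex x -> cell Phi sg x ->
    h (mkpt s x) = mkpt tM.1 (mlin tM.2 x).
Proof.
move=> [Phi H]; exists Phi.
have F s : exists As : seq (bool * mx), forall sg, exists2 tM, tM \in As &
    forall x, in_simplex x -> cell Phi sg x -> h (mkpt s x) = mkpt tM.1 (mlin tM.2 x).
  apply: (finite_choices (Phi := Phi) _ (H s)) => sg sg' a E H' x Hx Hc.
  by apply: H' => //; apply: cell_ext Hc => l lP; rewrite E.
have [[At Ht] [Af Hf]] := (F true, F false); exists (At ++ Af) => -[] sg.
  by have [tM tA HtM] := Ht sg; exists tM => //; rewrite mem_cat tA.
by have [tM tA HtM] := Hf sg; exists tM => //; rewrite mem_cat tA orbT.
Qed.

(** The hyperplanes of the second map are pulled back by the matrices of all pieces of the first. *)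
Lemma PA_comp h1 h2 : (forall p, Sn p -> Sn (h1 p)) -> PA h1 -> PA h2 ->
  PA (fun p => h2 (h1 p)).
Proof.
move=> S1 /PA_pieces [Phi1 [As H1]] [Phi2 H2].
exists (Phi1 ++ [seq l *m tM.2 | tM : bool * mx <- As, l : rv <- Phi2]) => s sg.
have [[t1 M1] tA /= E1] := H1 s sg.
have [[t2 M2] /= E2] := H2 t1 (fun l => sg (l *m M1)).
exists (t2, M2 *m M1) => x Hx /cell_cat [C1 C2] /=.
rewrite E1 // E2 ?mlin_mul //.
  by have [] := S1 _ (mkpt_Sn s Hx); rewrite E1.
move=> l lP; rewrite lin_mlin; apply: (C2 (l *m M1)).
by apply/allpairsP; exists ((t1, M1), l).
Qed.

Lemma PA_id : PA id.
Proof.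
exists [::] => s sg; exists (s, 1%:M) => x _ _ /=; congr mkpt; apply/funext => i.
rewrite -[LHS](sum_delta i x); apply: eq_bigr => j _.
by rewrite mxE eq_sym.
Qed.

Lemma PA_PLS h : homeoS h -> PA h -> PLS h.
Proof.
move=> Hh [Phi H]; split=> //.
(* Adding the differences of two coordinates to the hyperplanes gives every simplex a least
   coordinate. *)
pose D := [seq (\row_j ((j == ik.1)%:R - (j == ik.2)%:R) : rv) | ik <- enum {: 'I_n.+1 * 'I_n.+1}].
have [T sT HT] := refinement (Phi ++ D).
have [|m [side [vert [Htri Hvert]]]] := double_triangulation sT.
  move=> V VT; apply: has_least_signed => i k; apply: HT => //.
  by rewrite mem_cat; apply/orP; right; apply/mapP; exists (i, k); rewrite ?mem_enum.
exists m, side, vert; split=> // j; have [V VT ->] := Hvert j.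
have [[t M] HM] := H (side j) (fun l => [forall i, 0 <= lin l (V i)]).
exists t, M, (fun=> 0) => lam ls; rewrite /simplex_pt HM.
- by congr mkpt; apply/funext => i; rewrite addr0.
- by apply: bary_simplex => //; have [Ts _ _ _] := sT; apply: Ts.
- move=> l lP; rewrite lin_bary; have [l0 _] := ls; case: forallP => Hf.
    by apply: sumr_ge0 => i _; rewrite mulr_ge0.
  apply: sumr_le0 => i _; rewrite mulr_ge0_le0 //.
  by case: (HT V l VT _) => [|/(fun f => Hf f)|->] //; rewrite mem_cat lP.
Qed.

Definition dist1 (x y : pt) : R := \sum_i `|x i - y i|.

Lemma dist1_ge0 x y : 0 <= dist1 x y. Proof. exact: sumr_ge0. Qed.
Lemma dist1xx x : dist1 x x = 0.
Proof. by rewrite /dist1 big1 // => i _; rewrite subrr normr0. Qed.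
Lemma dist1C x y : dist1 x y = dist1 y x.
Proof. by apply: eq_bigr => i _; rewrite distrC. Qed.
Lemma dist1_triangle y x z : dist1 x z <= dist1 x y + dist1 y z.
Proof. by rewrite -big_split; apply: ler_sum => i _; apply: ler_distD. Qed.
Lemma coord_dist1 x y i : `|x i - y i| <= dist1 x y.
Proof. by rewrite /dist1 (bigD1 i) //= lerDl sumr_ge0. Qed.

Lemma enorm_dist1 (x y : pt) : enorm (dvec x y) <= dist1 x y.
Proof.
rewrite /enorm -[leRHS]ger0_norm ?dist1_ge0 // -sqrtr_sqr ler_wsqrtr //.
rewrite expr2 {1}/dist1 mulr_suml; apply: ler_sum => i _.
rewrite -real_normK ?num_real // expr2 ler_wpM2l //; exact: coord_dist1.
Qed.

Lemma coord_enorm (x y : pt) i : `|x i - y i| <= enorm (dvec x y).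
Proof.
rewrite -sqrtr_sqr /enorm ler_wsqrtr // (bigD1 i) //= lerDl.
by apply: sumr_ge0 => j _; apply: sqr_ge0.
Qed.

Lemma sdist_coord (p q : spt R n) e i : sdist_lt p q e -> `|p.2 i - q.2 i| < e.
Proof.
case=> [[_]|[z [_ [_]]]]; apply: le_lt_trans; first exact: coord_enorm.
by apply: le_trans (ler_distD (z i) _ _) _; rewrite lerD // coord_enorm.
Qed.

Lemma sdist_mkpt t (u v : pt) e : in_simplex u -> in_simplex v -> dist1 u v < e ->
  sdist_lt (mkpt t u) (mkpt t v) e.
Proof.
move=> Hu Hv Huv.
have E0 (w : pt) : enorm (dvec w w) = 0.
  by rewrite /enorm big1 ?sqrtr0 // => i _; rewrite /dvec subrr expr0n.
have Huv' : enorm (dvec u v) < e by apply: le_lt_trans (enorm_dist1 _ _) Huv.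
case: (pselect (on_bdry u)) => Bu.
  by right; exists u; do 2!split=> //; rewrite /= E0 add0r.
case: (pselect (on_bdry v)) => Bv.
  by right; exists v; do 2!split=> //; rewrite /= E0 addr0.
by left; rewrite /mkpt; do 2![case: pselect => //].
Qed.

Lemma sdist_bdry (p q : spt R n) e : sdist_lt p q e -> p.1 <> q.1 ->
  exists i, p.2 i < e /\ q.2 i < e.
Proof.
case=> [[]//|[z [_ [[i zi] H]]]] _; exists i.
have := coord_enorm p.2 z i; have := coord_enorm z q.2 i; rewrite zi subr0 sub0r normrN.
have := ler_norm (p.2 i); have := ler_norm (q.2 i).
have : 0 <= enorm (dvec p.2 z) by apply: sqrtr_ge0.
have : 0 <= enorm (dvec z q.2) by apply: sqrtr_ge0.
by lra.
Qed.

(** A hyperplane through [x] puts no condition on [x], and one that misses [x] has all nearby points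
    on the same side; so [x] and [y] share a closed cell. *)
Lemma near_sign (Phi : seq rv) (x : pt) : exists2 d : R, 0 < d &
  forall y, (forall i, `|x i - y i| < d) -> exists sg, cell Phi sg x /\ cell Phi sg y.
Proof.
have [d d0 Hd] : exists2 d : R, 0 < d & forall l y, l \in Phi ->
    (forall i, `|x i - y i| < d) -> 0 <= lin l x * lin l y.
  elim: Phi => [|l Phi [d d0 IH]]; first by exists 1.
  pose K := 1 + \sum_i `|l 0 i|; have K0 : 0 < K by rewrite ltr_pwDl // sumr_ge0.
  case: (eqVneq (lin l x) 0) => [E0|N0].
    exists d => // l' y; rewrite inE => /orP[/eqP ->|]; last exact: IH.
    by rewrite E0 mul0r.
  have m0 : 0 < `|lin l x| / K by rewrite divr_gt0 ?normr_gt0.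
  exists (Num.min d (`|lin l x| / K)); first by rewrite lt_min d0.
  move=> l' y; rewrite inE => H Hy; case/orP: H => [/eqP ->{l'}|l'P]; last first.
    by apply: IH => // i; have := Hy i; rewrite lt_min => /andP[].
  have : `|lin l x - lin l y| <= (K - 1) * (`|lin l x| / K).
    rewrite /lin -sumrB /K addrAC subrr add0r mulr_suml.
    apply: le_trans (ler_norm_sum _ _ _) _; apply: ler_sum => i _.
    rewrite -mulrBr normrM ler_wpM2l //; have := Hy i.
    by rewrite lt_min => /andP[_ /ltW].
  have -> : (K - 1) * (`|lin l x| / K) = `|lin l x| - `|lin l x| / K.
    by field; rewrite gt_eqF.
  move=> Hle; have {}Hle : `|lin l x - lin l y| < `|lin l x| by lra.
  case: (ltgtP (lin l x) 0) N0 Hle => // Hl _.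
    by rewrite (ltr0_norm Hl) => /ltr_normlP [H1 _]; apply: mulr_le0; lra.
  by rewrite (gtr0_norm Hl) => /ltr_normlP [_ H1]; apply: mulr_ge0; lra.
exists d => // y Hy; exists (fun l => (0 <= lin l x) && (0 <= lin l y)).
split=> l lP; have := Hd l y lP Hy; case: ifP => [/andP[]//|].
  move=> /negbT; rewrite negb_and -!ltNge => /orP[/ltW //|Hl].
  by rewrite nmulr_lge0.
move=> /negbT; rewrite negb_and -!ltNge => /orP[Hl|/ltW //].
by rewrite nmulr_rge0.
Qed.

Lemma PA_contS h : (forall p, Sn p -> Sn (h p)) -> PA h -> contS h.
Proof.
move=> Sh /PA_pieces [Phi [As H]] p Sp e e0.
have [K K0 HK] : exists2 K : R, 0 < K & forall tM, tM \in As -> forall i l, `|tM.2 i l| <= K.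
  elim: {H}As => [|[t M] As [K K0 IH]]; first by exists 1.
  exists (K + \sum_i \sum_l `|M i l|) => [|tM].
    by rewrite ltr_pwDl //; do 2!apply: sumr_ge0 => ? _.
  rewrite inE => /orP[/eqP ->|/IH Ht] i l /=; last first.
    by apply: le_trans (Ht i l) _; rewrite lerDl; do 2!apply: sumr_ge0 => ? _.
  rewrite (bigD1 i) //= (bigD1 l) //=.
  have : 0 <= \sum_(i0 < n.+1 | i0 != l) `|M i i0| by apply: sumr_ge0.
  have : 0 <= \sum_(i0 < n.+1 | i0 != i) \sum_l0 `|M i0 l0| by do 2!apply: sumr_ge0 => ? _.
  by lra.
have [px _] := Sp; have [d1 d10 Hd1] := near_sign Phi p.2.
(* Bound for the l1 norm of all the matrices: n + 1 rows, n + 1 entries in each, all at most [K]. *)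
pose m := (n.+1%:R * n.+1%:R) * K.
have m0 : 0 < m by rewrite !mulr_gt0 // ltr0n.
have Hloc s y : in_simplex y -> (forall i, `|p.2 i - y i| < Num.min d1 (e / m)) ->
    sdist_lt (h (mkpt s p.2)) (h (mkpt s y)) e.
  move=> Hy Hd; have [|sg [C1 C2]] := Hd1 y.
    by move=> i; have := Hd i; rewrite lt_min => /andP[].
  have [tM tA E] := H s sg.
  have Hx' : in_simplex (mlin tM.2 p.2) by have [] := Sh _ (mkpt_Sn s px); rewrite E.
  have Hy' : in_simplex (mlin tM.2 y) by have [] := Sh _ (mkpt_Sn s Hy); rewrite E.
  rewrite !E //; apply: sdist_mkpt => //.
  have H1 i : `|mlin tM.2 p.2 i - mlin tM.2 y i| < n.+1%:R * (K * (e / m)).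
    rewrite /mlin -sumrB; apply: le_lt_trans (ler_norm_sum _ _ _) _.
    have -> : n.+1%:R * (K * (e / m)) = \sum_(l < n.+1) K * (e / m).
      by rewrite sumr_const card_ord mulr_natl.
    apply: ltr_sum; first by apply/hasP; exists ord0; rewrite ?mem_index_enum.
    move=> l _; rewrite -mulrBr normrM.
    apply: le_lt_trans (_ : K * `|p.2 l - y l| < _); first by rewrite ler_wpM2r // HK.
    by rewrite ltr_pM2l //; have := Hd l; rewrite lt_min => /andP[].
  have -> : e = \sum_(i < n.+1) n.+1%:R * (K * (e / m)).
    have key (w : R) : w != 0 -> e = w * (w * (K * (e / (w * w * K)))).
      by move=> w0; field; rewrite w0 gt_eqF.
    by rewrite sumr_const card_ord -[RHS]mulr_natl; apply: key; rewrite pnatr_eq0.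
  by apply: ltr_sum => //; apply/hasP; exists ord0; rewrite ?mem_index_enum.
(* An interior point keeps its side within the size of its least coordinate; a boundary point may be
   given either side. *)
have [d2 d20 Hd2] : exists2 d : R, 0 < d & on_bdry p.2 \/ forall i, d <= p.2 i.
  case: (pselect (on_bdry p.2)) => Hb; first by exists 1; [|left].
  case: (@arg_minP _ _ _ ord0 xpredT p.2) => // i0 _ Hmin.
  exists (p.2 i0); last by right=> i; apply: Hmin.
  rewrite lt_neqAle (proj1 px) andbT eq_sym; apply/eqP => E; apply: Hb; by exists i0.
exists (Num.min d2 (Num.min d1 (e / m))).
  by rewrite !lt_min d20 d10 divr_gt0.
move=> q Sq Hpq; have Hc i := sdist_coord i Hpq.
have Hc' i : `|p.2 i - q.2 i| < Num.min d1 (e / m).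
  by have := Hc i; rewrite lt_min => /andP[].
have Eq := mkptK Sq; have [qx _] := Sq.
have Ep : mkpt q.1 p.2 = p.
  have [E|NE] := pselect (p.1 = q.1); first by rewrite -E mkptK.
  case: Hd2 => [Hb|Hb]; first by rewrite (mkpt_bdry _ p.1 Hb) mkptK.
  have [i [Hi _]] := sdist_bdry Hpq NE.
  by move: Hi; rewrite lt_min => /andP[/(le_lt_trans (Hb i))]; rewrite ltxx.
by have := Hloc q.1 q.2 qx Hc'; rewrite Ep Eq.
Qed.

End PiecewiseLinear.

(** * The distorted rotation of a triangle *)

Section PlaneMaps.
Variable R : realType.
Implicit Types (s a b c m x y : R) (t : R * R * R).

(* A triple (a, b, c) with a vanishing entry stands for the point a x + b y + c z
   of the plane divided into three sectors by three rays x, y, z. *)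
Definition tri t : Prop :=
  [/\ 0 <= t.1.1, 0 <= t.1.2, 0 <= t.2 & [\/ t.1.1 = 0, t.1.2 = 0 | t.2 = 0]].

Definition mass t : R := t.1.1 + t.1.2 + t.2.
Definition rot3 t : R * R * R := (t.2, t.1.1, t.1.2).
Definition swp t : R * R * R := (t.1.2, t.1.1, t.2).
Definition clamp m x : R := Num.max (- m) (Num.min m x).

(* On the circle [mass = 1] of length 3, this map stretches the middle part
   [s, 1 - s] of the edge xy to the whole edge and is the identity on the parts
   [s, 1 - s] of the two other edges. *)
Definition stretch s t : R * R * R :=
  let N := mass t in
  let c := Num.max t.2 ((t.2 + s * N - Num.min t.1.1 t.1.2) / 2) in
  let d := clamp (N - c) ((t.1.1 - t.1.2) / (1 - 2 * s)) in
  ((N - c + d) / 2, (N - c - d) / 2, c).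

Definition shrink s t : R * R * R :=
  let N := mass t in
  let c := Num.max 0 (Num.min t.2 (2 * t.2 - s * N)) in
  let w := Num.max 0 (s * N - 2 * t.2) in
  if t.2 == 0 then (t.1.1 + s * (t.1.2 - t.1.1), t.1.2 + s * (t.1.1 - t.1.2), 0)
  else if t.1.1 == 0 then (w, N - w - c, c) else (N - w - c, w, c).

Variant max_spec x y : R -> Prop :=
  | MaxL of y <= x : max_spec x y x | MaxR of x <= y : max_spec x y y.
Variant min_spec x y : R -> Prop :=
  | MinL of x <= y : min_spec x y x | MinR of y <= x : min_spec x y y.

Lemma maxrP x y : max_spec x y (Num.max x y).
Proof. by rewrite maxEle; case: leP => H; constructor; rewrite // ltW. Qed.
Lemma minrP x y : min_spec x y (Num.min x y).
Proof. by rewrite minEle; case: leP => H; constructor; rewrite // ltW. Qed.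

Lemma clampl m x : 0 <= m -> x <= - m -> clamp m x = - m.
Proof.
move=> m0 H; rewrite /clamp; have -> : Num.min m x = x by apply/min_idPr; lra.
exact/max_idPl.
Qed.

Lemma clampr m x : 0 <= m -> m <= x -> clamp m x = m.
Proof.
move=> m0 H; rewrite /clamp; have -> : Num.min m x = m by apply/min_idPl.
by apply/max_idPr; lra.
Qed.

Lemma clampm m x : - m <= x -> x <= m -> clamp m x = x.
Proof.
move=> H1 H2; rewrite /clamp; have -> : Num.min m x = x by apply/min_idPr.
exact/max_idPr.
Qed.

Lemma clampN m x : 0 <= m -> clamp m (- x) = - clamp m x.
Proof.
move=> m0; have [H1|H1] := leP x (- m).
  by rewrite clampr ?clampl ?opprK //; lra.
have [H2|H2] := leP m x; first by rewrite clampl ?clampr //; lra.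
by rewrite !clampm //; lra.
Qed.

Section Param.
Variable s : R.
Hypothesis s0 : 0 <= s.
Hypothesis s4 : s <= 1 / 4.

Lemma stretch_den : 0 < 1 - 2 * s. Proof. by have := s4; lra. Qed.

Lemma sM_bound N : 0 <= N -> 0 <= s * N /\ s * N <= N / 4.
Proof.
have h0 := s0; have h4 := s4; have s2 := stretch_den.
move=> N0; split; first by rewrite mulr_ge0.
have : 0 <= (1 / 4 - s) * N by rewrite mulr_ge0 // subr_ge0.
by lra.
Qed.

Lemma stretch_a0 b c : 0 <= b -> 0 <= c ->
  let N := b + c in let c' := Num.max c ((c + s * N) / 2) in
  stretch s (0, b, c) = (0, N - c', c').
Proof.
have h0 := s0; have h4 := s4; have s2 := stretch_den.
move=> b0 c0 N c'; rewrite /stretch /mass /= add0r -/N.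
have -> : Num.min 0 b = 0 by apply/min_idPl.
rewrite subr0 -/c'.
have [sN0 sN1] : 0 <= s * N /\ s * N <= N / 4 by apply: sM_bound; rewrite addr_ge0.
have Hc' : c <= c' /\ c' <= N.
  have EN : N = b + c by []; clearbody N.
  by rewrite /c'; case: maxrP => H; lra.
rewrite clampl; first by congr (_, _, _); lra.
  by lra.
rewrite ler_pdivrMr //.
have : 0 <= s * (N - c') by rewrite mulr_ge0 //; lra.
have EN : N = b + c by []; clearbody c' N.
by lra.
Qed.

Lemma stretch_lo a b : 0 <= a -> a <= b -> a <= s * (a + b) ->
  let N := a + b in let c' := (s * N - a) / 2 in
  stretch s (a, b, 0) = (0, N - c', c').
Proof.
have h0 := s0; have h4 := s4; have s2 := stretch_den.
move=> a0 ab Ha N c'; rewrite /stretch /mass /= addr0 -/N.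
have -> : Num.min a b = a by apply/min_idPl.
rewrite add0r -/c'.
have [sN0 sN1] : 0 <= s * N /\ s * N <= N / 4 by apply: sM_bound; rewrite addr_ge0 //; lra.
have -> : Num.max 0 c' = c' by apply/max_idPr; rewrite /c' /N; lra.
have Hc' : 0 <= c' /\ c' <= N.
  have EN : N = a + b by []; rewrite -/N in Ha; clearbody N.
  by rewrite /c'; lra.
rewrite clampl; first by congr (_, _, _); lra.
  by lra.
rewrite ler_pdivrMr //.
have : 0 <= c' * (1 - 2 * s) by rewrite mulr_ge0 //; lra.
have EN : N = a + b by []; rewrite -/N in Ha; clearbody c' N.
by lra.
Qed.

Lemma stretch_mid a b : s * (a + b) <= a -> s * (a + b) <= b -> 0 <= a -> 0 <= b ->
  let N := a + b in
  stretch s (a, b, 0) = ((a - s * N) / (1 - 2 * s), (b - s * N) / (1 - 2 * s), 0).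
Proof.
have h0 := s0; have h4 := s4; have s2 := stretch_den.
move=> Ha Hb a0 b0 N; rewrite /stretch /mass /= addr0 -/N add0r.
have -> : Num.max 0 ((s * N - Num.min a b) / 2) = 0.
  by apply/max_idPl; case: minrP => _; rewrite /N; lra.
rewrite subr0 clampm.
- by congr (_, _, _); rewrite /N; field; rewrite gt_eqF.
- by rewrite ler_pdivlMr // /N; nra.
- by rewrite ler_pdivrMr // /N; nra.
Qed.

Lemma stretch_swp t : tri t -> stretch s (swp t) = swp (stretch s t).
Proof.
have h0 := s0; have h4 := s4; have s2 := stretch_den.
move=> [a0 b0 c0 _]; rewrite /stretch /swp /=.
have -> : mass (t.1.2, t.1.1, t.2) = mass t by rewrite /mass /=; ring.
rewrite minC; set c := Num.max _ _.
have Hc : c <= mass t.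
  have [sN0 sN1] : 0 <= s * mass t /\ s * mass t <= mass t / 4.
    by apply: sM_bound; rewrite /mass; lra.
  have : 0 <= Num.min t.1.1 t.1.2 by rewrite le_min a0.
  have Hm : t.2 <= mass t by rewrite /mass; lra.
  by rewrite /c; case: maxrP => H; lra.
have -> : (t.1.2 - t.1.1) / (1 - 2 * s) = - ((t.1.1 - t.1.2) / (1 - 2 * s)).
  by field; rewrite gt_eqF.
by rewrite clampN ?opprK //; lra.
Qed.

Lemma shrink_c0 a b : shrink s (a, b, 0) = (a + s * (b - a), b + s * (a - b), 0).
Proof. by rewrite /shrink /= eqxx. Qed.

Lemma shrink_a0 b c : 0 <= b -> 0 <= c ->
  let N := b + c in let c' := Num.max 0 (Num.min c (2 * c - s * N)) in
  let w := Num.max 0 (s * N - 2 * c) in shrink s (0, b, c) = (w, N - w - c', c').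
Proof.
have h0 := s0; have h4 := s4; have s2 := stretch_den.
move=> b0 c0 N c' w; rewrite /shrink /mass /= eqxx.
case: eqP => Ec; last by rewrite !add0r.
have sN : 0 <= s * N by rewrite mulr_ge0 // addr_ge0.
have -> : w = s * b.
  by rewrite /w /N Ec mulr0 subr0 addr0; apply/max_idPr; rewrite mulr_ge0.
have -> : c' = 0.
  rewrite /c' Ec mulr0 sub0r; apply/max_idPl; rewrite ge_min oppr_le0 sN orbT //.
by rewrite /N Ec; congr (_, _, _); ring.
Qed.

Lemma shrink_swp t : tri t -> shrink s (swp t) = swp (shrink s t).
Proof.
have h0 := s0; have h4 := s4; have s2 := stretch_den.
case: t => -[a b] c [/= a0 b0 c0 H]; rewrite /swp /=.
have [->|cn] := eqVneq c 0; first by rewrite !shrink_c0.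
have Em : mass (b, a, c) = mass (a, b, c) by rewrite /mass /=; ring.
rewrite /shrink Em /= (negbTE cn).
case: (eqVneq a 0) => [Ea|an]; case: (eqVneq b 0) => [Eb|bn] //=.
  rewrite /mass /= Ea Eb !add0r.
  have sc : s * c <= c / 4 by have [] := sM_bound c0.
  have sc0 : 0 <= s * c by rewrite mulr_ge0.
  have -> : Num.max 0 (s * c - 2 * c) = 0 by apply/max_idPl; lra.
  have -> : Num.min c (2 * c - s * c) = c by apply/min_idPl; lra.
  have -> : Num.max 0 c = c by apply/max_idPr.
  by congr (_, _, _); lra.
by case: H => // /eqP; rewrite ?(negbTE an) ?(negbTE bn) ?(negbTE cn).
Qed.

Lemma swpK : involutive swp. Proof. by case=> -[]. Qed.
Lemma tri_swp t : tri t -> tri (swp t).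
Proof. by case=> a0 b0 c0 H; split=> //; case: H; [constructor 2|constructor 1|constructor 3]. Qed.

Lemma tri_ind (P : R * R * R -> Prop) :
  (forall t, tri t -> P (swp t) -> P t) ->
  (forall b c, 0 <= b -> 0 <= c -> P (0, b, c)) ->
  (forall a b, 0 <= a -> 0 <= b -> P (a, b, 0)) -> forall t, tri t -> P t.
Proof.
move=> Hs Ha Hc [[a b] c] tt; have [/= a0 b0 c0 H] := tt.
case: H => E; rewrite ?E in tt *; [exact: Ha| |exact: Hc].
by apply: (Hs _ tt); apply: Ha.
Qed.

Lemma stretch_tri t : tri t -> tri (stretch s t) /\ mass (stretch s t) = mass t.
Proof.
have h0 := s0; have h4 := s4; have s2 := stretch_den.
move: t; apply: tri_ind => [t tt|b c b0 c0|a b a0 b0].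
- rewrite stretch_swp // => -[/tri_swp]; rewrite swpK => H1 H2; split=> //.
  by move: H2; rewrite /mass /swp /=; lra.
- rewrite stretch_a0 //=; have [sN0 sN1] := sM_bound (addr_ge0 b0 c0).
  split; last by rewrite /mass /=; ring.
  by split=> /=; [| | |constructor 1] => //; case: maxrP => ?; lra.
- wlog ab : a b a0 b0 / a <= b.
    move=> W; have [/W|/ltW ba] := leP a b; first exact.
    have tt : tri (b, a, 0) by split=> //; constructor 3.
    have [H1 H2] := W _ _ b0 a0 ba.
    rewrite -[(a, b, 0)]/(swp (b, a, 0)) stretch_swp //; split; first exact: tri_swp.
    by move: H2; rewrite /mass /swp /=; lra.
  have [sN0 sN1] := sM_bound (addr_ge0 a0 b0).
  have [Ha|Ha] := leP a (s * (a + b)).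
    rewrite stretch_lo //=; split; last by rewrite /mass /=; ring.
    by split=> /=; [| | |constructor 1] => //; lra.
  rewrite stretch_mid //=; [|by lra..].
  split; last by rewrite /mass /=; field; rewrite gt_eqF.
  by split=> /=; [| | |constructor 3] => //; rewrite divr_ge0 //; lra.
Qed.

Lemma shrink_tri t : tri t -> tri (shrink s t) /\ mass (shrink s t) = mass t.
Proof.
have h0 := s0; have h4 := s4; have s2 := stretch_den.
move: t; apply: tri_ind => [t tt|b c b0 c0|a b a0 b0].
- rewrite shrink_swp // => -[/tri_swp]; rewrite swpK => H1 H2; split=> //.
  by move: H2; rewrite /mass /swp /=; lra.
- rewrite shrink_a0 //=; have [sN0 sN1] := sM_bound (addr_ge0 b0 c0).
  split; last by rewrite /mass /=; ring.
  rewrite /tri /=.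
  case: (maxrP 0 (s * (b + c) - 2 * c)) => H1; case: minrP => H2;
  case: maxrP => H3; split=> //; try lra; first [by constructor 1 | by constructor 3 | by constructor 1; lra | by constructor 3; lra].
- rewrite shrink_c0; have := sM_bound a0; have := sM_bound b0 => -[? ?] [? ?].
  split; last by rewrite /mass /=; ring.
  by split=> /=; [| | |constructor 3] => //; lra.
Qed.

Lemma shrinkK t : tri t -> stretch s (shrink s t) = t.
Proof.
have h0 := s0; have h4 := s4; have s2 := stretch_den.
move: t; apply: tri_ind => [t tt|b c b0 c0|a b a0 b0].
- move=> H; have [ts _] := shrink_tri tt; rewrite -[t in RHS]swpK -H shrink_swp //.
  by rewrite stretch_swp // swpK.
- rewrite shrink_a0 //=; have [sN0 sN1] := sM_bound (addr_ge0 b0 c0).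
  case: (leP (2 * c) (s * (b + c))) => H1.
    have -> : Num.max 0 (s * (b + c) - 2 * c) = s * (b + c) - 2 * c by apply/max_idPr; lra.
    have -> : Num.max 0 (Num.min c (2 * c - s * (b + c))) = 0.
      by apply/max_idPl; rewrite ge_min; apply/orP; right; lra.
    rewrite subr0; set a' := _ - 2 * c.
    have E : a' + (b + c - a') = b + c by ring.
    have H := @stretch_lo a' (b + c - a'); rewrite /= E in H.
    rewrite H; [|by rewrite /a'; lra..].
    by congr (_, _, _); rewrite /a'; lra.
  have -> : Num.max 0 (s * (b + c) - 2 * c) = 0 by apply/max_idPl; lra.
  have -> : Num.max 0 (Num.min c (2 * c - s * (b + c))) = Num.min c (2 * c - s * (b + c)).
    by apply/max_idPr; rewrite le_min; apply/andP; split; lra.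
  rewrite subr0; case: (leP c (2 * c - s * (b + c))) => H2.
    rewrite stretch_a0 ?subrK //; last by lra.
    have -> : Num.max c ((c + s * (b + c)) / 2) = c by apply/max_idPl; lra.
    by congr (_, _, _); lra.
  have H := @stretch_a0 (b + c - (2 * c - s * (b + c))) (2 * c - s * (b + c)).
  rewrite /= subrK in H; rewrite H; [|by lra..].
  have -> : Num.max (2 * c - s * (b + c)) ((2 * c - s * (b + c) + s * (b + c)) / 2) = c.
    by case: maxrP => ?; lra.
  by congr (_, _, _); lra.
- rewrite shrink_c0; have := sM_bound a0; have := sM_bound b0 => -[? ?] [? ?].
  rewrite stretch_mid; [|by nra..].
  by congr (_, _, _); field; rewrite gt_eqF.
Qed.

Lemma stretchK t : tri t -> shrink s (stretch s t) = t.
Proof.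
have h0 := s0; have h4 := s4; have s2 := stretch_den.
move: t; apply: tri_ind => [t tt|b c b0 c0|a b a0 b0].
- move=> H; have [ts _] := stretch_tri tt; rewrite -[t in RHS]swpK -H stretch_swp //.
  by rewrite shrink_swp // swpK.
- rewrite stretch_a0 //=; have [sN0 sN1] := sM_bound (addr_ge0 b0 c0).
  set c' := Num.max _ _.
  have Hc' : c <= c' /\ c' <= b + c by rewrite /c'; case: maxrP => H; lra.
  rewrite shrink_a0 ?subrK; [|by lra..].
  have -> : Num.max 0 (s * (b + c) - 2 * c') = 0.
    by apply/max_idPl; rewrite /c'; case: maxrP => H; lra.
  have -> : Num.max 0 (Num.min c' (2 * c' - s * (b + c))) = c.
    by rewrite /c'; case: (maxrP c _) => H; case: minrP => ?; case: maxrP => ?; lra.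
  by congr (_, _, _); lra.
- wlog ab : a b a0 b0 / a <= b.
    move=> W; have [/W|/ltW ba] := leP a b; first exact.
    have tt : tri (b, a, 0) by split=> //; constructor 3.
    have H := W _ _ b0 a0 ba; have [ts _] := stretch_tri tt.
    by rewrite -[(a, b, 0)]/(swp (b, a, 0)) stretch_swp // shrink_swp // H.
  have [sN0 sN1] := sM_bound (addr_ge0 a0 b0).
  have [Ha|Ha] := leP a (s * (a + b)).
    rewrite stretch_lo //=; set c' := _ / 2.
    have Ec : 2 * c' = s * (a + b) - a by rewrite /c'; lra.
    clearbody c'; have Hc' : 0 <= c' /\ c' <= a + b by lra.
    rewrite shrink_a0 ?subrK; [|by lra..].
    have -> : Num.max 0 (s * (a + b) - 2 * c') = a.
      by case: maxrP => ?; lra.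
    have -> : Num.max 0 (Num.min c' (2 * c' - s * (a + b))) = 0.
      by apply/max_idPl; rewrite ge_min; apply/orP; right; lra.
    by congr (_, _, _); lra.
  rewrite stretch_mid //; [|by lra..].
  rewrite shrink_c0.
  by congr (_, _, _); field; rewrite gt_eqF.
Qed.

(** A conjugate of [rot3], hence of order three; at s = 0 it is the rotation itself on triples with
    a vanishing entry. *)
Definition turn t := stretch s (rot3 (shrink s t)).

Lemma rot3_tri t : tri t -> tri (rot3 t) /\ mass (rot3 t) = mass t.
Proof.
move=> [a0 b0 c0 H]; split; last by rewrite /mass /rot3 /=; ring.
by split=> //; case: H => /= ?; [constructor 2|constructor 3|constructor 1].
Qed.

Lemma turn_tri t : tri t -> tri (turn t) /\ mass (turn t) = mass t.
Proof.
move=> /shrink_tri [/rot3_tri [/stretch_tri [? E1] E2] E3]; split=> //.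
by rewrite /turn E1 E2.
Qed.

Lemma turn3 t : tri t -> turn (turn (turn t)) = t.
Proof.
move=> tt; rewrite /turn; have [t1 _] := shrink_tri tt.
have [t2 _] := rot3_tri t1; have [t3 _] := rot3_tri t2.
rewrite !stretchK //; have -> : rot3 (rot3 (rot3 (shrink s t))) = shrink s t.
  by case: (shrink s t) => -[].
exact: shrinkK.
Qed.

(** The contracted base edge is rotated onto the middle part of the next edge, where [stretch] is
    the identity. The result is linear in (a, b) with coefficients 1 - s and s, and the same happens
    for the second turn. *)
Lemma turn_c0 a b : 0 <= a -> 0 <= b ->
  turn (a, b, 0) = (0, a + s * (b - a), b + s * (a - b)).
Proof.
have h0 := s0; have h4 := s4; have s2 := stretch_den.
move=> a0 b0; rewrite /turn shrink_c0 /rot3 /=.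
have := sM_bound a0; have := sM_bound b0 => -[? ?] [? ?].
rewrite stretch_a0; [|by lra..].
have -> : Num.max (b + s * (a - b)) ((b + s * (a - b) +
   s * (a + s * (b - a) + (b + s * (a - b)))) / 2) = b + s * (a - b).
  by apply/max_idPl; nra.
by congr (_, _, _); lra.
Qed.

Lemma turn_a0 a b : 0 <= a -> 0 <= b ->
  turn (0, a + s * (b - a), b + s * (a - b)) = (b + s * (a - b), 0, a + s * (b - a)).
Proof.
have h0 := s0; have h4 := s4; have s2 := stretch_den.
move=> a0 b0; have := sM_bound a0; have := sM_bound b0 => -[sb sb'] [sa sa'].
set a1 := a + _; set b1 := b + _.
have EN : a1 + b1 = a + b by rewrite /a1 /b1; ring.
have EN' : b1 + a1 = a + b by rewrite /a1 /b1; ring.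
have [a10 b10] : 0 <= a1 /\ 0 <= b1 by rewrite /a1 /b1; lra.
have Hb1 : s * (a + b) <= b1 by rewrite /b1; nra.
have Ha1 : s * (a + b) <= a1 by rewrite /a1; nra.
have sN : 0 <= s * (a + b) by lra.
rewrite /turn shrink_a0 // EN.
have -> : Num.max 0 (s * (a + b) - 2 * b1) = 0 by apply/max_idPl; lra.
have -> : Num.min b1 (2 * b1 - s * (a + b)) = b1 by apply/min_idPl; lra.
have -> : Num.max 0 b1 = b1 by apply/max_idPr.
have -> : a + b - 0 - b1 = a1 by rewrite -EN; ring.
have tt : tri (0, b1, a1) by split=> //; constructor 1.
rewrite -[rot3 _]/(swp (0, b1, a1)) stretch_swp // stretch_a0 // EN'.
have -> : Num.max a1 ((a1 + s * (a + b)) / 2) = a1 by apply/max_idPl; lra.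
by rewrite /swp /=; congr (_, _, _); rewrite -EN; ring.
Qed.

End Param.
End PlaneMaps.

(** * Lipschitz dependence of the rotation on the point and on the parameter *)

Section PlaneEstimates.
Variable R : realType.
Implicit Types (s k x y : R) (t : R * R * R).

Definition dist3 t t' : R :=
  `|t.1.1 - t'.1.1| + `|t.1.2 - t'.1.2| + `|t.2 - t'.2|.

Lemma dist_max x y x' y' : `|Num.max x y - Num.max x' y'| <= `|x - x'| + `|y - y'|.
Proof.
have := ler_norm (x - x'); have := ler_norm (x' - x); rewrite (distrC x').
have := ler_norm (y - y'); have := ler_norm (y' - y); rewrite (distrC y').
have := normr_ge0 (x - x'); have := normr_ge0 (y - y').
by rewrite ler_norml; case: maxrP => ?; case: maxrP => ? *; lra.
Qed.

Lemma dist_min x y x' y' : `|Num.min x y - Num.min x' y'| <= `|x - x'| + `|y - y'|.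
Proof.
have := ler_norm (x - x'); have := ler_norm (x' - x); rewrite (distrC x').
have := ler_norm (y - y'); have := ler_norm (y' - y); rewrite (distrC y').
have := normr_ge0 (x - x'); have := normr_ge0 (y - y').
by rewrite ler_norml; case: minrP => ?; case: minrP => ? *; lra.
Qed.

Lemma dist_clamp m x m' x' : `|clamp m x - clamp m' x'| <= 2 * `|m - m'| + `|x - x'|.
Proof.
apply: le_trans (dist_max _ _ _ _) _; have := dist_min m x m' x'.
have -> : - m - - m' = - (m - m') by ring.
by rewrite normrN; lra.
Qed.

Lemma dist3_triangle t t' t'' : dist3 t t'' <= dist3 t t' + dist3 t' t''.
Proof.
rewrite /dist3; have := ler_distD t'.1.1 t.1.1 t''.1.1.
have := ler_distD t'.1.2 t.1.2 t''.1.2; have := ler_distD t'.2 t.2 t''.2.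
by lra.
Qed.

Lemma dist3_rot3 t t' : dist3 (rot3 t) (rot3 t') = dist3 t t'.
Proof. by rewrite /dist3 /=; lra. Qed.

Lemma stretch_lip s t t' : 0 <= s -> s <= 1 / 4 ->
  dist3 (stretch s t) (stretch s t') <= 20 * dist3 t t'.
Proof.
move=> s0 s4; set D := dist3 t t'.
have [Ha Hb Hc] : [/\ `|t.1.1 - t'.1.1| <= D, `|t.1.2 - t'.1.2| <= D & `|t.2 - t'.2| <= D].
  have := normr_ge0 (t.1.1 - t'.1.1); have := normr_ge0 (t.1.2 - t'.1.2).
  by have := normr_ge0 (t.2 - t'.2); rewrite /D /dist3; split; lra.
have D0 : 0 <= D := le_trans (normr_ge0 _) Ha.
have HN : `|mass t - mass t'| <= D.
  have -> : mass t - mass t' = (t.1.1 - t'.1.1) + (t.1.2 - t'.1.2) + (t.2 - t'.2).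
    by rewrite /mass; ring.
  by apply: le_trans (ler_normD _ _) _; rewrite lerD2r ler_normD.
have Hm : `|Num.min t.1.1 t.1.2 - Num.min t'.1.1 t'.1.2| <= D.
  apply: le_trans (dist_min _ _ _ _) _; rewrite /D /dist3.
  by have := normr_ge0 (t.2 - t'.2); lra.
have HsN : `|s * mass t - s * mass t'| <= D.
  rewrite -mulrBr normrM (ger0_norm s0); apply: le_trans HN.
  by rewrite ler_piMl //; lra.
rewrite /stretch /=.
set c := Num.max t.2 _; set c' := Num.max t'.2 _.
have Hcc : `|c - c'| <= 3 * D.
  apply: le_trans (dist_max _ _ _ _) _.
  have : `|(t.2 + s * mass t - Num.min t.1.1 t.1.2) / 2 -
           (t'.2 + s * mass t' - Num.min t'.1.1 t'.1.2) / 2| <= 2 * D.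
    by move: Hc Hm HsN; rewrite !ler_norml; lra.
  by lra.
set x := (t.1.1 - t.1.2) / _; set x' := (t'.1.1 - t'.1.2) / _.
have Hx : `|x - x'| <= 4 * D.
  have -> : x - x' = ((t.1.1 - t'.1.1) - (t.1.2 - t'.1.2)) / (1 - 2 * s).
    by rewrite /x /x'; field; rewrite gt_eqF //; lra.
  have s2 : 0 < 1 - 2 * s by lra.
  rewrite normrM normfV (gtr0_norm s2) ler_pdivrMr //.
  apply: le_trans (ler_normB _ _) _.
  have : D * (4 * s) <= D * 1 by rewrite ler_wpM2l //; lra.
  by lra.
have Hd := dist_clamp (mass t - c) x (mass t' - c') x'.
have HM : `|mass t - c - (mass t' - c')| <= 4 * D.
  by move: HN Hcc; rewrite !ler_norml; lra.
move: Hd; set d := clamp _ _; set d' := clamp _ _ => Hd.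
have {}Hd : `|d - d'| <= 12 * D by lra.
have H1 : `|(mass t - c + d) / 2 - (mass t' - c' + d') / 2| <= 8 * D.
  by move: Hd HM; rewrite !ler_norml; lra.
have H2 : `|(mass t - c - d) / 2 - (mass t' - c' - d') / 2| <= 8 * D.
  by move: Hd HM; rewrite !ler_norml; lra.
by rewrite /dist3 /=; lra.
Qed.

Lemma stretch_dep s s' t : 0 <= s -> s <= 1 / 4 -> 0 <= s' -> s' <= 1 / 4 -> tri t ->
  dist3 (stretch s t) (stretch s' t) <= 20 * (`|s - s'| * mass t).
Proof.
move=> s0 s4 s0' s4' [a0 b0 c0 _]; set D := _ * mass t.
have N0 : 0 <= mass t by rewrite /mass; lra.
have D0 : 0 <= D by rewrite mulr_ge0.
have HsN : `|s * mass t - s' * mass t| <= D by rewrite -mulrBl normrM (ger0_norm N0).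
rewrite /stretch /=.
set c := Num.max t.2 _; set c' := Num.max t.2 _.
have Hcc : `|c - c'| <= D.
  apply: le_trans (dist_max _ _ _ _) _; rewrite subrr normr0 add0r.
  by move: HsN; rewrite !ler_norml; lra.
set x := _ / (1 - 2 * s); set x' := _ / (1 - 2 * s').
have Hx : `|x - x'| <= 8 * D.
  have -> : x - x' = ((t.1.1 - t.1.2) * (2 * (s - s'))) / ((1 - 2 * s) * (1 - 2 * s')).
    by rewrite /x /x'; field; rewrite !gt_eqF //; lra.
  have s2 : 0 < (1 - 2 * s) * (1 - 2 * s') by rewrite mulr_gt0 //; lra.
  rewrite normrM normfV (gtr0_norm s2) ler_pdivrMr // !normrM (gtr0_norm (ltr0n _ 2)).
  have H1 : `|t.1.1 - t.1.2| <= mass t by rewrite ler_norml /mass; lra.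
  have H2 : 1 / 4 <= (1 - 2 * s) * (1 - 2 * s').
    have -> : 1 / 4 = 1 / 2 * (1 / 2) :> R by lra.
    by apply: ler_pM; lra.
  have H3 : `|t.1.1 - t.1.2| * `|s - s'| <= D by rewrite mulrC ler_wpM2l.
  have H4 : D * (1 / 4) <= D * ((1 - 2 * s) * (1 - 2 * s')) by rewrite ler_wpM2l.
  by lra.
have Hd := dist_clamp (mass t - c) x (mass t - c') x'.
have HM : `|mass t - c - (mass t - c')| <= D by move: Hcc; rewrite !ler_norml; lra.
move: Hd; set d := clamp _ _; set d' := clamp _ _ => Hd.
have {}Hd : `|d - d'| <= 10 * D by lra.
have H1 : `|(mass t - c + d) / 2 - (mass t - c' + d') / 2| <= 8 * D.
  by move: Hd HM; rewrite !ler_norml; lra.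
have H2 : `|(mass t - c - d) / 2 - (mass t - c' - d') / 2| <= 8 * D.
  by move: Hd HM; rewrite !ler_norml; lra.
by rewrite /dist3 /=; lra.
Qed.

Lemma shrink_dep s s' t : tri t ->
  dist3 (shrink s t) (shrink s' t) <= 20 * (`|s - s'| * mass t).
Proof.
move=> [a0 b0 c0 _]; set D := _ * mass t.
have N0 : 0 <= mass t by rewrite /mass; lra.
have D0 : 0 <= D by rewrite mulr_ge0.
have HsN : `|s * mass t - s' * mass t| <= D by rewrite -mulrBl normrM (ger0_norm N0).
rewrite /shrink; case: ifP => _.
  rewrite /dist3 /= subrr normr0 addr0.
  have H x : `|x| <= mass t -> `|s * x - s' * x| <= D.
    by move=> Hx; rewrite -mulrBl normrM ler_wpM2l.
  have /H : `|t.1.2 - t.1.1| <= mass t by rewrite ler_norml /mass; lra.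
  have /H : `|t.1.1 - t.1.2| <= mass t by rewrite ler_norml /mass; lra.
  have E x y : x + s * y - (x + s' * y) = s * y - s' * y by ring.
  by rewrite !E; lra.
set w := Num.max 0 (s * _ - _); set w' := Num.max 0 (s' * _ - _).
set c := Num.max 0 (Num.min _ _); set c' := Num.max 0 (Num.min _ (_ - s' * _)).
have Hw : `|w - w'| <= D.
  apply: le_trans (dist_max _ _ _ _) _; rewrite subrr normr0 add0r.
  by move: HsN; rewrite !ler_norml; lra.
have Hc : `|c - c'| <= D.
  apply: le_trans (dist_max _ _ _ _) _; rewrite subrr normr0 add0r.
  apply: le_trans (dist_min _ _ _ _) _; rewrite subrr normr0 add0r.
  by move: HsN; rewrite !ler_norml; lra.
have HN : `|mass t - w - c - (mass t - w' - c')| <= 2 * D.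
  by move: Hw Hc; rewrite !ler_norml; lra.
by case: ifP => _; rewrite /dist3 /=; lra.
Qed.

(** The constant is 420 = 20 + 20 . 20: the change of [stretch], plus its Lipschitz constant times
    the change of [shrink]. *)
Lemma turn_dep s s' t : 0 <= s -> s <= 1 / 4 -> 0 <= s' -> s' <= 1 / 4 -> tri t ->
  dist3 (turn s t) (turn s' t) <= 420 * (`|s - s'| * mass t).
Proof.
move=> s0 s4 s0' s4' tt; rewrite /turn.
apply: le_trans (dist3_triangle _ (stretch s (rot3 (shrink s' t))) _) _.
have [t1 m1] := shrink_tri s0' s4' tt; have [t2 m2] := rot3_tri t1.
have := stretch_lip (rot3 (shrink s t)) (rot3 (shrink s' t)) s0 s4.
have := stretch_dep s0 s4 s0' s4' t2; rewrite m2 m1 dist3_rot3.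
have := shrink_dep s s' tt.
by lra.
Qed.

End PlaneEstimates.

(** * The sphere as a join of triangles *)

(** The combinatorics of the labels, separated from the geometry: [flip] is the action of S, and
    [tau] the action of U on the labels in [inX] and of its inverse on the others. *)
Record gluing (n : nat) := Gluing {
  tau : 'I_n.+1 -> 'I_n.+1;
  inX : pred 'I_n.+1;
  flip : 'I_n.+1 -> 'I_n.+1;
  tauK : involutive tau;
  inX_tau : forall j, inX (tau j) = ~~ inX j;
  flipK : involutive flip }.

Section SphereModel.
Variables (R : realType) (n : nat) (G : gluing n).
Local Notation J := 'I_n.+1.
Local Notation pt := (J -> R).
Local Notation config := (J -> R * R * R).
Local Notation tau := (tau G).
Local Notation inX := (inX G).

Lemma sum_tau (F : pt) : \sum_j F j = \sum_(j | inX j) (F j + F (tau j)).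
Proof.
rewrite (bigID inX) /= big_split /=; congr (_ + _).
rewrite (reindex_inj (inv_inj (tauK G))) /=; apply: eq_bigl => j.
by rewrite inX_tau negbK.
Qed.

(** The value of [beta] is the one for which the coordinates given by [bend] sum to 1. Besides
    positivity, [eps < beta] ensures that the denominators in [levelI] are positive. *)
Definition eps : R := n.+1%:R^-1.
Definition beta : R := (1 + 2 * eps) * eps.

Lemma eps_gt0 : 0 < eps. Proof. by rewrite invr_gt0 ltr0n. Qed.
Lemma eps_lt_beta : eps < beta.
Proof. by have := eps_gt0 => e0; rewrite /beta mulrDl mul1r ltrDl !mulr_gt0. Qed.
Lemma beta_gt0 : 0 < beta. Proof. exact: lt_trans eps_gt0 eps_lt_beta. Qed.
Lemma sum_beta C : \sum_(j < n.+1) beta * C = (1 + 2 * eps) * C.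
Proof.
rewrite sumr_const card_ord -[LHS]mulr_natl mulrA; congr (_ * _).
by rewrite /beta mulrCA mulfV ?mulr1 // pnatr_eq0.
Qed.

(** A point of the join of the boundaries of the triangles: one triple for each pair {j, tau j},
    recorded at both labels. Mass 1 is counted once per pair. *)
Definition conf (q : config) : Prop :=
  [/\ forall j, tri (q j), forall j, q (tau j) = q j & \sum_(j | inX j) mass (q j) = 1].

Definition ucoord (q : config) : pt := fun j => if inX j then (q j).1.1 else (q j).1.2.
Definition ctot (q : config) : R := \sum_(j | inX j) (q j).2.
(** On configurations without third entries this is the identification with the base simplex; all
    other configurations go to the interior of the simplex, on the other side of the sphere. *)
Definition bend (q : config) : pt := fun j => ucoord q j - eps * (q j).2 + beta * ctot q.
Definition theta (q : config) : spt R n := mkpt (0 < ctot q) (bend q).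

Lemma conf_c_le q j : conf q -> (q j).2 <= ctot q.
Proof.
move=> [qt qtau _]; wlog Xj : j / inX j.
  move=> W; case Xj: (inX j); first exact: W.
  by rewrite -qtau; apply: W; rewrite inX_tau Xj.
rewrite /ctot (bigD1 j) //= lerDl; apply: sumr_ge0 => i _; by have [] := qt i.
Qed.

Lemma ctot_ge0 q : conf q -> 0 <= ctot q.
Proof. by move=> [qt _ _]; apply: sumr_ge0 => i _; have [] := qt i. Qed.

Lemma ucoord_ge0 q j : conf q -> 0 <= ucoord q j.
Proof. by move=> [qt _ _]; rewrite /ucoord; case: ifP => _; have [] := qt j. Qed.

Lemma bend_ge q j : conf q -> (beta - eps) * ctot q <= bend q j.
Proof.
move=> cq; have := ucoord_ge0 j cq; have := conf_c_le j cq; have e0 := eps_gt0.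
move=> /(ler_wpM2l (ltW e0)); rewrite /bend; lra.
Qed.

Lemma bend_c0 q j : conf q -> ctot q = 0 -> bend q j = ucoord q j.
Proof.
move=> cq C0; have := conf_c_le j cq; rewrite /bend C0 => Hle.
have [qt _ _] := cq; have [_ _ H0 _] := qt j.
have -> : (q j).2 = 0 by lra.
by rewrite !mulr0 subr0 addr0.
Qed.

Lemma bend_simplex q : conf q -> in_simplex (bend q).
Proof.
move=> cq; split=> [j|].
  apply: le_trans (bend_ge j cq); rewrite mulr_ge0 ?ctot_ge0 // subr_ge0.
  exact: ltW eps_lt_beta.
rewrite /bend big_split /= sum_beta sum_tau.
have [_ qtau qm] := cq.
have -> : \sum_(j | inX j) (ucoord q j - eps * (q j).2 +
     (ucoord q (tau j) - eps * (q (tau j)).2)) = 1 - ctot q - 2 * eps * ctot q.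
  rewrite -[X in X - _ - _]qm /ctot mulr_sumr -!sumrB; apply: eq_bigr => j Xj.
  by rewrite /ucoord inX_tau Xj /= qtau /mass; ring.
by ring.
Qed.

Lemma theta_Sn q : conf q -> Sn (theta q).
Proof. by move=> cq; apply/mkpt_Sn/bend_simplex. Qed.

Definition mu (x : pt) : pt := fun j => Num.min (x j) (x (tau j)).

Lemma mu_tau x j : mu x (tau j) = mu x j.
Proof. by rewrite /mu tauK minC. Qed.

(** Either the third entry vanishes or the lesser of the two others does; so, once the total [C] of
    the third entries is known, the lesser of the coordinates at [j] and [tau j] determines the
    third entry. *)
Definition unbend (C : R) (x : pt) : config := fun j =>
  let c := Num.max 0 ((beta * C - mu x j) / eps) in
  let u i := x i + eps * c - beta * C in
  if inX j then (u j, u (tau j), c) else (u (tau j), u j, c).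

(** Self-consistency of the guess [C]: the third entries computed from it must add up to it. Both 0
    and [root x] solve this, one for each copy of the simplex. *)
Definition balanced (C : R) (x : pt) : Prop :=
  0 <= C /\ \sum_(j | inX j) Num.max 0 ((beta * C - mu x j) / eps) = C.

Lemma balanced0 x : in_simplex x -> balanced 0 x.
Proof.
move=> [x0 _]; split=> //; rewrite big1 // => j _; apply/max_idPl.
rewrite mulr0 sub0r mulNr oppr_le0 divr_ge0 //; last exact: ltW eps_gt0.
by rewrite le_min !x0.
Qed.

Lemma unbendP C x : in_simplex x -> balanced C x ->
  [/\ conf (unbend C x), bend (unbend C x) = x & ctot (unbend C x) = C].
Proof.
move=> [x0 x1] [C0 HC]; have e0 := eps_gt0.
have Hc j : (unbend C x j).2 = Num.max 0 ((beta * C - mu x j) / eps).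
  by rewrite /unbend; case: ifP.
have Et : ctot (unbend C x) = C by rewrite -[RHS]HC; apply: eq_bigr => j _.
have Hu j : ucoord (unbend C x) j =
    x j + eps * Num.max 0 ((beta * C - mu x j) / eps) - beta * C.
  by rewrite /ucoord /unbend; case: (inX j).
have Etau j : unbend C x (tau j) = unbend C x j.
  by rewrite /unbend inX_tau mu_tau tauK; case: (inX j).
split=> //; last first.
  apply/funext => j; rewrite /bend Et Hu Hc; ring.
have key j : let c := Num.max 0 ((beta * C - mu x j) / eps) in
   [/\ 0 <= x j + eps * c - beta * C, 0 <= x (tau j) + eps * c - beta * C, 0 <= c &
       [\/ x j + eps * c - beta * C = 0, x (tau j) + eps * c - beta * C = 0 | c = 0]].
  move=> c.
  have H1 : beta * C - mu x j <= eps * c.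
    by rewrite [eps * c]mulrC -ler_pdivrMr // /c le_max lexx orbT.
  have H2 : mu x j <= x j by rewrite ge_min lexx.
  have H3 : mu x j <= x (tau j) by rewrite ge_min lexx orbT.
  split; [lra|lra|by rewrite le_max lexx|].
  rewrite /c; case: maxrP => _; first by constructor 3.
  have -> : eps * ((beta * C - mu x j) / eps) = beta * C - mu x j.
    by rewrite mulrC mulfVK // gt_eqF.
  by rewrite /mu; case: minrP => _; [constructor 1|constructor 2]; ring.
split=> //.
- move=> j; have [k1 k2 k3 k4] := key j; rewrite /unbend.
  case: ifP => _; split=> //.
  by case: k4 => ?; [constructor 2|constructor 1|constructor 3].
- have -> : \sum_(j | inX j) mass (unbend C x j) =
    \sum_j (x j - beta * C) + (1 + 2 * eps) * \sum_(j | inX j) (unbend C x j).2.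
    rewrite sum_tau mulr_sumr -big_split /=; apply: eq_bigr => j Xj.
    by rewrite /mass /unbend Xj /=; ring.
  by rewrite -/(ctot _) Et sumrB sum_beta x1; ring.
Qed.

Lemma bendK q : conf q -> unbend (ctot q) (bend q) = q.
Proof.
move=> cq; have [qt qtau _] := cq; have e0 := eps_gt0; apply/funext => j.
have Emu : mu (bend q) j =
   Num.min (q j).1.1 (q j).1.2 - eps * (q j).2 + beta * ctot q.
  rewrite /mu /bend qtau /ucoord inX_tau qtau; case: (inX j) => /=;
    by case: (minrP (q j).1.1) => ?; case: minrP => ?; lra.
have Ec : Num.max 0 ((beta * ctot q - mu (bend q) j) / eps) = (q j).2.
  have -> : (beta * ctot q - mu (bend q) j) / eps =
            (q j).2 - Num.min (q j).1.1 (q j).1.2 / eps.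
    by rewrite Emu; field; rewrite gt_eqF.
  have [a0 b0 c0 H] := qt j.
  have m0 : 0 <= Num.min (q j).1.1 (q j).1.2 / eps.
    by rewrite divr_ge0 ?(ltW e0) // le_min a0.
  case: H => E; last by rewrite E; apply/max_idPl; lra.
  - have -> : Num.min (q j).1.1 (q j).1.2 = 0 by rewrite E; apply/min_idPl.
    by rewrite mul0r subr0; apply/max_idPr.
  - have -> : Num.min (q j).1.1 (q j).1.2 = 0 by rewrite E; apply/min_idPr.
    by rewrite mul0r subr0; apply/max_idPr.
rewrite /unbend Ec /bend /ucoord inX_tau !qtau; case: (q j) => -[a b] c /=.
by case: (inX j) => /=; congr (_, _, _); ring.
Qed.

Definition validI (I : {ffun J -> bool}) : bool :=
  [exists j, I j] && [forall j, I j ==> inX j].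

Definition levelI (I : {ffun J -> bool}) (x : pt) : R :=
  (\sum_(j | I j) mu x j) / (\sum_(j | I j) beta - eps).

Definition Xpoint : J := if inX ord0 then ord0 else tau ord0.
Definition I0 : {ffun J -> bool} := [ffun j => j == Xpoint].

(** The sum of positive parts in the balance equation is the maximum over sets of indices of partial
    sums, so its positive solution is the minimum of the solutions of the corresponding linear
    equations. This explicit form shows that it is piecewise linear. *)
Definition root (x : pt) : R := \big[Num.min/levelI I0 x]_(I | validI I) levelI I x.

Lemma inX_Xpoint : inX Xpoint.
Proof. by rewrite /Xpoint; case: ifP => // H; rewrite inX_tau H. Qed.

Lemma validI1 j : inX j -> validI [ffun i => i == j].
Proof.
move=> Xj; apply/andP; split; first by apply/existsP; exists j; rewrite ffunE.
by apply/forallP => i; rewrite ffunE; apply/implyP => /eqP ->.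
Qed.

Lemma denI I : validI I -> 0 < \sum_(j | I j) beta - eps.
Proof.
move=> /andP[/existsP[j Ij] _]; rewrite (bigD1 j) //=.
have : 0 <= \sum_(i | I i && (i != j)) beta by apply: sumr_ge0 => *; exact: ltW beta_gt0.
by have := eps_lt_beta; lra.
Qed.

Lemma root_le x I : validI I -> root x <= levelI I x.
Proof. by move=> vI; apply: bigmin_le_cond. Qed.

Lemma root_arg x : exists2 I, validI I & root x = levelI I x.
Proof.
apply: (big_ind (fun v => exists2 I, validI I & v = levelI I x)).
- by exists I0 => //; apply: validI1; apply: inX_Xpoint.
- by move=> u v [I vI ->] [I' vI' ->]; case: minrP => _; [exists I|exists I'].
- by move=> I vI; exists I.
Qed.

Lemma sum_pos_part (C : R) (x : pt) :
  \sum_(j | inX j) Num.max 0 (beta * C - mu x j) =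
  \sum_(j | inX j && (0 < beta * C - mu x j)) (beta * C - mu x j).
Proof.
rewrite [RHS]big_mkcondr /=; apply: eq_bigr => j _; case: ifP => H.
  by apply/max_idPr/ltW.
by apply/max_idPl; rewrite leNgt H.
Qed.

Lemma balancedE (C : R) (x : pt) : balanced C x <->
  0 <= C /\ \sum_(j | inX j) Num.max 0 (beta * C - mu x j) = eps * C.
Proof.
have e0 := eps_gt0.
have E : \sum_(j | inX j) Num.max 0 (beta * C - mu x j) =
         eps * \sum_(j | inX j) Num.max 0 ((beta * C - mu x j) / eps).
  rewrite mulr_sumr; apply: eq_bigr => j _.
  rewrite maxr_pMr ?(ltW e0) // mulr0 [eps * _]mulrC mulfVK //.
  by rewrite gt_eqF.
split=> -[C0 H]; split=> //; first by rewrite E H.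
by apply: (mulfI (lt0r_neq0 e0)); rewrite -E.
Qed.

Lemma sum_level (C : R) (I : pred J) (x : pt) :
  \sum_(j | I j) (beta * C - mu x j) - eps * C =
  (\sum_(j | I j) beta - eps) * C - \sum_(j | I j) mu x j.
Proof. by rewrite sumrB -mulr_suml; ring. Qed.

(** One inequality is the linear equation of the minimising set, the other is the minimality tested
    on the set of indices whose positive part is not zero. *)
Lemma balanced_root x : in_simplex x -> balanced (root x) x.
Proof.
move=> [x0 _]; apply/balancedE; have m0 j : 0 <= mu x j by rewrite le_min !x0.
have [I vI EI] := root_arg x; set C := root x in EI *.
have C0 : 0 <= C.
  by rewrite EI divr_ge0 ?(ltW (denI vI)) // sumr_ge0.
have e0 := eps_gt0.
split=> //; apply/eqP; rewrite eq_le; apply/andP; split.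
  rewrite sum_pos_part.
  have [/existsP [j Hj]|Hno] := boolP [exists j, inX j && (0 < beta * C - mu x j)].
    pose I' : {ffun J -> bool} := [ffun j => inX j && (0 < beta * C - mu x j)].
    have vI' : validI I'.
      apply/andP; split; first by apply/existsP; exists j; rewrite ffunE.
      by apply/forallP => i; rewrite ffunE; apply/implyP => /andP[].
    have := root_le x vI'; rewrite -/C ler_pdivlMr ?denI // mulrC.
    rewrite -subr_le0 -sum_level subr_le0.
    by under eq_bigl do rewrite ffunE.
  rewrite big_pred0 ?mulr_ge0 ?(ltW e0) // => j.
  by apply/negbTE; move/existsPn: Hno => /(_ j).
have : eps * C <= \sum_(j | I j) (beta * C - mu x j).
  rewrite -subr_ge0 sum_level subr_ge0 EI /levelI mulrC mulfVK //.
  by rewrite gt_eqF // denI.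
move=> /le_trans; apply; have /andP[_ /forallP HI] := vI.
rewrite [leLHS]big_mkcond [leRHS]big_mkcond /=; apply: ler_sum => j _.
have := HI j; case: (I j) => /= [->|_]; first by rewrite le_max lexx orbT.
by case: ifP => _ //; rewrite le_max lexx.
Qed.

Lemma root_unique C x : 0 < C -> balanced C x -> root x = C.
Proof.
move=> C0 /balancedE [_ HC]; have e0 := eps_gt0.
have Hle I : validI I -> C <= levelI I x.
  move=> vI; rewrite ler_pdivlMr ?denI // mulrC -subr_le0 -sum_level subr_le0 -HC.
  have /andP[_ /forallP HI] := vI.
  rewrite [leLHS]big_mkcond [leRHS]big_mkcond /=; apply: ler_sum => j _.
  have := HI j; case: (I j) => /= [->|_]; first by rewrite le_max lexx orbT.
  by case: ifP => _ //; rewrite le_max lexx.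
apply/eqP; rewrite eq_le; apply/andP; split; last first.
  by have [I vI ->] := root_arg x; apply: Hle.
pose I' : {ffun J -> bool} := [ffun j => inX j && (0 < beta * C - mu x j)].
have vI' : validI I'.
  apply/andP; split; last first.
    by apply/forallP => i; rewrite ffunE; apply/implyP => /andP[].
  apply: contraTT (mulr_gt0 e0 C0) => /existsPn Hno.
  rewrite -HC sum_pos_part big_pred0 ?ltxx // => j.
  by have := Hno j; rewrite ffunE => /negbTE.
apply: le_trans (root_le x vI') _; rewrite ler_pdivrMr ?denI // mulrC.
rewrite -subr_ge0 -sum_level subr_ge0 -HC sum_pos_part.
by under [leRHS]eq_bigl do rewrite ffunE.
Qed.

Lemma root_eq0 x : in_simplex x -> root x = 0 <-> on_bdry x.
Proof.
move=> Hx; have [x0 _] := Hx; have m0 j : 0 <= mu x j by rewrite le_min !x0.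
have [C0 _] := balanced_root Hx; split.
  have [I vI ->] := root_arg x => /eqP; rewrite mulf_eq0 invr_eq0.
  rewrite (gt_eqF (denI vI)) orbF => /eqP /psumr_eq0P H.
  have /andP[/existsP[j Ij] _] := vI.
  have := H (fun i _ => m0 i) j Ij; rewrite /mu.
  by case: minrP => _ E; [exists j|exists (tau j)].
move=> [i Ei]; have [j Xj Ej] : exists2 j, inX j & mu x j = 0.
  have Mi : mu x i = 0 by rewrite /mu Ei; apply/min_idPl.
  by case Xi: (inX i); [exists i|exists (tau i)]; rewrite ?inX_tau ?Xi ?mu_tau.
apply/eqP; rewrite eq_le C0 andbT; apply: le_trans (root_le x (validI1 Xj)) _.
rewrite /levelI (big_pred1 j) ?Ej ?mul0r // => i'.
by rewrite ffunE.
Qed.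

Definition height (p : spt R n) : R := if p.1 then root p.2 else 0.
Definition psi (p : spt R n) : config := unbend (height p) p.2.

Lemma height_mkpt s x : in_simplex x -> height (mkpt s x) = if s then root x else 0.
Proof.
move=> Hx; rewrite /height /mkpt /=; case: pselect => //= Hb.
by case: s => //; apply/(root_eq0 Hx).
Qed.

Lemma balanced_height p : Sn p -> balanced (height p) p.2.
Proof.
move=> [Hx _]; rewrite /height; case: (p.1); [exact: balanced_root|exact: balanced0].
Qed.

Lemma psi_conf p : Sn p -> conf (psi p).
Proof. by move=> Sp; have [] := unbendP (proj1 Sp) (balanced_height Sp). Qed.

Lemma psiK p : Sn p -> theta (psi p) = p.
Proof.
move=> Sp; have Hx := proj1 Sp; have [_ E1 E2] := unbendP Hx (balanced_height Sp).
rewrite /theta /psi E1 E2 -[RHS]mkptK // /height.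
case E: (p.1); last by rewrite ltxx.
have [C0 _] := balanced_root Hx; case: ltP => // Hle.
by apply: mkpt_bdry; apply/(root_eq0 Hx); apply/eqP; rewrite eq_le Hle.
Qed.

Lemma thetaK q : conf q -> psi (theta q) = q.
Proof.
move=> cq; have Hx := bend_simplex cq; rewrite /psi /theta height_mkpt //.
have C0 := ctot_ge0 cq; case: ltP => Hc.
  rewrite (_ : root _ = ctot q) ?bendK //; apply: root_unique => //.
  split=> //; rewrite -[RHS]/(ctot q) /ctot; apply: eq_bigr => j _.
  by rewrite -[in RHS](bendK cq) /unbend; case: ifP.
by rewrite (_ : 0 = ctot q) ?bendK //; apply/eqP; rewrite eq_le C0.
Qed.

Definition weights (s : pt) : Prop :=
  [/\ forall j, 0 <= s j, forall j, s j <= 1 / 4,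
      forall j, s (tau j) = s j & forall j, s (flip G j) = s j].

Section Turn.
Variable s : pt.
Hypothesis ws : weights s.

Definition turn_conf (q : config) : config := fun j => turn (s j) (q j).

Lemma turn_confP q : conf q -> conf (turn_conf q).
Proof.
have [s0 s4 st _] := ws; move=> [qt qtau qm]; split.
- by move=> j; have [] := turn_tri (s0 j) (s4 j) (qt j).
- by move=> j; rewrite /turn_conf st qtau.
- rewrite -[RHS]qm; apply: eq_bigr => j _.
  by have [_] := turn_tri (s0 j) (s4 j) (qt j).
Qed.

Definition rhoU (p : spt R n) : spt R n := theta (turn_conf (psi p)).

Lemma rhoU_Sn p : Sn p -> Sn (rhoU p).
Proof. by move=> Sp; apply/theta_Sn/turn_confP/psi_conf. Qed.

Lemma psi_rhoU p : Sn p -> psi (rhoU p) = turn_conf (psi p).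
Proof. by move=> Sp; rewrite thetaK //; apply/turn_confP/psi_conf. Qed.

Lemma rhoU3 p : Sn p -> rhoU (rhoU (rhoU p)) = p.
Proof.
move=> Sp; rewrite {1}/rhoU psi_rhoU ?psi_rhoU //; last exact: rhoU_Sn.
rewrite -[RHS]psiK //; congr theta; apply/funext => j; have [s0 s4 _ _] := ws.
by rewrite /turn_conf turn3 //; have [qt _ _] := psi_conf Sp.
Qed.

End Turn.

Definition rhoS (p : spt R n) : spt R n := mkpt (~~ p.1) (fun j => p.2 (flip G j)).

Lemma flip_simplex (x : pt) : in_simplex x -> in_simplex (fun j => x (flip G j)).
Proof.
move=> [x0 x1]; split=> [j|]; first exact: x0.
by rewrite -[RHS]x1 [RHS](reindex_inj (inv_inj (flipK G))).
Qed.

Lemma flip_bdry (x : pt) : on_bdry x -> on_bdry (fun j => x (flip G j)).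
Proof. by move=> [i Ei]; exists (flip G i); rewrite flipK. Qed.

Lemma rhoS_Sn p : Sn p -> Sn (rhoS p).
Proof. by move=> [Hx _]; apply/mkpt_Sn/flip_simplex. Qed.

Lemma rhoS_mkpt t (x : pt) : rhoS (mkpt t x) = mkpt (~~ t) (fun j => x (flip G j)).
Proof.
case: (pselect (on_bdry x)) => Hb.
  by rewrite /rhoS /=; apply: mkpt_bdry; apply: flip_bdry.
by rewrite /rhoS {2}/mkpt /=; case: pselect.
Qed.

Lemma rhoS2 p : Sn p -> rhoS (rhoS p) = p.
Proof.
move=> Sp; rewrite {2}/rhoS rhoS_mkpt negbK -[RHS]mkptK //; congr mkpt.
by apply/funext => j; rewrite flipK.
Qed.

Lemma PA_rhoS : PA rhoS.
Proof.
exists [::] => t sg; exists (~~ t, \matrix_(i, l) (l == flip G i)%:R) => x _ _ /=.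
rewrite rhoS_mkpt; congr mkpt; apply/funext => j; rewrite /mlin.
by rewrite -[LHS](sum_delta (flip G j) x); apply: eq_bigr => l _; rewrite mxE.
Qed.

Definition PL3 (f : pt -> R * R * R) : Prop :=
  [/\ PL (fun x => (f x).1.1), PL (fun x => (f x).1.2) & PL (fun x => (f x).2)].

Lemma PL_mass f : PL3 f -> PL (fun x => mass (f x)).
Proof. by case=> Ha Hb Hc; apply: PL_add => //; apply: PL_add. Qed.

Lemma PL_clamp (f g : pt -> R) : PL f -> PL g -> PL (fun x => clamp (f x) (g x)).
Proof. by move=> Hf Hg; apply: PL_max; [apply: PL_opp|apply: PL_min]. Qed.

Lemma PL_scaler c (f : pt -> R) : PL f -> PL (fun x => f x * c).
Proof. by move=> /(PL_scale c); apply: PL_ext => x _; rewrite mulrC. Qed.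

Lemma PL3_stretch s f : PL3 f -> PL3 (fun x => stretch s (f x)).
Proof.
move=> H; have HN := PL_mass H; have [Ha Hb Hc] := H.
have H2 : PL (fun x => Num.max (f x).2
    (((f x).2 + s * mass (f x) - Num.min (f x).1.1 (f x).1.2) / 2)).
  apply: PL_max => //; apply: PL_scaler; apply: PL_sub; last exact: PL_min.
  by apply: PL_add => //; apply: PL_scale.
have Hd := PL_clamp (PL_sub HN H2) (PL_scaler (1 - 2 * s)^-1 (PL_sub Ha Hb)).
split=> //; apply: PL_scaler.
  by apply: PL_add Hd; apply: PL_sub.
by apply: PL_sub Hd; apply: PL_sub.
Qed.

Lemma PL3_if3 (psi1 psi2 : pt -> R) f g1 g2 h : PL psi1 -> PL psi2 -> PL3 f -> PL3 g1 -> PL3 g2 ->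
  (forall x, in_simplex x -> 0 <= psi1 x -> h x = f x) ->
  (forall x, in_simplex x -> psi1 x <= 0 -> 0 <= psi2 x -> h x = g1 x) ->
  (forall x, in_simplex x -> psi1 x <= 0 -> psi2 x <= 0 -> h x = g2 x) -> PL3 h.
Proof.
move=> Hp1 Hp2 [f1 f2 f3] [g11 g12 g13] [g21 g22 g23] Hf Hg1 Hg2.
split.
- by apply: (PL_if3 Hp1 Hp2 f1 g11 g21) => [x Hx H|x Hx H H'|x Hx H H'];
    [rewrite Hf|rewrite Hg1|rewrite Hg2].
- by apply: (PL_if3 Hp1 Hp2 f2 g12 g22) => [x Hx H|x Hx H H'|x Hx H H'];
    [rewrite Hf|rewrite Hg1|rewrite Hg2].
- by apply: (PL_if3 Hp1 Hp2 f3 g13 g23) => [x Hx H|x Hx H H'|x Hx H H'];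
    [rewrite Hf|rewrite Hg1|rewrite Hg2].
Qed.

(** The equality tests in the body of [shrink] are replaced by closed conditions: since one entry
    vanishes, the third one is zero as soon as it is at most the two others, and otherwise the
    lesser of the first two is. *)
Lemma PL3_shrink s f : 0 <= s -> s <= 1 / 4 -> (forall x, in_simplex x -> tri (f x)) ->
  PL3 f -> PL3 (fun x => shrink s (f x)).
Proof.
move=> s0 s4 ft H; have HN := PL_mass H; have [Ha Hb Hc] := H.
have Hw : PL (fun x => Num.max 0 (s * mass (f x) - 2 * (f x).2)).
  by apply: PL_max (PL_const _ _) _; apply: PL_sub; apply: PL_scale.
have Hc' : PL (fun x => Num.max 0 (Num.min (f x).2 (2 * (f x).2 - s * mass (f x)))).
  apply: PL_max (PL_const _ _) _; apply: PL_min => //.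
  by apply: PL_sub; apply: PL_scale.
have Hv := PL_sub (PL_sub HN Hw) Hc'.
pose w x := Num.max 0 (s * mass (f x) - 2 * (f x).2).
pose c x := Num.max 0 (Num.min (f x).2 (2 * (f x).2 - s * mass (f x))).
have Ea x : in_simplex x -> (f x).1.1 = 0 -> shrink s (f x) = (w x, mass (f x) - w x - c x, c x).
  move=> Hx E; have [_ b0 c0 _] := ft x Hx; rewrite /w /c.
  case: (f x) E b0 c0 => -[a b] c1 /= -> b0 c0.
  by rewrite shrink_a0 //= /mass /= add0r.
have Eb x : in_simplex x -> (f x).1.2 = 0 -> shrink s (f x) = (mass (f x) - w x - c x, w x, c x).
  move=> Hx E; have := ft x Hx; rewrite /w /c.
  case: (f x) E => -[a b] c1 /= -> tt; have [/= a0 _ c0 _] := tt.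
  rewrite -[(a, 0, c1)]/(swp (0, a, c1)) shrink_swp //; last exact: (tri_swp tt).
  by rewrite shrink_a0 //= /swp /mass /= addr0.
apply: (PL3_if3 (PL_sub (PL_min Ha Hb) Hc) (PL_sub Hb Ha)
   (f := fun x => ((f x).1.1 + s * ((f x).1.2 - (f x).1.1),
     (f x).1.2 + s * ((f x).1.1 - (f x).1.2), 0))
   (g1 := fun x => (w x, mass (f x) - w x - c x, c x))
   (g2 := fun x => (mass (f x) - w x - c x, w x, c x))).
- split=> /=; last exact: PL_const.
    by apply: PL_add => //; apply: PL_scale; apply: PL_sub.
  by apply: PL_add => //; apply: PL_scale; apply: PL_sub.
- by split.
- by split.
- move=> x Hx; rewrite subr_ge0 le_min => /andP[ca cb].
  have [a0 b0 c0 H0] := ft x Hx.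
  have Ec : (f x).2 = 0 by case: H0; lra.
  by case: (f x) Ec => -[a b] c1 /= ->; rewrite shrink_c0.
- move=> x Hx; rewrite subr_le0 subr_ge0 ge_min => H1 H2; apply: Ea => //.
  have [a0 b0 c0 H0] := ft x Hx.
  by case/orP: H1 => H1; case: H0; lra.
- move=> x Hx; rewrite !subr_le0 ge_min => H1 H2; apply: Eb => //.
  have [a0 b0 c0 H0] := ft x Hx.
  by case/orP: H1 => H1; case: H0; lra.
Qed.

Lemma PL3_turn s f : 0 <= s -> s <= 1 / 4 -> (forall x, in_simplex x -> tri (f x)) ->
  PL3 f -> PL3 (fun x => turn s (f x)).
Proof.
move=> s0 s4 ft /(PL3_shrink s0 s4 ft) [Ha Hb Hc].
exact: PL3_stretch.
Qed.

Lemma PL_root : PL root.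
Proof.
have Hl I : PL (levelI I).
  by apply: PL_scaler; apply: PL_sum => j; apply: PL_min; apply: PL_coord.
exact: PL_bigmin.
Qed.

Lemma PL3_unbend C j : PL C -> PL3 (fun x => unbend (C x) x j).
Proof.
move=> HC.
have Hc : PL (fun x => Num.max 0 ((beta * C x - mu x j) / eps)).
  apply: PL_max (PL_const _ _) _; apply: PL_scaler; apply: PL_sub; first exact: PL_scale.
  by apply: PL_min; apply: PL_coord.
have Hu i : PL (fun x => x i + eps * Num.max 0 ((beta * C x - mu x j) / eps) - beta * C x).
  apply: PL_sub; last exact: PL_scale.
  by apply: PL_add; [apply: PL_coord|apply: PL_scale].
by rewrite /unbend; case: (inX j); (split=> /=; [exact: Hu|exact: Hu|exact: Hc]).
Qed.

Lemma PA_rhoU s : weights s -> PA (rhoU s).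
Proof.
move=> ws; have [s0 s4 st _] := ws.
pose q t x := turn_conf s (psi (mkpt t x)).
have cq t x : in_simplex x -> conf (q t x).
  by move=> Hx; apply/turn_confP => //; apply/psi_conf/mkpt_Sn.
have Hq t j : PL3 (fun x => q t x j).
  apply: PL3_turn => //.
    by move=> x Hx; have [] := psi_conf (mkpt_Sn t Hx).
  have HC : PL (fun x => if t then root x else 0).
    by case: t; [apply: PL_root|apply: PL_const].
  have [H1 H2 H3] := PL3_unbend j HC.
  by split; [apply: PL_ext H1|apply: PL_ext H2|apply: PL_ext H3] => x Hx;
    rewrite /psi height_mkpt.
have Hu t j : PL (fun x => ucoord (q t x) j).
  by rewrite /ucoord; have [] := Hq t j; case: (inX j).
have Hbend t j : PL (fun x => bend (q t x) j).
  apply: PL_add; first by apply: PL_sub => //; apply: PL_scale; have [] := Hq t j.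
  by apply: PL_scale; apply: PL_sum => i; have [] := Hq t i.
(* The entries of the configuration are made linear on cells as well, not only the final
   coordinates; the midpoint argument below depends on it. *)
pose phi (i : bool * (J * 'I_3)) (x : pt) : R :=
  match i with (t, (j, k)) =>
    if k == 0 then bend (q t x) j else if k == 1 then ucoord (q t x) j
    else (q t x j).2 end.
have Hphi i : PL (phi i).
  case: i => t [j k]; rewrite /phi; case: (k == 0); first exact: Hbend.
  by case: (k == 1) => //; have [] := Hq t j.
have [Phi Hfam] := PL_family Hphi; exists Phi => t sg.
have [al Hal] := Hfam sg.
pose M := \matrix_(i, l) al (t, (i, 0)) 0 l.
have EM x : in_simplex x -> cell Phi sg x -> bend (q t x) = mlin M x.
  move=> Hx Cx; apply/funext => i.
  rewrite -[LHS]/(phi (t, (i, 0)) x) Hal // /mlin /lin.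
  by apply: eq_bigr => l _; rewrite mxE.
have EU x : in_simplex x -> cell Phi sg x ->
    rhoU s (mkpt t x) = mkpt (0 < ctot (q t x)) (mlin M x).
  by move=> Hx Cx; rewrite -EM.
(* The side has to be constant on the cell. If third entries are positive at some [x1], the side is
   [true], and it remains to see that points where they all vanish are sent to the boundary. *)
have [[x1 [Hx1 Cx1 Hpos]]|Hno] := pselect (exists x1,
    [/\ in_simplex x1, cell Phi sg x1 & 0 < ctot (q t x1)]); last first.
  exists (false, M) => x Hx Cx; rewrite EU //; case: ltP => // H.
  by case: Hno; exists x.
exists (true, M) => x Hx Cx; rewrite EU //; case: ltP => // Hle.
have C0 : ctot (q t x) = 0 by apply/eqP; rewrite eq_le Hle ctot_ge0 //; apply: cq.
apply: mkpt_bdry; rewrite -EM //; apply: contrapT => Nb.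
have upos j : 0 < ucoord (q t x) j.
  rewrite lt_neqAle ucoord_ge0 ?andbT; last exact: cq.
  by apply/eqP => E; apply: Nb; exists j; rewrite bend_c0 //; apply: cq.
have [j Xj cj] : exists2 j, inX j & 0 < (q t x1 j).2.
  apply: contrapT => Hn; move: Hpos; rewrite /ctot big1 ?ltxx // => j Xj.
  apply/eqP; rewrite eq_le; have [qt _ _] := cq t _ Hx1; have [_ _ -> _] := qt j.
  by rewrite andbT leNgt; apply/negP => Hj; apply: Hn; exists j.
(* If [x] were sent to the interior, then at the midpoint all first and second entries and one third
   entry would be positive, which no triple allows. *)
pose y : pt := fun i => (x i + x1 i) / 2.
have ly l : lin l y = (lin l x + lin l x1) / 2.
  by rewrite /lin -big_split mulr_suml /=; apply: eq_bigr => i _; rewrite /y; lra.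
have Hy : in_simplex y.
  have [x0 xs] := Hx; have [x10 x1s] := Hx1; split=> [i|].
    by rewrite /y; have := x0 i; have := x10 i; lra.
  by rewrite /y -mulr_suml big_split /= xs x1s; lra.
have Cy : cell Phi sg y.
  move=> l lP; have := Cx l lP; have := Cx1 l lP; rewrite ly.
  by case: (sg l); lra.
have mid i : phi i y = (phi i x + phi i x1) / 2 by rewrite !Hal.
have uy i : 0 < ucoord (q t y) i.
  have := mid (t, (i, 1)); rewrite /phi /= => ->; have := upos i.
  by have := ucoord_ge0 i (cq t _ Hx1); lra.
have cy : 0 < (q t y j).2.
  have := mid (t, (j, inord 2)); rewrite /phi.
  have -> : (inord 2 == 0 :> 'I_3) = false by apply/negP => /eqP/(congr1 val); rewrite /= inordK.
  have -> : (inord 2 == 1 :> 'I_3) = false by apply/negP => /eqP/(congr1 val); rewrite /= inordK.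
  move=> ->; have [qt _ _] := cq t _ Hx; have [_ _ + _] := qt j; lra.
have [qt qtau _] := cq t _ Hy; have [_ _ _ H0] := qt j.
have u1 : 0 < (q t y j).1.1 by have := uy j; rewrite /ucoord Xj.
have u2 : 0 < (q t y j).1.2 by have := uy (tau j); rewrite /ucoord inX_tau Xj qtau.
by case: H0; lra.
Qed.

End SphereModel.

(** * Stochastic matrices of the words and their contraction *)

Section Contraction.
Variables (R : realType) (n : nat) (G : gluing n).
Local Notation J := 'I_n.+1.
Local Notation pt := (J -> R).
Local Notation tau := (tau G).
Local Notation inX := (inX G).
Local Notation flip := (flip G).
Local Notation eps := (eps R n).
Local Notation beta := (beta R n).

Definition unit_pt (i : J) : pt := fun j => (j == i)%:R.

Definition linear_pt (F : pt -> R) : Prop := exists a : pt, forall y, F y = \sum_i a i * y i.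

Lemma linear_coord i : linear_pt (fun y => y i).
Proof. by exists (unit_pt i) => y; rewrite sum_delta. Qed.

Lemma linear_add F H : linear_pt F -> linear_pt H -> linear_pt (fun y => F y + H y).
Proof.
move=> [a Ha] [b Hb]; exists (fun i => a i + b i) => y; rewrite Ha Hb -big_split.
by apply: eq_bigr => i _; rewrite mulrDl.
Qed.

Lemma linear_scale c F : linear_pt F -> linear_pt (fun y => c * F y).
Proof.
move=> [a Ha]; exists (fun i => c * a i) => y; rewrite Ha mulr_sumr.
by apply: eq_bigr => i _; rewrite mulrA.
Qed.

Lemma linear_sub F H : linear_pt F -> linear_pt H -> linear_pt (fun y => F y - H y).
Proof.
move=> HF /(linear_scale (-1)) /(linear_add HF) [a Ha]; exists a => y.
by rewrite -Ha mulN1r.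
Qed.

Lemma linear_zero : linear_pt (fun=> 0).
Proof. by exists (fun=> 0) => y; rewrite big1 // => i _; rewrite mul0r. Qed.

Lemma linear_sum (P : pred J) (F : J -> pt -> R) : (forall j, linear_pt (F j)) ->
  linear_pt (fun y => \sum_(j | P j) F j y).
Proof.
move=> /choice [a Ha]; exists (fun i => \sum_(j | P j) a j i) => y.
under eq_bigr do rewrite Ha.
by rewrite exchange_big /=; apply: eq_bigr => i _; rewrite mulr_suml.
Qed.

Section Step.
Variable s : pt.
Hypothesis ws : weights G s.

Definition blend (y : pt) : pt := fun j => y j + s j * (y (tau j) - y j).

(** The configuration of the image of a point of the base copy under U (bit [true]) or U U (bit
    [false]), by the linear formulas of [turn_c0] and [turn_a0]. *)
Definition tq (b : bool) (y : pt) (j : J) : R * R * R :=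
  let jx := if inX j then j else tau j in let jy := if inX j then tau j else j in
  if b then (0, blend y jx, blend y jy) else (blend y jy, 0, blend y jx).

(** S U or S U U as a map of the base copy to itself; the composition with [flip] is the action of
    S. *)
Definition step (b : bool) (y : pt) : pt := fun j => bend G (tq b y) (flip j).

Lemma psi_false (y : pt) j : in_simplex y -> psi G (mkpt false y) j =
  if inX j then (y j, y (tau j), 0) else (y (tau j), y j, 0).
Proof.
move=> Hy; rewrite /psi height_mkpt // /unbend /=.
have -> : Num.max 0 ((beta * 0 - mu G y j) / eps) = 0.
  have [_] := balanced0 G Hy; rewrite mulr0 sub0r => _; apply/max_idPl.
  have [y0 _] := Hy; rewrite mulNr oppr_le0 divr_ge0 ?(ltW (eps_gt0 R n)) //.
  by rewrite le_min !y0.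
by rewrite !mulr0 !addr0 !subr0.
Qed.

Lemma turn_psi_false y : in_simplex y -> turn_conf s (psi G (mkpt false y)) = tq true y.
Proof.
move=> Hy; have [y0 _] := Hy; have [s0 s4 st _] := ws.
apply/funext => j; rewrite /turn_conf psi_false // /tq /blend.
by case: ifP => Xj; rewrite turn_c0 ?st ?tauK.
Qed.

Lemma turn_tq y : in_simplex y -> turn_conf s (tq true y) = tq false y.
Proof.
move=> [y0 _]; have [s0 s4 st _] := ws; apply/funext => j; rewrite /turn_conf /tq /blend.
by case: ifP => Xj; rewrite !tauK !st turn_a0.
Qed.

Lemma conf_tq b y : in_simplex y -> conf G (tq b y).
Proof.
move=> Hy; have c1 : conf G (tq true y).
  by rewrite -turn_psi_false //; apply: turn_confP => //; apply/psi_conf/mkpt_Sn.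
by case: b => //; rewrite -turn_tq //; apply: turn_confP.
Qed.

Lemma step_simplex b y : in_simplex y -> in_simplex (step b y).
Proof. by move=> Hy; apply: flip_simplex; apply/bend_simplex/conf_tq. Qed.

Lemma theta_tq b y : in_simplex y -> theta G (tq b y) = mkpt true (bend G (tq b y)).
Proof.
move=> Hy; rewrite /theta; case: ltP => // Hle; apply: mkpt_bdry.
have cq := conf_tq b Hy.
have C0 : ctot G (tq b y) = 0 by apply/eqP; rewrite eq_le Hle ctot_ge0.
exists (if b then Xpoint G else tau (Xpoint G)); rewrite bend_c0 // /ucoord /tq.
by case: b {cq C0 Hle}; rewrite ?inX_tau inX_Xpoint.
Qed.

Lemma rhoU_false y : in_simplex y -> rhoU G s (mkpt false y) = mkpt true (bend G (tq true y)).
Proof. by move=> Hy; rewrite /rhoU turn_psi_false // theta_tq. Qed.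

Lemma rhoU2_false y : in_simplex y ->
  rhoU G s (rhoU G s (mkpt false y)) = mkpt true (bend G (tq false y)).
Proof.
move=> Hy; rewrite {1}/rhoU psi_rhoU ?turn_psi_false ?turn_tq ?theta_tq //.
exact: mkpt_Sn.
Qed.

Lemma step_rho b y : in_simplex y ->
  rhoS G (if b then rhoU G s (mkpt false y) else rhoU G s (rhoU G s (mkpt false y)))
  = mkpt false (step b y).
Proof. by move=> Hy; case: b; [rewrite rhoU_false|rewrite rhoU2_false]; rewrite // rhoS_mkpt. Qed.

Lemma linear_step b j : linear_pt (fun y => step b y j).
Proof.
have Hb i : linear_pt (fun y => blend y i).
  apply: linear_add; first exact: linear_coord.
  by apply: linear_scale; apply: linear_sub; apply: linear_coord.
have H0 := linear_zero.
have Hu i : linear_pt (fun y => ucoord G (tq b y) i).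
  by rewrite /ucoord /tq; case: (inX i); case: b => /=.
have Hc i : linear_pt (fun y => (tq b y i).2) by rewrite /tq; case: (inX i); case: (b) => /=.
apply: linear_add; first by apply: linear_sub => //; apply: linear_scale.
by apply: linear_scale; apply: linear_sum.
Qed.

Lemma step_delta b y j : step b y j = \sum_i y i * step b (unit_pt i) j.
Proof.
have [a Ha] := linear_step b j; rewrite Ha; apply: eq_bigr => i _; rewrite Ha.
have := sum_delta i a; under eq_bigr do rewrite mulrC.
by rewrite /unit_pt => ->; rewrite mulrC.
Qed.

Lemma step_ge b y j : in_simplex y -> (beta - eps) * ctot G (tq b y) <= step b y j.
Proof. by move=> Hy; apply: bend_ge; apply: conf_tq. Qed.

Lemma tau_neq j : (tau j == j) = false.
Proof. by apply/negP => /eqP E; have := inX_tau G j; rewrite E; case: (inX j). Qed.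

Lemma blend_delta i j : blend (unit_pt i) j =
  if j == i then 1 - s i else if j == tau i then s i else 0.
Proof.
have [_ _ st _] := ws; rewrite /blend /unit_pt.
have [->|ji] := eqVneq j i; first by rewrite ?eqxx tau_neq /=; ring.
have [->|jti] := eqVneq j (tau i); first by rewrite tauK eqxx ?tau_neq st /=; ring.
have -> : (tau j == i) = false.
  by apply/negP => /eqP E; move/eqP: jti; rewrite -E tauK.
by rewrite /=; ring.
Qed.

(** This total decides where a vertex goes: since s is at most 1/4 it vanishes only when [inX i = b]
    and [s i = 0], and in every other case the image is interior by [step_ge]. *)
Lemma ctot_tq_delta b i : ctot G (tq b (unit_pt i)) = if inX i == b then s i else 1 - s i.
Proof.
have [_ _ st _] := ws.
have E : ctot G (tq b (unit_pt i)) =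
    \sum_(j | inX j) blend (unit_pt i) (if b then tau j else j).
  by apply: eq_bigr => j Xj; rewrite /tq Xj; case: b.
rewrite E (bigD1 (if inX i then i else tau i)) /=; last first.
  by case: ifP => // H; rewrite inX_tau H.
rewrite big1 ?addr0; last first.
  move=> j /andP[Xj]; rewrite blend_delta.
  have H1 : j != i -> j != tau i -> (if b then tau j else j) == i = false.
    move=> ji jti; case: (b); apply/negP => /eqP Ej; last by move/eqP: ji.
    by move/eqP: jti; rewrite -Ej tauK.
  have H2 : j != i -> j != tau i -> (if b then tau j else j) == tau i = false.
    move=> ji jti; case: (b); apply/negP => /eqP Ej; last by move/eqP: jti.
    by move/eqP: ji; apply; apply: (inv_inj (tauK G)).
  move=> Hj; have [ji jti] : j != i /\ j != tau i.
    move: Hj; case Xi: (inX i) => Hj; split => //.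
      by apply: contraTneq Xj => ->; rewrite inX_tau Xi.
    by apply: contraTneq Xj => ->; rewrite Xi.
  by rewrite H1 // H2.
rewrite blend_delta; case: (inX i); case: (b) => /=;
  by rewrite ?tauK ?eqxx ?tau_neq ?[_ == tau _]eq_sym ?tau_neq ?eqxx.
Qed.

Definition sig (j : J) : J := flip (tau j).
Definition sgi (j : J) : J := tau (flip j).
Lemma sgiK : cancel sgi sig. Proof. by move=> j; rewrite /sig /sgi tauK flipK. Qed.
Lemma sigK : cancel sig sgi. Proof. by move=> j; rewrite /sig /sgi flipK tauK. Qed.

Lemma s_sgi j : s (sgi j) = s j.
Proof. by have [_ _ st sf] := ws; rewrite /sgi st sf. Qed.

Lemma delta_simp i : in_simplex (unit_pt i). Proof. exact: delta_simplex. Qed.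

Lemma step_persist b i : inX i = b -> s i = 0 -> step b (unit_pt i) = unit_pt (sig i).
Proof.
move=> Xi si; have [_ _ st _] := ws; apply/funext => j.
have cq := conf_tq b (delta_simp i).
rewrite /step bend_c0 // ?ctot_tq_delta ?Xi ?eqxx //.
have -> : ucoord G (tq b (unit_pt i)) (flip j) =
   if inX (flip j) == b then 0 else blend (unit_pt i) (tau (flip j)).
  by rewrite /ucoord /tq; case: (inX (flip j)); case: b {Xi cq}.
rewrite blend_delta si subr0 /unit_pt /sig.
have -> : (tau (flip j) == i) = (j == flip (tau i)).
  by apply/eqP/eqP => [<-|->]; rewrite ?tauK ?flipK ?tauK.
rewrite -/sgi.
case: eqVneq => [Xf|Xf]; last by case: eqP => // _; case: ifP.
case: eqP => // Ej; move: Xf; rewrite Ej flipK inX_tau Xi.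
by case: b {Xi cq}.
Qed.

(** The outermost letter comes first, so the word is read backwards in time: each letter must send
    the vertex [sgi v] to the vertex [v]. *)
Fixpoint persists (v : J) (w : seq bool) : bool :=
  if w is b :: w' then (inX (sgi v) == b) && persists (sgi v) w' else true.

Fixpoint run (w : seq bool) (y : pt) : pt :=
  if w is b :: w' then step b (run w' y) else y.

Lemma run_cat w w' y : run (w ++ w') y = run w (run w' y).
Proof. by elim: w => //= b w ->. Qed.

Lemma run_simplex w y : in_simplex y -> in_simplex (run w y).
Proof. by elim: w => //= b w IH /IH; apply: step_simplex. Qed.

Lemma run_delta w y j : run w y j = \sum_i y i * run w (unit_pt i) j.
Proof.
elim: w y j => [|b w IH] y j /=.
  by rewrite -[LHS](sum_delta j y); apply: eq_bigr => i _; rewrite /unit_pt mulrC eq_sym.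
rewrite [LHS]step_delta; under [LHS]eq_bigr => l _ do rewrite IH mulr_suml.
rewrite exchange_big /=; apply: eq_bigr => i _.
by rewrite [in RHS]step_delta mulr_sumr; apply: eq_bigr => l _; rewrite mulrA.
Qed.

Lemma run_persist v w : s v = 0 -> persists v w ->
  run w (unit_pt (iter (size w) sgi v)) = unit_pt v.
Proof.
elim: w v => //= b w IH v sv /andP[/eqP Xv pv].
rewrite -iterS iterSr IH ?s_sgi // step_persist ?s_sgi //.
by rewrite sgiK.
Qed.

Lemma mixing : exists2 del : R, 0 < del <= 1 &
  forall b i, ~ (inX i = b /\ s i = 0) -> forall j, del <= step b (unit_pt i) j.
Proof.
have [s0 s4 _ _] := ws; have be := eps_lt_beta R n.
(* Lower bound for the total of third entries at a vertex that does not persist: [s i] if positive,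
   and 1 - s i, at least 3/4, when the bit is the wrong one. *)
pose F i : R := if s i == 0 then 3 / 4 else s i.
case: (@arg_minP _ _ _ ord0 xpredT F) => // i0 _ Hmin.
have F0 i : 0 < F i by rewrite /F; case: eqVneq => [_|si]; [lra|rewrite lt0r si s0].
have F1 i : F i <= 3 / 4 by rewrite /F; case: ifP => _ //; have := s4 i; lra.
have key b i : ~ (inX i = b /\ s i = 0) -> F i0 <= ctot G (tq b (unit_pt i)).
  rewrite ctot_tq_delta => H; have h1 := Hmin i isT; have h2 := F1 i0; have h3 := s4 i.
  case: eqP => [Xi|_]; last by lra.
  have si : s i != 0 by apply/eqP => si; apply: H.
  by have <- : F i = s i by rewrite /F (negbTE si).
have H1 b i : ~ (inX i = b /\ s i = 0) -> forall j,
    (beta - eps) * F i0 <= step b (unit_pt i) j.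
  move=> /key H j; apply: le_trans (step_ge b j (delta_simp i)).
  by rewrite ler_wpM2l // subr_ge0 ltW.
exists ((beta - eps) * F i0) => //; rewrite mulr_gt0 ?subr_gt0 //=.
pose i := Xpoint G; have Hn : ~ (inX i = false /\ s i = 0) by rewrite inX_Xpoint => -[].
apply: le_trans (H1 _ _ Hn i) _.
have [p0 p1] := step_simplex false (delta_simp i); rewrite -p1 (bigD1 i) //= lerDl.
exact: sumr_ge0.
Qed.

Definition separated : Prop := forall v v',
  (forall i, inX (iter i.+1 sgi v) = inX (iter i.+1 sgi v')) -> v = v'.

Lemma sgi_period : exists2 L, (0 < L)%N & forall v, iter L sgi v = v.
Proof.
have inj : injective sgi := can_inj sgiK.
exists #[perm inj]%g; first exact: fingroup.order_gt0.
move=> v; have := permX (perm inj) v #[perm inj]%g; rewrite expg_order perm1 => {2}->.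
by apply: eq_iter => x; rewrite permE.
Qed.

Lemma persistsP v w : persists v w <->
  forall i, (i < size w)%N -> nth false w i = inX (iter i.+1 sgi v).
Proof.
elim: w v => //= b w IH v; split.
  by move=> /andP[/eqP <- /IH H] [|i] //= Hi; rewrite H // -iterSr.
move=> H; apply/andP; split; first by have /= <- := H 0%N isT; apply/eqP.
by apply/IH => i Hi; have := H i.+1 Hi; rewrite /= -!iterS -iterSr => ->.
Qed.

(** The map [sgi] permutes a finite set, so itineraries have a common period and one period already
    separates them. *)
Lemma separated_bound : separated -> exists2 L, (0 < L)%N &
  forall w v v', (L <= size w)%N -> persists v w -> persists v' w -> v = v'.
Proof.
move=> sep; have [L L0 HL] := sgi_period; exists L => // w v v' Hw /persistsP pv /persistsP pv'.
apply: sep => i.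
have per u k : iter k sgi u = iter (k %% L)%N sgi u.
  rewrite {1}(divn_eq k L) addnC iterD.
  have -> : iter (k %/ L * L)%N sgi u = u; last by [].
  by elim: (k %/ L)%N => //= m IH; rewrite mulSn iterD IH HL.
have E k : iter k.+1 sgi v = iter (k %% L)%N.+1 sgi v by rewrite !iterS per.
have E' k : iter k.+1 sgi v' = iter (k %% L)%N.+1 sgi v' by rewrite !iterS per.
have Hi : (i %% L < size w)%N by apply: leq_trans Hw; rewrite ltn_mod.
by rewrite E E' -pv // -pv'.
Qed.

Definition source w i : Prop := exists v, [/\ s v = 0, persists v w & i = iter (size w) sgi v].

(** If the inner word still sends [i] to a vertex, the outermost step mixes and all entries are at
    least [del]. Otherwise induction bounds the weight at [sgi v], and the outermost step carries
    that weight to [v] without loss. *)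
Lemma run_nonpersist del : (forall b i, ~ (inX i = b /\ s i = 0) ->
    forall j, del <= step b (unit_pt i) j) ->
  forall w b i v, s v = 0 -> persists v (belast b w) -> ~ source (b :: w) i ->
    del <= run (b :: w) (unit_pt i) v.
Proof.
move=> Hdel; elim=> [|b' w IH] b i v sv pv Hs.
  apply: Hdel => -[Xi si]; apply: Hs; exists (sig i); split=> /=.
  - by rewrite -s_sgi sigK.
  - by rewrite sigK Xi eqxx.
  - by rewrite sigK.
have [[u [su pu Ei]]|Hs'] := pselect (source (b' :: w) i).
  have -> : run (b :: b' :: w) (unit_pt i) = step b (unit_pt u).
    by rewrite /= -[step b' _]/(run (b' :: w) (unit_pt i)) Ei run_persist.
  apply: Hdel => -[Xu _]; apply: Hs; exists (sig u); split.
  - by rewrite -s_sgi sigK.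
  - by rewrite /= sigK Xu eqxx; move: pu => /=.
  - by rewrite Ei [size (b :: _)]/= iterSr sigK.
move: pv => /= /andP[/eqP Xv pv].
have := IH b' i (sgi v) _ pv Hs'; rewrite s_sgi => /(_ sv) H.
change (del <= step b (run (b' :: w) (unit_pt i)) v); rewrite step_delta.
set y := run (b' :: w) (unit_pt i) in H *.
rewrite (bigD1 (sgi v)) //= step_persist // ?s_sgi // sgiK /unit_pt eqxx mulr1.
apply: le_trans H _; rewrite lerDl; apply: sumr_ge0 => l _; rewrite mulr_ge0 //.
  by have [] := @run_simplex (b' :: w) _ (delta_simp i).
by have [] := step_simplex b (delta_simp l).
Qed.

Lemma run_dist_le w x y : in_simplex x -> in_simplex y ->
  dist1 (run w x) (run w y) <= dist1 x y.
Proof.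
move=> Hx Hy; rewrite /dist1.
under eq_bigr do rewrite run_delta [X in _ - X]run_delta -sumrB.
apply: (@le_trans _ _ (\sum_j \sum_i `|x i - y i| * run w (unit_pt i) j)).
  apply: ler_sum => j _; apply: le_trans (ler_norm_sum _ _ _) _; apply: ler_sum => i _.
  rewrite -mulrBl normrM (@ger0_norm _ (run _ _ _)) //.
  by have [] := run_simplex w (delta_simp i).
rewrite exchange_big /=; apply: ler_sum => i _; rewrite -mulr_sumr.
by have [_ ->] := run_simplex w (delta_simp i); rewrite mulr1.
Qed.

(** Doeblin's argument: the common part [del] of the column [v] cancels in the difference, because
    both arguments have total weight 1, and what remains has row sums 1 - del. *)
Lemma run_contract del w v x y : 0 <= del -> (forall i, del <= run w (unit_pt i) v) ->
  in_simplex x -> in_simplex y -> dist1 (run w x) (run w y) <= (1 - del) * dist1 x y.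
Proof.
move=> d0 Hdel Hx Hy; pose c i j := run w (unit_pt i) j - del * unit_pt v j.
have c0 i j : 0 <= c i j.
  rewrite /c {2}/unit_pt; case: eqP => [->|_]; first by rewrite mulr1 subr_ge0.
  by rewrite mulr0 subr0; have [] := run_simplex w (delta_simp i).
have E j : run w x j - run w y j = \sum_i (x i - y i) * c i j.
  rewrite run_delta [X in _ - X]run_delta -sumrB /c.
  under [RHS]eq_bigr do rewrite mulrBr.
  have Z : \sum_i (x i - y i) * (del * unit_pt v j) = 0.
    by rewrite -mulr_suml sumrB (proj2 Hx) (proj2 Hy) subrr mul0r.
  by rewrite [RHS]sumrB Z subr0; apply: eq_bigr => i _; rewrite mulrBl.
rewrite /dist1; under eq_bigr do rewrite E.
apply: (@le_trans _ _ (\sum_j \sum_i `|x i - y i| * c i j)).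
  apply: ler_sum => j _; apply: le_trans (ler_norm_sum _ _ _) _; apply: ler_sum => i _.
  by rewrite normrM (ger0_norm (c0 i j)).
rewrite exchange_big /= mulr_sumr; apply: ler_sum => i _; rewrite -mulr_sumr mulrC.
rewrite /c sumrB -mulr_sumr; have [_ ->] := run_simplex w (delta_simp i).
by have [_ ->] := delta_simp v; rewrite mulr1.
Qed.

Lemma expr_small (x e : R) : 0 <= x < 1 -> 0 < e -> exists m, x ^+ m < e.
Proof.
move=> /andP[x0 x1] e0; pose d := 1 - x; have d0 : 0 < d by rewrite subr_gt0.
have Ex : x = 1 - d by rewrite /d; ring.
clearbody d; have B m : x ^+ m * (1 + m%:R * d) <= 1.
  elim: m => [|m IH]; first by rewrite expr0 mul0r addr0 mulr1.
  apply: le_trans IH; rewrite exprSr -mulrA ler_wpM2l ?exprn_ge0 //.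
  rewrite -natr1 Ex.
  have : 0 <= (m%:R + 1) * (d * d).
    by apply: mulr_ge0; [rewrite addr_ge0|apply: mulr_ge0; exact: ltW].
  by lra.
exists (Num.bound (1 / (d * e))); set m := Num.bound _.
have Hm : 1 / (d * e) < m%:R by apply: archi_boundP; rewrite divr_ge0 // mulr_ge0 // ltW.
rewrite ltr_pdivrMr ?mulr_gt0 // in Hm.
rewrite ltNge; apply/negP => He; have := B m; apply/negP; rewrite -ltNge.
apply: (@lt_le_trans _ _ (e * (1 + m%:R * d))); first by lra.
by rewrite ler_wpM2r // addr_ge0 // mulr_ge0 // ltW.
Qed.

Lemma dist1_simplex x y : in_simplex x -> in_simplex y -> @dist1 R n x y <= 2.
Proof.
move=> [x0 x1] [y0 y1]; apply: (@le_trans _ _ (\sum_i (x i + y i))).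
  apply: ler_sum => i _; apply: le_trans (ler_normB _ _) _.
  by rewrite !ger0_norm.
by rewrite big_split /= x1 y1; lra.
Qed.

(** Every word of length [L] has a column bounded below by [del], so each block of [L] letters
    contracts by the factor 1 - del. *)
Lemma run_shrink : separated -> (exists v, s v = 0) -> forall e : R, 0 < e ->
  exists D, forall w, (D <= size w)%N -> forall x y, in_simplex x -> in_simplex y ->
    dist1 (run w x) (run w y) < e.
Proof.
move=> sep [v0 sv0] e e0; have [L L0 HL] := separated_bound sep.
have [del /andP[d0 d1] Hdel] := mixing.
have Hrow w : (L <= size w)%N -> exists v, forall i, del <= run w (unit_pt i) v.
  move=> Hw; have [[v [sv pv]]|Hno] := pselect (exists v, s v = 0 /\ persists v w).
    exists v => i; have [[u [su pu Ei]]|Hs] := pselect (source w i).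
      by rewrite Ei run_persist // (HL w u v) // /unit_pt eqxx.
    case: w Hw pv Hs => [|b w] Hw pv Hs; first by move: Hw; rewrite leqNgt L0.
    apply: run_nonpersist => //; move: pv; rewrite lastI -cats1.
    by move/persistsP => pv; apply/persistsP => k Hk; rewrite -pv ?nth_cat ?Hk // size_cat ltn_addr.
  (* The longest prefix along which a vertex persists. With one more letter there is no source left,
     so [run_nonpersist] bounds the whole column of that vertex, and averaging over the remaining
     inner letters keeps the bound. *)
  pose P m := `[< exists v, s v = 0 /\ persists v (take m w) >].
  have P0 : exists m, P m by exists 0%N; apply/asboolP; exists v0; rewrite take0.
  have Pb m : P m -> (m <= size w)%N.
    move=> /asboolP [v [sv pv]]; rewrite leqNgt; apply/negP => Hm.
    by apply: Hno; exists v; rewrite take_oversize // in pv; apply: ltnW.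
  case: (ex_maxnP P0 Pb) => m /asboolP [v [sv pv]] Hmax.
  have Hm : (m < size w)%N.
    rewrite ltn_neqAle Pb ?andbT; last by apply/asboolP; exists v.
    by apply/eqP => Em; apply: Hno; exists v; rewrite Em take_size in pv.
  exists v => i.
  rewrite -(cat_take_drop m.+1 w) run_cat run_delta.
  set y := run (drop _ _) _.
  have Hy : in_simplex y by apply: run_simplex; apply: delta_simp.
  have [y0 y1] := Hy.
  rewrite -[del]mul1r -y1 mulr_suml; apply: ler_sum => l _; rewrite ler_wpM2l //.
  have Et : take m.+1 w = rcons (take m w) (nth false w m) by rewrite (take_nth false).
  have Hns : ~ source (take m.+1 w) l.
    move=> [u [su pu _]]; have /Hmax : P m.+1 by apply/asboolP; exists u.
    by rewrite ltnn.
  move: Hns pv; rewrite Et; case: (take m w) => [|b w'] Hns pv.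
    by apply: (@run_nonpersist del Hdel [::]).
  by apply: (@run_nonpersist del Hdel (rcons w' _)) => //; rewrite belast_rcons.
have Hpow m w : (m * L <= size w)%N -> forall x y, in_simplex x -> in_simplex y ->
    dist1 (run w x) (run w y) <= (1 - del) ^+ m * 2.
  elim: m w => [|m IH] w Hw x y Hx Hy.
    rewrite expr0 mul1r; apply: dist1_simplex; exact: run_simplex.
  rewrite -(cat_take_drop L w) !run_cat.
  have HL' : (L <= size w)%N by apply: leq_trans Hw; rewrite mulSn leq_addr.
  have [v Hv] : exists v, forall i, del <= run (take L w) (unit_pt i) v.
    by apply: Hrow; rewrite size_take_min (minn_idPl HL').
  apply: le_trans (run_contract (ltW d0) Hv _ _) _; [exact: run_simplex..|].
  rewrite exprS -mulrA ler_wpM2l ?subr_ge0 //; apply: IH => //.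
  by rewrite size_drop leq_subRL // -mulSn.
have [|m Hm] := @expr_small (1 - del) (e / 2) _ (divr_gt0 e0 (ltr0n _ 2)); first by lra.
exists (m * L)%N => w Hw x y Hx Hy; apply: le_lt_trans (Hpow m w Hw x y Hx Hy) _.
by rewrite -ltr_pdivlMr.
Qed.

End Step.
End Contraction.

(** * Words and normal forms in the modular group *)

Lemma mx2E (A : 'M[int]_2) : A = mx2 (A 0 0) (A 0 1) (A 1 0) (A 1 1).
Proof.
by apply/matrixP => i j; rewrite mxE; case: i j => -[|[|//]] pi [] -[|[|//]] pj /=;
  congr (A _ _); apply: val_inj.
Qed.

Lemma mx2_entries (a b c d : int) :
  let A := mx2 a b c d in [/\ A 0 0 = a, A 0 1 = b, A 1 0 = c & A 1 1 = d].
Proof. by split; rewrite mxE. Qed.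

Lemma mx2_inj (a b c d a' b' c' d' : int) : mx2 a b c d = mx2 a' b' c' d' ->
  [/\ a = a', b = b', c = c' & d = d'].
Proof.
move=> E; have [Ea Eb Ec Ed] := mx2_entries a b c d.
have [Ea' Eb' Ec' Ed'] := mx2_entries a' b' c' d'.
by split; [rewrite -Ea E|rewrite -Eb E|rewrite -Ec E|rewrite -Ed E].
Qed.

Lemma mx2_mul (a b c d a' b' c' d' : int) : mx2 a b c d *m mx2 a' b' c' d' =
  mx2 (a * a' + b * c') (a * b' + b * d') (c * a' + d * c') (c * b' + d * d').
Proof.
rewrite [LHS]mx2E; congr mx2; rewrite !mxE !big_ord_recl big_ord0 !mxE /= addr0 //.
Qed.

Lemma mx2_opp (a b c d : int) : - mx2 a b c d = mx2 (- a) (- b) (- c) (- d).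
Proof. by rewrite [LHS]mx2E; congr mx2; rewrite !mxE. Qed.

Lemma mx2_1 : 1%:M = mx2 1 0 0 1.
Proof. by rewrite [LHS]mx2E; congr mx2; rewrite !mxE. Qed.

Lemma mx2_det (a b c d : int) : \det (mx2 a b c d) = a * d - b * c.
Proof.
rewrite (expand_det_row _ ord0) !big_ord_recl big_ord0 /cofactor !det_mx11 !mxE /=.
by rewrite /bump /= expr0 expr1; ring.
Qed.

Lemma psl_refl A : psl_eq A A. Proof. by left. Qed.
Lemma psl_sym A B : psl_eq A B -> psl_eq B A.
Proof. by case=> ->; [left|right; rewrite opprK]. Qed.
Lemma psl_trans A B C : psl_eq A B -> psl_eq B C -> psl_eq A C.
Proof. by case=> -> [] ->; rewrite ?opprK; [left|right|right|left]. Qed.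
Lemma psl_mul A B A' B' : psl_eq A A' -> psl_eq B B' -> psl_eq (A *m B) (A' *m B').
Proof.
by case=> -> [] ->; rewrite ?mulNmx ?mulmxN ?opprK; [left|right|right|left].
Qed.
Lemma psl_neg A : psl_eq (- A) A. Proof. by right. Qed.

Lemma isSL_mul A B : isSL A -> isSL B -> isSL (A *m B).
Proof. by rewrite /isSL det_mulmx => -> ->. Qed.
Lemma isSL_S : isSL genS. Proof. by rewrite /isSL mx2_det. Qed.
Lemma isSL_U : isSL genU. Proof. by rewrite /isSL mx2_det. Qed.
Lemma isSL_1 : isSL 1%:M. Proof. by rewrite /isSL det1. Qed.
Lemma isSL_opp A : isSL A -> isSL (- A).
Proof. by rewrite (mx2E A) /isSL mx2_opp !mx2_det mulrNN mulrNN. Qed.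
(* Words in the generators: [true] stands for [genS], [false] for [genU]. *)
Definition letter (a : bool) : 'M[int]_2 := if a then genS else genU.
Definition evalm (l : seq bool) : 'M[int]_2 := foldr (fun a M => letter a *m M) 1%:M l.

(* Bit [true] codes S U, bit [false] codes S U U. *)
Definition code1 (b : bool) : seq bool := if b then [:: true; false] else [:: true; false; false].
Definition code (w : seq bool) : seq bool := flatten (map code1 w).
(** The normal form of the free product of the groups of order 3 and 2 generated by U and S: a power
    of U, blocks S U or S U U, and possibly a final S. *)
Definition nfword (a : nat) (w : seq bool) (e : bool) : seq bool :=
  nseq a false ++ code w ++ nseq e true.
Definition invw (l : seq bool) : seq bool :=
  flatten (map (fun a : bool => if a then [:: true] else [:: false; false]) (rev l)).

Lemma evalm_cat l l' : evalm (l ++ l') = evalm l *m evalm l'.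
Proof. by elim: l => [|a l IH] /=; rewrite ?mul1mx // IH mulmxA. Qed.

Lemma evalm_SL l : isSL (evalm l).
Proof.
elim: l => [|a l IH]; first exact: isSL_1.
by apply: isSL_mul => //; case: a; [apply: isSL_S|apply: isSL_U].
Qed.

Lemma genS2 : genS *m genS = - 1%:M.
Proof. by rewrite mx2_1 mx2_mul mx2_opp. Qed.
Lemma genU3 : genU *m (genU *m genU) = - 1%:M.
Proof. by rewrite mx2_1 !mx2_mul mx2_opp. Qed.

Lemma code_cons b w : code (b :: w) = code1 b ++ code w. Proof. by []. Qed.
Lemma code_cat w w' : code (w ++ w') = code w ++ code w'.
Proof. by rewrite /code map_cat flatten_cat. Qed.

Lemma invw_cons a l : invw (a :: l) = invw l ++ (if a then [:: true] else [:: false; false]).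
Proof. by rewrite /invw rev_cons map_rcons -cats1 flatten_cat /= cats0. Qed.

Lemma evalm_invw l : psl_eq (evalm (invw l) *m evalm l) 1%:M.
Proof.
elim: l => [|a l IH] /=; first by rewrite mulmx1; left.
rewrite invw_cons evalm_cat -mulmxA.
apply: psl_trans IH; apply: psl_mul; first exact: psl_refl.
right; rewrite mulmxA; case: a => /=; rewrite mulmx1 ?genS2 ?mulNmx ?mul1mx //.
by rewrite -(mulmxA genU genU genU) genU3 mulNmx mul1mx.
Qed.

(** Up to sign the two blocks are the elementary upper and lower unipotent matrices, so the entries
    of a product stay non-negative and their sum grows with each letter. *)
Lemma code_nonneg w : exists a b c d : nat,
  [/\ psl_eq (evalm (code w)) (mx2 a b c d), (a * d = 1 + b * c)%N &
      (2 + size w <= a + b + c + d)%N].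
Proof.
elim: w => [|x w [a [b [c [d [H1 H2 H3]]]]]].
  by exists 1%N, 0%N, 0%N, 1%N; split=> //; left; rewrite /= mx2_1.
have E : psl_eq (evalm (code1 x)) (if x then mx2 1 1 0 1 else mx2 1 0 1 1).
  right; case: x => /=; rewrite mulmx1 ?mx2_mul mx2_opp //.
have E2 : psl_eq (evalm (code (x :: w)))
    ((if x then mx2 1 1 0 1 else mx2 1 0 1 1) *m mx2 a b c d).
  by rewrite code_cons evalm_cat; apply: psl_mul.
case: x {E} E2; rewrite mx2_mul => E2.
  exists (a + c)%N, (b + d)%N, c, d; split=> /=; [|lia|].
    by apply: psl_trans E2 _; left; congr mx2; rewrite ?mul1r ?mul0r ?add0r.
  have : (0 < c + d)%N by rewrite lt0n; apply/negP => /eqP cd; nia.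
  lia.
exists a, b, (a + c)%N, (b + d)%N; split=> /=; [|lia|].
  by apply: psl_trans E2 _; left; congr mx2; rewrite ?mul1r ?mul0r ?addr0.
have : (0 < a + b)%N by rewrite lt0n; apply/negP => /eqP ab; nia.
lia.
Qed.

Lemma nfword_trivial a w e : (a < 3)%N -> psl_eq (evalm (nfword a w e)) 1%:M ->
  [/\ a = 0%N, w = [::] & e = false].
Proof.
move=> a3 H; have [p [q [r [t [Hw Hdet Hsz]]]]] := code_nonneg w.
have H' : psl_eq (evalm (nseq a false) *m (mx2 p q r t *m evalm (nseq e true))) 1%:M.
  apply: psl_trans H; rewrite /nfword !evalm_cat; apply: psl_mul; first exact: psl_refl.
  by apply: psl_mul; [apply: psl_sym|apply: psl_refl].
have E1 : evalm [::] = mx2 1 0 0 1 by rewrite /= mx2_1.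
case: a a3 H' {H} => [|[|[|//]]] _; case: e => /=; rewrite ?mulmx1 ?mul1mx /genS /genU ?mx2_mul mx2_1;
  case; rewrite ?mx2_opp => /mx2_inj [k1 k2 k3 k4]; try (exfalso; lia).
  by split=> //; case: w Hsz {Hw} => //= *; exfalso; lia.
Qed.

Section Action.
Variables (T : Type) (D : T -> Prop) (fS fU : T -> T).
Hypotheses (DS : forall p, D p -> D (fS p)) (DU : forall p, D p -> D (fU p)).
Hypotheses (S2 : forall p, D p -> fS (fS p) = p) (U3 : forall p, D p -> fU (fU (fU p)) = p).

Definition act (l : seq bool) (p : T) : T := foldr (fun a q => (if a then fS else fU) q) p l.

Lemma act_cat l l' p : act (l ++ l') p = act l (act l' p).
Proof. exact: foldr_cat. Qed.

Lemma act_D l p : D p -> D (act l p).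
Proof. by move=> Dp; elim: l => //= -[] l IH; [apply: DS|apply: DU]. Qed.

Lemma act_invw l p : D p -> act (invw l) (act l p) = p.
Proof.
move=> Dp; elim: l => // a l IH; rewrite invw_cons act_cat /=.
have Dl := act_D l Dp.
by case: a => /=; rewrite ?S2 ?U3.
Qed.

(** A letter on the left either lengthens the normal form or cancels through S S = 1 or U U U = 1;
    both the matrix up to sign and the action respect these cancellations. *)
Lemma act_nfword l : exists a w e, [/\ (a < 3)%N,
  psl_eq (evalm l) (evalm (nfword a w e)) & forall p, D p -> act l p = act (nfword a w e) p].
Proof.
elim: l => [|x l [a [w [e [a3 El Al]]]]].
  by exists 0%N, [::], false; split=> //; left.
case: x => /=; last first.
  have [a2|a2] := ltnP a.+1 3.
    exists a.+1, w, e; split=> // [|p Dp]; last by rewrite Al.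
    by rewrite -[nfword _ _ _]/(false :: nfword a w e) /=; apply: psl_mul => //; apply: psl_refl.
  have Ea : a = 2%N by lia.
  exists 0%N, w, e; split=> // [|p Dp].
    apply: psl_trans (psl_mul (psl_refl _) El) _; right.
    by rewrite Ea /= !mulmxA -(mulmxA genU genU genU) genU3 mulNmx mul1mx.
  rewrite Al // Ea /= U3 //; exact: act_D.
case: a a3 El Al => [|a] a3 El Al.
  case: w El Al => [|b w] El Al.
    exists 0%N, [::], (~~ e); split=> // [|p Dp].
      apply: psl_trans (psl_mul (psl_refl _) El) _.
      by case: (e); rewrite /= ?mulmx1; [right; exact: genS2|left].
    by rewrite Al //; case: (e) => //=; rewrite S2.
  exists (if b then 1 else 2)%N, w, e; split=> // [|| p Dp]; first by case: (b).
    apply: psl_trans (psl_mul (psl_refl _) El) _; right.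
    rewrite /nfword /= code_cons; case: (b) => /=;
    by rewrite mulmxA genS2 mulNmx mul1mx.
  rewrite Al // /nfword /= code_cons; case: (b) => /=; rewrite S2 //;
    by repeat apply: DU; apply: act_D.
exists 0%N, ((a == 0%N) :: w), e.
have E : nfword 0 ((a == 0%N) :: w) e = true :: nfword a.+1 w e.
  by case: a a3 {El Al} => [|[|//]].
rewrite E; split=> // [|p Dp]; last by rewrite /= Al.
by apply: psl_mul => //; apply: psl_refl.
Qed.

(** The presentation of the modular group by S S = U U U = 1: the word l'^-1 l has matrix 1 up to
    sign, so its normal form is empty and it acts trivially. *)
Lemma act_presentation l l' p : psl_eq (evalm l) (evalm l') -> D p -> act l p = act l' p.
Proof.
move=> El Dp; have [a [w [e [a3 Em Am]]]] := act_nfword (invw l' ++ l).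
have : psl_eq (evalm (nfword a w e)) 1%:M.
  apply: psl_trans (psl_sym Em) _; rewrite evalm_cat.
  by apply: psl_trans (evalm_invw l'); apply: psl_mul => //; apply: psl_refl.
move=> /(nfword_trivial a3) [Ea Ew Ee]; subst a w e.
have := Am p Dp; rewrite act_cat /= => H.
have Dl := act_D l Dp.
have [l2 Hl2] : exists l2, forall q, D q -> act l2 (act (invw l') q) = q.
  by exists (invw (invw l')) => q Dq; apply: act_invw.
have K q : D q -> act l' (act (invw l') q) = q.
  move=> Dq; have Dq' := act_D (invw l') Dq.
  have E := act_invw l' Dq'.
  by rewrite -[RHS]Hl2 // -[in RHS]E Hl2 //; apply: act_D.
by rewrite -[RHS](congr1 (act l') H) K.
Qed.

End Action.

Lemma evalm_T (k : int) : exists l, psl_eq (mx2 1 k 0 1) (evalm l).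
Proof.
have Hnat (m : nat) : exists l, psl_eq (mx2 1 m%:Z 0 1) (evalm l).
  elim: m => [|m [l Hl]]; first by exists [::]; left; rewrite /= mx2_1.
  exists ([:: true; false] ++ l); rewrite evalm_cat.
  apply: psl_trans (psl_mul (_ : psl_eq (mx2 1 1 0 1) _) Hl).
    by left; rewrite mx2_mul; congr mx2; lia.
  by right; rewrite /= mulmx1 mx2_mul mx2_opp.
have [m [->|->]] : exists m : nat, k = m%:Z \/ k = - m%:Z.
  by exists `|k|%N; lia.
  exact: Hnat.
have [l Hl] := Hnat m; exists (invw l).
have H1 := evalm_invw l.
have E : mx2 1 m 0 1 *m mx2 1 (- m%:Z) 0 1 = 1%:M by rewrite mx2_mul mx2_1; congr mx2; lia.
have := psl_mul H1 (psl_refl (mx2 1 (- m%:Z) 0 1)); rewrite mul1mx -mulmxA => H2.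
apply: psl_trans (psl_sym H2) _; rewrite -[X in psl_eq _ X]mulmx1 -E.
by apply: psl_mul; [left|apply: psl_mul; [apply: psl_sym|left]].
Qed.

(** Euclid's algorithm on the first column: a translation followed by S makes the lower left entry
    smaller in absolute value. *)
Lemma evalm_surj (A : 'M[int]_2) : isSL A -> exists l, psl_eq A (evalm l).
Proof.
rewrite (mx2E A); move: (A 0 0) (A 0 1) (A 1 0) (A 1 1) => a b c d.
have [m] := ubnP `|c|%N; elim: m a b c d => // m IH a b c d Hc.
rewrite /isSL mx2_det => Hdet.
have [c0|c0] := eqVneq c 0.
  have [[Ea Ed]|[Ea Ed]] : (a = 1 /\ d = 1) \/ (a = -1 /\ d = -1).
    have Had : a * d = 1 by move: Hdet; rewrite c0; lia.
    have /eqP : (`|a| * `|d| = 1)%N by rewrite -abszM Had.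
    by rewrite muln_eq1 => /andP[/eqP Ha /eqP Hd]; nia.
    by have [l Hl] := evalm_T b; exists l; rewrite Ea Ed c0.
  have [l Hl] := evalm_T (- b); exists l; apply: psl_trans Hl; right.
  by rewrite mx2_opp Ea Ed c0; congr mx2; lia.
pose q := (a %/ c)%Z.
have [||l Hl] := IH (- c) (- d) (a - q * c) (b - q * d).
- have : `|a - q * c| < `|c|.
    have -> : a - q * c = (a %% c)%Z by rewrite {1}(divz_eq a c) /q; lia.
    by rewrite ger0_norm ?modz_ge0 // ltz_mod.
  lia.
- by rewrite /isSL mx2_det; lia.
have [l' Hl'] := evalm_T q.
exists (l' ++ true :: l); rewrite evalm_cat /=.
have E : mx2 a b c d = - (mx2 1 q 0 1 *m (genS *m mx2 (- c) (- d) (a - q * c) (b - q * d))).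
  by rewrite !mx2_mul mx2_opp; congr mx2; ring.
rewrite E; apply: psl_trans (psl_neg _) _.
by apply: psl_mul => //; apply: psl_mul => //; apply: psl_refl.
Qed.

(** * Infinite binary sequences and König's lemma *)

Definition shift (c : nat -> bool) (k i : nat) : bool := c (k + i)%N.

Lemma mkseqD (c : nat -> bool) i j : mkseq c (i + j) = mkseq c i ++ mkseq (shift c i) j.
Proof.
rewrite /mkseq iotaD map_cat; congr (_ ++ _); rewrite add0n /shift.
by rewrite -[i in iota i]addn0 iotaDl -map_comp.
Qed.

Lemma mkseq_rcons (c : nat -> bool) i : mkseq c i.+1 = rcons (mkseq c i) (c i).
Proof. exact: mkseqS. Qed.

Lemma dependent_path (P : seq bool -> Prop) : P [::] ->
  (forall w, P w -> exists b, P (rcons w b)) -> exists c, forall i, P (mkseq c i).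
Proof.
move=> P0 PS; pose nxt w := `[< P (rcons w true) >].
pose W := fix W i := if i is i'.+1 then rcons (W i') (nxt (W i')) else [::].
have EW i : mkseq (fun k => nxt (W k)) i = W i.
  by elim: i => // i IH; rewrite mkseq_rcons IH.
exists (fun k => nxt (W k)) => i; rewrite EW; elim: i => //= i /PS [b Hb].
by rewrite /nxt; case: asboolP => // Hn; case: b Hb.
Qed.

(** The path is followed through the words that have extensions in [P] of every length; this
    property passes to one of the two successors. *)
Lemma konig (P : seq bool -> Prop) : (forall w b, P (rcons w b) -> P w) ->
  (forall m, exists2 w, size w = m & P w) -> exists c, forall i, P (mkseq c i).
Proof.
move=> Pr Pm; pose inf w := forall m, exists2 w', size w' = m & P (w ++ w').
have Pcat w w' : P (w ++ w') -> P w.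
  elim/last_ind: w' => [|w' b IH]; first by rewrite cats0.
  by rewrite -rcons_cat => /Pr /IH.
have [||c Hc] := dependent_path (P := inf).
- by move=> m; apply: Pm.
- move=> w Hw; apply: contrapT => Hn.
  have Hb b : exists m, forall w', size w' = m -> ~ P (rcons w b ++ w').
    apply: contrapT => Hb; apply: Hn; exists b => m; apply: contrapT => Hm.
    by apply: Hb; exists m => w' Ew' Pw'; apply: Hm; exists w'.
  have [[m1 H1] [m2 H2]] := (Hb true, Hb false).
  have [w' Ew' Pw'] := Hw (maxn m1 m2).+1.
  case: w' Ew' Pw' => // b w' /= [Ew'] Pw'.
  have Pw'' k : (k <= size w')%N -> P (rcons w b ++ take k w').
    move=> Hk; apply: (@Pcat _ (drop k w')).
    by rewrite -catA cat_take_drop cat_rcons.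
  case: b Pw' Pw'' => Pw' Pw''.
    apply: (H1 (take m1 w')); first by rewrite size_takel // Ew' leq_maxl.
    by apply: Pw''; rewrite Ew' leq_maxl.
  apply: (H2 (take m2 w')); first by rewrite size_takel // Ew' leq_maxr.
  by apply: Pw''; rewrite Ew' leq_maxr.
- by exists c => i; have [w' /size0nil ->] := Hc i 0%N; rewrite cats0.
Qed.

(** * Limit points of infinite paths *)

Section LimitPoints.
Variables (R : realType) (n : nat) (G : gluing n).
Local Notation J := 'I_n.+1.
Local Notation pt := (J -> R).
Local Notation tau := (tau G).
Local Notation inX := (inX G).
Local Notation flip := (flip G).
Local Notation sgi := (sgi G).
Local Notation delta := (@unit_pt R n).
Variable s : pt.
Hypothesis ws : weights G s.
Hypothesis sep : separated G.
Hypothesis cusp : exists v, s v = 0.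
Local Notation run := (run G s).
Local Notation step := (step G s).

(** The images of the simplex under longer and longer prefixes are nested; a coordinate of their
    common point is the supremum of the lower bounds of that coordinate on these images. *)
Definition xi (c : nat -> bool) : pt := fun j =>
  sup [set r | exists i, forall y, in_simplex y -> r <= run (mkseq c i) y j].

Let p0 : in_simplex (delta ord0). Proof. exact: delta_simp. Qed.

Lemma xi_close c i e : (forall x y, in_simplex x -> in_simplex y ->
    dist1 (run (mkseq c i) x) (run (mkseq c i) y) <= e) ->
  forall y j, in_simplex y -> `|xi c j - run (mkseq c i) y j| <= e.
Proof.
move=> He y j Hy.
pose E : set R := fun r => exists i, forall y, in_simplex y -> r <= run (mkseq c i) y j.
rewrite -[xi c j]/(sup E).
have Hub : ubound E (run (mkseq c i) y j + e).
  move=> r [k' Hr].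
  have Hz : in_simplex (run (mkseq (shift c i) k') y) by apply: run_simplex.
  have Hz' : in_simplex (run (mkseq (shift c k') i) y) by apply: run_simplex.
  have := Hr _ Hz'; rewrite -run_cat -mkseqD addnC mkseqD run_cat => Hle.
  have := He _ _ Hz Hy; have := coord_dist1 (run (mkseq c i) (run (mkseq (shift c i) k') y)) (run (mkseq c i) y) j.
  by move=> /le_trans H /H; rewrite ler_norml; lra.
have E1 : E (run (mkseq c i) y j - e).
  exists i => z Hz; have := He _ _ Hz Hy.
  have := coord_dist1 (run (mkseq c i) z) (run (mkseq c i) y) j.
  by move=> /le_trans H /H; rewrite ler_norml; lra.
have H1 : sup E <= run (mkseq c i) y j + e.
  by apply: ge_sup => //; exists (run (mkseq c i) y j - e).
have H2 : run (mkseq c i) y j - e <= sup E.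
  by apply: ub_le_sup => //; exists (run (mkseq c i) y j + e).
by rewrite ler_norml; lra.
Qed.

Lemma xi_cvg e : 0 < e -> exists D, forall c i, (D <= i)%N -> forall y, in_simplex y ->
  dist1 (xi c) (run (mkseq c i) y) < e.
Proof.
move=> e0; have N0 : 0 < n.+1%:R :> R by rewrite ltr0n.
have [D HD] := run_shrink ws sep cusp (divr_gt0 e0 (mulr_gt0 (ltr0n R 2) N0)).
exists D => c i Di y Hy.
have Hclose : forall y j, in_simplex y ->
    `|xi c j - run (mkseq c i) y j| <= e / (2 * n.+1%:R).
  by apply: xi_close => x z Hx Hz; apply/ltW/HD => //; rewrite size_mkseq.
apply: (@le_lt_trans _ _ (\sum_(j < n.+1) e / (2 * n.+1%:R))).
  by apply: ler_sum => j _; apply: Hclose.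
rewrite sumr_const card_ord -[X in X < _]mulr_natr.
have -> : e / (2 * n.+1%:R) * n.+1%:R = e / 2.
  by rewrite invfM mulrA mulfVK // gt_eqF.
by lra.
Qed.

Lemma dist1_eq0 (x y : pt) : (forall e, 0 < e -> dist1 x y < e) -> x = y.
Proof.
move=> H; apply/funext => j; apply/eqP; rewrite -subr_eq0 -normr_eq0.
rewrite eq_le normr_ge0 andbT leNgt; apply/negP => /H.
by rewrite ltNge coord_dist1.
Qed.

Lemma xi_simplex c : in_simplex (xi c).
Proof.
split=> [j|].
  rewrite leNgt; apply/negP => Hneg.
  have Hn : 0 < - xi c j by lra.
  have [D HD] := xi_cvg Hn.
  have := HD c D (leqnn _) _ p0; apply/negP; rewrite -leNgt.
  apply: le_trans (coord_dist1 _ _ j).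
  have [r0 _] := @run_simplex R n G s ws (mkseq c D) _ p0.
  by rewrite ler0_norm; have := r0 j; lra.
apply/eqP; rewrite -subr_eq0 -normr_eq0 eq_le normr_ge0 andbT leNgt; apply/negP => Hpos.
have [D HD] := xi_cvg Hpos; have := HD c D (leqnn _) _ p0; apply/negP; rewrite -leNgt.
have [_ r1] := @run_simplex R n G s ws (mkseq c D) _ p0.
by rewrite -[X in _ - X]r1 -sumrB; apply: ler_norm_sum.
Qed.

Lemma xi_run c i : xi c = run (mkseq c i) (xi (shift c i)).
Proof.
apply: dist1_eq0 => e e0; have e2 : 0 < e / 2 by lra.
have [D HD] := xi_cvg e2.
apply: le_lt_trans (dist1_triangle (run (mkseq c (i + D)) (delta ord0)) _ _) _.
have H1 := HD c (i + D)%N (leq_addl _ _) _ p0.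
have H2 := HD (shift c i) D (leqnn _) _ p0.
rewrite {2}mkseqD run_cat dist1C [X in _ + X]dist1C.
have := run_dist_le ws (mkseq c i) (xi_simplex (shift c i))
   (run_simplex ws (mkseq (shift c i) D) p0).
by rewrite [dist1 (run (mkseq c (i + D)) _) _]dist1C; lra.
Qed.

Lemma xi_step c : xi c = step (c 0%N) (xi (shift c 1)).
Proof. by rewrite [LHS](xi_run c 1). Qed.

Lemma xi_unique c x : (forall i, exists2 y, in_simplex y & x = run (mkseq c i) y) -> x = xi c.
Proof.
move=> Hx; apply: dist1_eq0 => e e0; have [D HD] := xi_cvg e0.
by have [y Hy ->] := Hx D; rewrite dist1C; apply: HD.
Qed.

Lemma xi_vertex c v : s v = 0 -> (forall i, c i = inX (iter i.+1 sgi v)) -> xi c = delta v.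
Proof.
move=> sv Hc; apply/esym/xi_unique => i; exists (delta (iter i sgi v)).
  exact: delta_simp.
have pv : persists G v (mkseq c i).
  by apply/persistsP => k; rewrite size_mkseq => Hk; rewrite nth_mkseq.
by have := run_persist ws sv pv; rewrite size_mkseq.
Qed.

(** Once the image of a vertex has left the vertices it is positive everywhere, and it stays so: at
    each letter it has weight at a label of the wrong type, which is spread over all coordinates. *)
Lemma run_pos w i : w != [::] -> ~ source G s w i -> forall j, 0 < run w (delta i) j.
Proof.
have [del /andP[d0 _] Hdel] := mixing ws.
elim: w => // b w IH _ Hs j.
have [Ew|wn] := eqVneq w [::].
  rewrite Ew /=; apply: lt_le_trans d0 _; apply: Hdel => -[Xi si]; apply: Hs.
  by rewrite Ew; exists (sig G i); rewrite /= sigK Xi eqxx -(s_sgi ws) sigK.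
have [[u [su pu Ei]]|Hs'] := pselect (source G s w i).
  rewrite [run _ _]/= Ei run_persist //; apply: lt_le_trans d0 _; apply: Hdel => -[Xu _].
  apply: Hs; exists (sig G u); split=> [||].
  - by rewrite -(s_sgi ws) sigK.
  - by rewrite /= sigK Xu eqxx.
  - by rewrite Ei [size (b :: _)]/= iterSr sigK.
have Hy := IH wn Hs'; rewrite [run _ _]/= step_delta.
pose l := if b then tau (Xpoint G) else Xpoint G.
rewrite (bigD1 l) //=; apply: ltr_pwDl.
  apply: mulr_gt0 => //; apply: lt_le_trans d0 _; apply: Hdel; rewrite /l => -[+ _].
  by case: (b); rewrite ?inX_tau inX_Xpoint.
apply: sumr_ge0 => m _; apply: mulr_ge0; first exact: ltW.
by have [] := step_simplex ws b (delta_simp R m).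
Qed.

Lemma delta_inj (v v' : J) : delta v = delta v' -> v = v'.
Proof.
move=> /(congr1 (fun f => f v)); rewrite /unit_pt eqxx; case: eqP => // _ /eqP.
by rewrite oner_eq0.
Qed.

(** If a coordinate of the limit point vanishes, then by [run_pos] the tail of the path is supported
    on sources of the prefix. By separation there is only one, so the tail is a vertex and so is the
    limit. Arbitrarily long prefixes give the whole itinerary. *)
Lemma xi_bdry c : on_bdry (xi c) ->
  exists v, [/\ s v = 0, xi c = delta v & forall i, c i = inX (iter i.+1 sgi v)].
Proof.
move=> [l Hl]; have [L L0 HL] := separated_bound sep.
have key M : (L <= M)%N -> exists v, [/\ s v = 0, xi c = delta v & persists G v (mkseq c M)].
  move=> HM; set w := mkseq c M; set y := xi (shift c M).
  have Exi : xi c = run w y by apply: xi_run.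
  have [y0 y1] : in_simplex y by apply: xi_simplex.
  have wn : w != [::] by rewrite -size_eq0 size_mkseq -lt0n (leq_trans L0).
  have Hw : (L <= size w)%N by rewrite size_mkseq.
  have Hsup i : y i != 0 -> source G s w i.
    move=> yi; apply: contrapT => /(run_pos wn) /(_ l) Hp.
    have : 0 < xi c l; last by rewrite Hl ltxx.
    rewrite Exi run_delta (bigD1 i) //=; apply: ltr_pwDl.
      by rewrite mulr_gt0 // lt0r yi y0.
    apply: sumr_ge0 => m _; rewrite mulr_ge0 //.
    by have [] := run_simplex ws w (delta_simp R m).
  have [i yi] : exists i, y i != 0.
    apply: contrapT => Hn; have /eqP : (1 : R) = 0; last by rewrite oner_eq0.
    rewrite -y1 big1 // => i _; apply/eqP/negPn/negP => yi; apply: Hn; by exists i.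
  have [v [sv pv Ei]] := Hsup i yi; exists v; split=> //.
  have Ey : y = delta i.
    have y0' k : k != i -> y k = 0.
      move=> ki; apply/eqP/negPn/negP => /Hsup [v' [_ pv' Ek]]; move/eqP: ki; apply.
      by rewrite Ek Ei (HL w v v').
    apply/funext => k; rewrite /unit_pt; case: (eqVneq k i) => [->|/y0' //].
    by rewrite -y1 (bigD1 i) //= big1 ?addr0 // => k' /y0'.
  by rewrite Exi Ey Ei run_persist.
have [v [sv Ev _]] := key L (leqnn _); exists v; split=> // i.
have [v' [_ Ev' pv']] := key (L + i.+1)%N (leq_addr _ _).
have Evv : v' = v by apply: delta_inj; rewrite -Ev' Ev.
move/persistsP: pv' => /(_ i); rewrite size_mkseq Evv nth_mkseq; last by lia.
by apply; lia.
Qed.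

End LimitPoints.

(** * The action on the sphere and its limit set *)

Section SphereAction.
Variables (R : realType) (n : nat) (G : gluing n).
Local Notation J := 'I_n.+1.
Local Notation pt := (J -> R).
Local Notation tau := (tau G).
Local Notation inX := (inX G).
Local Notation flip := (flip G).
Variable s : pt.
Hypothesis ws : weights G s.
Local Notation run := (run G s).
Local Notation step := (step G s).
Local Notation xi := (xi G s).
Local Notation rS := (@rhoS R n G).
Local Notation rU := (rhoU G s).
Local Notation gact := (act rS rU).

Lemma gact_Sn l p : Sn p -> Sn (gact l p).
Proof. by apply: act_D => q; [apply: rhoS_Sn|apply: rhoU_Sn]. Qed.

Lemma gact_invw l p : Sn p -> gact (invw l) (gact l p) = p.
Proof.
apply: (act_invw (D := @Sn R n)) => q; [exact: rhoS_Sn|exact: rhoU_Sn|exact: rhoS2|exact: rhoU3].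
Qed.

Lemma gact_presentation l l' p : psl_eq (evalm l) (evalm l') -> Sn p -> gact l p = gact l' p.
Proof.
apply: (act_presentation (D := @Sn R n)) => q; [exact: rhoS_Sn|exact: rhoU_Sn|exact: rhoS2|exact: rhoU3].
Qed.

Lemma gact_invwr l p : Sn p -> gact l (gact (invw l) p) = p.
Proof.
move=> Sp; have Sq := gact_Sn (invw l) Sp; rewrite -[in RHS](gact_invw (invw l) Sp).
apply: gact_presentation Sq.
have H1 := evalm_invw l; have H2 := evalm_invw (invw l).
have := psl_mul H2 (psl_refl (evalm l)); rewrite mul1mx -mulmxA => H3.
apply: psl_trans (psl_sym H3) _; rewrite -[X in psl_eq _ X]mulmx1.
exact: psl_mul (psl_refl _) H1.
Qed.

Lemma PA_gact l : PA (gact l).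
Proof.
elim: l => [|a l IH]; first exact: PA_id.
apply: (PA_comp (h1 := gact l) (h2 := if a then rS else rU)) => //.
  exact: gact_Sn.
by case: (a); [apply: PA_rhoS|apply: PA_rhoU].
Qed.

Lemma gact_contS l : contS (gact l).
Proof. by apply: PA_contS (PA_gact l); apply: gact_Sn. Qed.

Lemma gact_PLS l : PLS (gact l).
Proof.
apply: PA_PLS (PA_gact l); split; first exact: gact_Sn.
exists (gact (invw l)); split; first exact: gact_Sn.
split; last by split; apply: gact_contS.
by move=> p Sp; rewrite gact_invw // gact_invwr.
Qed.

(** The second copy is parametrised through S, so that both copies carry the same maps [run w] and S
    merely exchanges the value of [o]. *)
Definition place (o : bool) (y : pt) : spt R n :=
  if o then rS (mkpt false y) else mkpt false y.

Lemma place_true y : place true y = mkpt true (fun j => y (flip j)).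
Proof. by rewrite /place rhoS_mkpt. Qed.

Lemma place_Sn o y : in_simplex y -> Sn (place o y).
Proof. by move=> Hy; case: o => /=; rewrite /place; [apply: rhoS_Sn|]; apply: mkpt_Sn. Qed.

Lemma rhoS_place o y : in_simplex y -> rS (place o y) = place (~~ o) y.
Proof. by move=> Hy; case: o => //=; rewrite /place rhoS2 //; apply: mkpt_Sn. Qed.

Lemma placeP p : Sn p -> exists o, exists2 y, in_simplex y & p = place o y.
Proof.
move=> Sp; have [Hx _] := Sp; have Ep := mkptK Sp; case: (p.1) Ep => Ep.
  exists true, (fun j => p.2 (flip j)); first exact: flip_simplex.
  by rewrite place_true -[LHS]Ep; congr mkpt; apply/funext => j; rewrite flipK.
by exists false, p.2.
Qed.

Lemma dist1_flip (x y : pt) : dist1 (fun j => x (flip j)) (fun j => y (flip j)) = dist1 x y.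
Proof. by rewrite /dist1 [RHS](reindex_inj (inv_inj (flipK G))). Qed.

Lemma sdist_place o y y' e : in_simplex y -> in_simplex y' -> dist1 y y' < e ->
  sdist_lt (place o y) (place o y') e.
Proof.
move=> Hy Hy' H; case: o; last exact: sdist_mkpt.
by rewrite !place_true; apply: sdist_mkpt; rewrite ?dist1_flip //; apply: flip_simplex.
Qed.

Lemma rhoU_place b y : in_simplex y ->
  (if b then rU (mkpt false y) else rU (rU (mkpt false y))) = place true (step b y).
Proof.
move=> Hy; rewrite /place -step_rho // rhoS2 //.
by case: b; repeat apply: rhoU_Sn => //; apply: mkpt_Sn.
Qed.

Lemma gact_code w y : in_simplex y -> gact (code w) (mkpt false y) = mkpt false (run w y).
Proof.
move=> Hy; elim: w => [|b w IH] //; rewrite code_cons act_cat IH.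
have Hw : in_simplex (run w y) by apply: run_simplex.
by rewrite [run (b :: w) y]/= -step_rho //; case: (b).
Qed.

Definition tile (o : bool) (w : seq bool) (p : spt R n) : Prop :=
  exists2 y, in_simplex y & p = place o (run w y).

Lemma tile_cat o w w' p : tile o (w ++ w') p -> tile o w p.
Proof. by move=> [y Hy ->]; exists (run w' y); [apply: run_simplex|rewrite run_cat]. Qed.

Lemma tile_take o m w p : tile o w p -> tile o (take m w) p.
Proof. by rewrite -{1}(cat_take_drop m w) => /tile_cat. Qed.

Lemma tile_rhoS o w p : Sn p -> tile o w (rS p) -> tile (~~ o) w p.
Proof.
move=> Sp [y Hy E]; exists y => //; rewrite -rhoS_place -?E ?rhoS2 //.
exact: run_simplex.
Qed.

Lemma tile0_open p : Sn p -> ~ tile false [::] p ->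
  exists2 d : R, 0 < d & forall q, Sn q -> sdist_lt p q d -> ~ tile false [::] q.
Proof.
move=> Sp Hp; have [Hx Hb] := Sp; have [x0 _] := Hx.
have p1 : p.1 = true.
  by case E: (p.1) => //; case: Hp; exists p.2 => //=; rewrite /place -E mkptK.
have Nb : ~ on_bdry p.2.
  by move=> Bp; apply: Hp; exists p.2 => //=; rewrite /place (mkpt_bdry false p.1 Bp) mkptK.
case: (@arg_minP _ _ _ ord0 xpredT p.2) => // i0 _ Hmin.
have m0 : 0 < p.2 i0.
  by rewrite lt_neqAle x0 andbT eq_sym; apply/eqP => E; apply: Nb; exists i0.
exists (p.2 i0) => // q Sq Hpq [y Hy /= Eq].
have q1 : q.1 = true.
  case E: (q.1) => //; have [|i [Hi _]] := sdist_bdry Hpq; first by rewrite p1 E.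
  by have := le_lt_trans (Hmin i isT) Hi; rewrite ltxx.
have [i Ei] : on_bdry q.2.
  move: q1; rewrite Eq /place /mkpt /=.
  by case: pselect.
have := sdist_coord i Hpq; rewrite Ei subr0 => /ltr_normlP [_ Hi].
by have := le_lt_trans (Hmin i isT) Hi; rewrite ltxx.
Qed.

Lemma preimage_open (g : spt R n -> spt R n) (P : spt R n -> Prop) p : contS g ->
  (forall p, Sn p -> Sn (g p)) -> Sn p ->
  (exists2 d : R, 0 < d & forall q, Sn q -> sdist_lt (g p) q d -> P q) ->
  exists2 d : R, 0 < d & forall q, Sn q -> sdist_lt p q d -> P (g q).
Proof.
move=> cg Sg Sp [e e0 He]; have [d d0 Hd] := cg p Sp e e0.
by exists d => // q Sq Hpq; apply: He; [apply: Sg|apply: Hd].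
Qed.

Lemma tile_false_inv w p : Sn p ->
  tile false w p <-> tile false [::] (gact (invw (code w)) p).
Proof.
move=> Sp; split=> -[y Hy E].
  by exists y => //; rewrite E /place -gact_code // gact_invw //; apply: mkpt_Sn.
by exists y => //; rewrite /place -gact_code // -[RHS]/(gact (code w) (place false (run [::] y))) -E gact_invwr.
Qed.

Lemma tile_open o w p : Sn p -> ~ tile o w p ->
  exists2 d : R, 0 < d & forall q, Sn q -> sdist_lt p q d -> ~ tile o w q.
Proof.
have H p' : Sn p' -> ~ tile false w p' ->
    exists2 d : R, 0 < d & forall q, Sn q -> sdist_lt p' q d -> ~ tile false w q.
  move=> Sp' /(contra_not (proj2 (tile_false_inv w Sp'))) Hn.
  have [|d d0 Hd] := preimage_open (gact_contS (invw (code w))) (@gact_Sn _) Sp' (P := fun q => ~ tile false [::] q).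
    by apply: tile0_open => //; apply: gact_Sn.
  by exists d => // q Sq /(Hd q Sq) Hq /(tile_false_inv w Sq).
move=> Sp Hn; case: o Hn => [Hn|]; last exact: H.
have SS := rhoS_Sn G Sp.
have Hn' : ~ tile false w (rS p) by move=> /(tile_rhoS Sp).
have [|d d0 Hd] := preimage_open (gact_contS [:: true]) (@gact_Sn _) Sp (P := fun q => ~ tile false w q).
  exact: H.
exists d => // q Sq /(Hd q Sq) Hq Ht; apply: Hq; have Sq' := rhoS_Sn G Sq.
by apply: (@tile_rhoS true) => //=; rewrite rhoS2.
Qed.

Lemma sdist_mono (p q : spt R n) d d' : d <= d' -> sdist_lt p q d -> sdist_lt p q d'.
Proof.
move=> Hd [[E H]|[z [H1 [H2 H3]]]]; first by left; split=> //; apply: lt_le_trans Hd.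
by right; exists z; do 2!split=> //; apply: lt_le_trans Hd.
Qed.

Fixpoint words (m : nat) : seq (seq bool) :=
  if m is m'.+1 then [seq b :: w | b <- [:: true; false], w <- words m'] else [:: [::]].

Lemma mem_words w : w \in words (size w).
Proof.
elim: w => //= b w IH; rewrite cats0 mem_cat; apply/orP.
by case: b; [left|right]; apply: map_f.
Qed.

Lemma size_words m w : w \in words m -> size w = m.
Proof.
elim: m w => [|m IH] w /=; first by rewrite inE => /eqP ->.
by rewrite cats0 mem_cat => /orP[] /mapP [w' /IH <- ->].
Qed.

Lemma open_forall (L : seq (bool * seq bool)) p : Sn p ->
  (forall ow, ow \in L -> ~ tile ow.1 ow.2 p) ->
  exists2 d : R, 0 < d & forall q, Sn q -> sdist_lt p q d ->
    forall ow, ow \in L -> ~ tile ow.1 ow.2 q.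
Proof.
move=> Sp; elim: L => [|ow L IH] HL; first by exists 1.
have [|d d0 Hd] := IH; first by move=> ow' H; apply: HL; rewrite inE H orbT.
have [|d' d0' Hd'] := @tile_open ow.1 ow.2 p Sp; first by apply: HL; rewrite inE eqxx.
exists (Num.min d d'); first by rewrite lt_min d0.
move=> q Sq Hpq ow'; rewrite inE => /orP[/eqP ->|H].
  by apply: Hd' => //; apply: sdist_mono Hpq; rewrite ge_min lexx orbT.
by apply: Hd => //; apply: sdist_mono Hpq; rewrite ge_min lexx.
Qed.

Lemma tiles_open D p : Sn p -> (forall o w, size w = D -> ~ tile o w p) ->
  exists2 d : R, 0 < d & forall q, Sn q -> sdist_lt p q d ->
    forall o w, size w = D -> ~ tile o w q.
Proof.
move=> Sp Hp.
have [|d d0 Hd] := @open_forall [seq (o, w) | o <- [:: true; false], w <- words D] p Sp.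
  by move=> [o w] /allpairsP [[o' w'] [_ /size_words Hw [-> ->]]]; apply: Hp.
exists d => // q Sq Hpq o w Hw; apply: (Hd q Sq Hpq (o, w)).
apply/allpairsP; exists (o, w); split=> //; first by case: (o).
by rewrite /= -Hw mem_words.
Qed.

(** Ping-pong: a word either brings the point into the base copy, or the point was already deep in
    the other copy, near where the inverse word contracts. *)
Lemma code_dichotomy w x : Sn x ->
  tile false [::] (gact (code w) x) \/ exists2 w', size w' = size w & tile true w' x.
Proof.
elim/last_ind: w x => [|w c IH] x Sx.
  have [o [y Hy ->]] := placeP Sx; case: o; [right|left; by exists y].
  by exists [::] => //; exists y.
rewrite -cats1 code_cat act_cat; set x' := gact _ x.
have Sx' : Sn x' by apply: gact_Sn.
have [?|[w' Hw' [y Hy Ex']]] := IH x' Sx'; first by left.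
(* The bit is negated because undoing U takes U U, and conversely. *)
right; exists (~~ c :: w'); first by rewrite size_cat /= addn1 Hw'.
exists y => //; have Hr : in_simplex (run w' y) by apply: run_simplex.
have EU : (if c then rU x else rU (rU x)) = mkpt false (run w' y).
  have := congr1 rS Ex'; rewrite rhoS_place // /x' /=.
  by case: (c) => /=; rewrite rhoS2 //; repeat apply: rhoU_Sn => //.
rewrite [run _ _]/= -rhoU_place // -EU; case: (c) => /=; rewrite rhoU3 //.
Qed.

Definition avoids (D : nat) (p : spt R n) : Prop := forall o w, size w = D -> ~ tile o w p.

Lemma avoids_ge D p o w : avoids D p -> (D <= size w)%N -> ~ tile o w p.
Proof. by move=> Hp Hw /(tile_take D); apply: Hp; rewrite size_takel. Qed.

(** If the word has at least 2 D bits, its inner part brings [p] into the base copy, as [p] is in no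
    deep tile; the outer D bits then put the image into a tile of depth D, and a final power of U
    only makes that tile deeper. *)
Lemma nfword_bound D a w e p : (a < 3)%N -> Sn p -> avoids D p ->
  avoids D (gact (nfword a w e) p) -> (size w < D + D)%N.
Proof.
move=> a3 Sp Hp Hq; rewrite ltnNge; apply/negP => Hw.
set w1 := take D w; set w2 := drop D w.
have Hw1 : size w1 = D by rewrite size_takel //; lia.
have Hw2 : (D <= size w2)%N by rewrite size_drop; lia.
move: Hq; rewrite /nfword !act_cat -(cat_take_drop D w) -/w1 -/w2 code_cat act_cat.
set p' := gact (nseq e true) p; have Sp' : Sn p' by apply: gact_Sn.
have [[y Hy Ey]|[w' Hw' Ht]] := code_dichotomy w2 Sp'; last first.
  move=> _; rewrite -Hw' in Hw2; rewrite /p' in Ht; case: (e) Ht => /= Ht.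
    by apply: (avoids_ge Hp Hw2); apply: tile_rhoS Ht.
  exact: (avoids_ge Hp Hw2) Ht.
rewrite Ey /place gact_code //.
have Hr : in_simplex (run [::] y) by [].
case: a a3 => [|[|[|//]]] _ /= Hq.
- by apply: (Hq false w1 Hw1); exists y.
- apply: (avoids_ge (o := true) (w := true :: w1) Hq); first by rewrite /= Hw1 leqnSn.
  exists y => //; rewrite [LHS](rhoU_place true) //; exact: run_simplex.
- apply: (avoids_ge (o := true) (w := false :: w1) Hq); first by rewrite /= Hw1 leqnSn.
  exists y => //; rewrite [LHS](rhoU_place false) //; exact: run_simplex.
Qed.

Section Limit.
Hypothesis sep : separated G.
Hypothesis cusp : exists v, s v = 0.

Definition Lam : set (spt R n) := [set p | exists o c, p = place o (xi c)].

Lemma xiS c : in_simplex (xi c). Proof. exact: xi_simplex. Qed.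

Lemma Lam_Sn p : Lam p -> Sn p.
Proof. by move=> [o [c ->]]; apply: place_Sn; apply: xiS. Qed.

Definition pcons (b : bool) (c : nat -> bool) : nat -> bool :=
  fun i => if i is i'.+1 then c i' else b.

Lemma xi_pcons b c : xi (pcons b c) = step b (xi c).
Proof. by rewrite [LHS]xi_step. Qed.

(** U prepends the bit [true] to a path in the base copy. In the other copy it turns a first bit
    [true] into [false], and cancels a first bit [false] by returning to the base copy. *)
Lemma Lam_gact l p : Lam p -> Lam (gact l p).
Proof.
move=> Lp; elim: l => // a l [o [c E]]; rewrite -[gact (a :: l) p]/((if a then rS else rU) (gact l p)) E.
case: a; first by exists (~~ o), c; rewrite rhoS_place //; apply: xiS.
case: o {E}; last first.
  exists true, (pcons true c); rewrite xi_pcons [place false _]/place.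
  by rewrite -(rhoU_place true (xiS c)).
rewrite xi_step //; set c' := shift c 1; rewrite -rhoU_place; last exact: xiS.
case: (c 0%N).
  exists true, (pcons false c'); rewrite xi_pcons -(rhoU_place false (xiS c')) //.
exists false, c'; rewrite rhoU3 //; apply: mkpt_Sn; exact: xiS.
Qed.

Lemma tile_xi o c i : tile o (mkseq c i) (place o (xi c)).
Proof. by exists (xi (shift c i)); [apply: xiS|rewrite -xi_run]. Qed.

Lemma Lam_of_tiles o c p : (forall i, tile o (mkseq c i) p) -> p = place o (xi c).
Proof.
move=> H; have [y0 Hy0 E0] := H 0%N.
rewrite E0; congr place; apply: xi_unique => // i.
have [y Hy Ey] := H i; exists y => //; move: Ey; rewrite E0.
case: (o) => [|/mkpt_inj [-> //]].
rewrite !place_true => /mkpt_inj [Ef _]; apply/funext => j.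
by have := congr1 (fun f => f (flip j)) Ef; rewrite flipK.
Qed.

(** Otherwise König's lemma gives an infinite path all of whose tiles contain [p], and [p] is its
    limit point. *)
Lemma avoids_exists p : Sn p -> ~ Lam p -> exists D, avoids D p.
Proof.
move=> Sp Lp.
have Ho o : exists D, forall w, size w = D -> ~ tile o w p.
  apply: contrapT => Hn; apply: Lp.
  have [||c Hc] := @konig (fun w => tile o w p).
  - by move=> w b; rewrite -cats1 => /tile_cat.
  - move=> m; apply: contrapT => Hm; apply: Hn; exists m => w Hw Ht.
    by apply: Hm; exists w.
  - by exists o, c; apply: Lam_of_tiles.
have [[D1 H1] [D2 H2]] := (Ho true, Ho false); exists (maxn D1 D2) => o w Hw.
case: o => /(tile_take) Ht.
  by apply: (H1 (take D1 w)) => //; rewrite size_takel // Hw leq_maxl.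
by apply: (H2 (take D2 w)) => //; rewrite size_takel // Hw leq_maxr.
Qed.

Lemma Lam_not_avoids D p : Lam p -> ~ avoids D p.
Proof.
by move=> [o [c ->]] /(_ o (mkseq c D)); rewrite size_mkseq => /(_ erefl); apply; apply: tile_xi.
Qed.

Lemma Lam_closed : closedS Lam.
Proof.
split; first exact: Lam_Sn.
move=> p Sp [_ Lp]; have [D HD] := avoids_exists Sp Lp.
have [d d0 Hd] := tiles_open Sp HD; exists d => // q Sq Hpq; split=> //.
by move=> /(@Lam_not_avoids D); apply; apply: Hd.
Qed.

Lemma Lam_compact : compactS Lam.
Proof.
split; first exact: Lam_Sn.
move=> I U Uo Ucov.
(* Bisection: if a copy had no finite subcover, neither would the tiles along some infinite path;
   but the limit of that path lies in one open set, which covers the limit points of a whole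
   tile. *)
pose fincov o w := exists m (k : 'I_m -> I), forall c, exists j, U (k j) (place o (run w (xi c))).
have Hcov o : fincov o [::].
  apply: contrapT => Hn.
  have [w Hw|c Hc] := @dependent_path (fun w => ~ fincov o w) Hn.
    apply: contrapT => Hb; apply: Hw.
    have Hb' b : fincov o (rcons w b) by apply: contrapT => H; apply: Hb; exists b.
    have [[m1 [k1 H1]] [m2 [k2 H2]]] := (Hb' true, Hb' false).
    exists (m1 + m2)%N, (fun j => match split j with inl j1 => k1 j1 | inr j2 => k2 j2 end) => c.
    rewrite xi_step //; case: (c 0%N).
      have [j Hj] := H1 (shift c 1); exists (lshift m2 j).
      have -> : split (lshift m2 j) = inl j := unsplitK (inl j).
      by move: Hj; rewrite -cats1 run_cat.
    have [j Hj] := H2 (shift c 1); exists (rshift m1 j).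
    have -> : split (rshift m1 j) = inr j := unsplitK (inr j).
    by move: Hj; rewrite -cats1 run_cat.
  have [i Hi] := Ucov (place o (xi c)) (ex_intro _ o (ex_intro _ c erefl)).
  have [d d0 Hd] := Uo i _ (place_Sn o (xiS c)) Hi.
  have [D HD] := xi_cvg ws sep cusp d0.
  apply: (Hc D); exists 1%N, (fun=> i) => c'; exists ord0; apply: Hd.
    by apply: place_Sn; apply: run_simplex => //; apply: xiS.
  by apply: sdist_place; [exact: xiS|apply: run_simplex => //; exact: xiS|apply: HD => //; exact: xiS].
have [[m1 [k1 H1]] [m2 [k2 H2]]] := (Hcov true, Hcov false).
exists (m1 + m2)%N, (fun j => match split j with inl j1 => k1 j1 | inr j2 => k2 j2 end) => p [o [c ->]].
case: o.
  have [j Hj] := H1 c; exists (lshift m2 j).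
  by have -> : split (lshift m2 j) = inl j := unsplitK (inl j).
have [j Hj] := H2 c; exists (rshift m1 j).
by have -> : split (rshift m1 j) = inr j := unsplitK (inr j).
Qed.

(** The word moves [p] to the base copy and then along a long prefix of the path of [q]; contraction
    makes the starting point irrelevant. *)
Lemma Lam_dense p q e : Lam p -> Lam q -> 0 < e -> exists l, sdist_lt (gact l p) q e.
Proof.
move=> [o [c ->]] [o' [c' ->]] e0; have [D HD] := xi_cvg ws sep cusp e0.
exists (nseq o' true ++ code (mkseq c' D) ++ nseq o true); rewrite !act_cat.
have -> : gact (nseq o true) (place o (xi c)) = mkpt false (xi c).
  by case: (o) => //=; rewrite rhoS2 //; apply: mkpt_Sn; exact: xiS.
rewrite gact_code; last exact: xiS.
have -> : gact (nseq o' true) (mkpt false (run (mkseq c' D) (xi c))) =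
          place o' (run (mkseq c' D) (xi c)) by case: (o').
apply: sdist_place; [by apply: run_simplex => //; exact: xiS|exact: xiS|].
by rewrite dist1C; apply: HD => //; exact: xiS.
Qed.

Lemma avoids_compact K : compactS K -> K `<=` @Sn R n `\` Lam ->
  exists D, forall p, K p -> avoids D p.
Proof.
move=> [KS Kc] KL.
have [||m [k Hk]] := Kc nat (fun D => [set p | Sn p /\ avoids D p]).
- move=> D p Sp [_ Hp]; have [d d0 Hd] := tiles_open Sp Hp.
  by exists d => // q Sq Hpq; split=> //; apply: Hd.
- move=> p Kp; have [Sp Lp] := KL p Kp; have [D HD] := avoids_exists Sp Lp.
  by exists D.
exists (\max_j k j)%N => p /Hk [j [_ Hj]] o w Hw; apply: (avoids_ge Hj).
by rewrite Hw (leq_bigmax j).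
Qed.

(** The barycentre is interior to its copy, and test points built from it exclude a final S and then
    an initial power of U from the normal form. A remaining word [w] would fix every point of the
    base copy, and its powers cannot contract the distance of two vertices. *)
Lemma gact_faithful l : (forall p, Sn p -> gact l p = p) -> psl_eq (evalm l) 1%:M.
Proof.
move=> Hl; have [a [w [e [a3 El Al]]]] : exists a w e, [/\ (a < 3)%N,
    psl_eq (evalm l) (evalm (nfword a w e)) & forall p, Sn p -> gact l p = gact (nfword a w e) p].
  by apply: (act_nfword (D := @Sn R n)) => q; [exact: rhoS_Sn|exact: rhoU_Sn|exact: rhoS2|exact: rhoU3].
have {}Hl p : Sn p -> gact (nfword a w e) p = p by move=> Sp; rewrite -Al // Hl.
pose y0 : pt := fun=> n.+1%:R^-1.
have Hy0 : in_simplex y0.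
  split=> [i|]; first by rewrite invr_ge0 ler0n.
  by rewrite sumr_const card_ord -[LHS]mulr_natl mulfV // pnatr_eq0.
have Ny0 : ~ on_bdry y0 by move=> [i /eqP]; rewrite invr_eq0 pnatr_eq0.
have sides x : mkpt true x <> mkpt false y0.
  by move=> /esym /mkpt_inj [_ H]; apply: Ny0; apply: H.
have Usides y : in_simplex y -> rU (mkpt false y) <> mkpt false y0 /\
     rU (rU (mkpt false y)) <> mkpt false y0.
  by move=> Hy; split; [rewrite rhoU_false|rewrite rhoU2_false].
have [Ea Ew Ee] : [/\ a = 0%N, w = [::] & e = false]; last first.
  by apply: psl_trans El _; rewrite Ea Ew Ee; left.
have e0 : e = false.
  case Ee: e Hl => //; rewrite /nfword => Hl; exfalso.
  case: a a3 Hl {El Al} => [|[|[|//]]] _ Hl.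
  - have := Hl _ (place_Sn true Hy0); rewrite !act_cat.
    have -> : gact (nseq true true) (place true y0) = mkpt false y0.
      exact: (rhoS_place true Hy0).
    rewrite gact_code // place_true => /mkpt_inj [E H]; have [//|i Hi] := H _.
    apply: Ny0; exists i; move: Hi; rewrite E.
    by rewrite /y0.
  - pose z := rU (rU (mkpt false y0)).
    have Sz : Sn z by do 2!apply: rhoU_Sn => //; apply: mkpt_Sn.
    have Hs := step_simplex ws false Hy0; have Hr := run_simplex ws w Hs.
    have Ez : rS z = mkpt false (step false y0).
      by rewrite /z [rU (rU _)](rhoU_place false Hy0) rhoS_place.
    have E : rU (mkpt false (run w (step false y0))) = z.
      by rewrite -[RHS](Hl z Sz) !act_cat -gact_code // -Ez.
    have [_ []] := Usides _ Hr; rewrite E /z rhoU3 //; exact: mkpt_Sn.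
  - pose z := rU (mkpt false y0).
    have Sz : Sn z by apply: rhoU_Sn => //; apply: mkpt_Sn.
    have Hs := step_simplex ws true Hy0; have Hr := run_simplex ws w Hs.
    have Ez : rS z = mkpt false (step true y0).
      by rewrite /z [rU _](rhoU_place true Hy0) rhoS_place.
    have E : rU (rU (mkpt false (run w (step true y0)))) = z.
      by rewrite -[RHS](Hl z Sz) !act_cat -gact_code // -Ez.
    have Em := rhoU3 ws (mkpt_Sn false Hr); rewrite E /z in Em.
    have [[]] := Usides _ Hr; rewrite -Em rhoU3 //; exact: mkpt_Sn.
rewrite e0 in Hl *.
have Hl' y : in_simplex y -> gact (nseq a false) (mkpt false (run w y)) = mkpt false y.
  move=> Hy; have := Hl _ (mkpt_Sn false Hy); rewrite /nfword !act_cat /=.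
  by rewrite gact_code.
have a0 : a = 0%N.
  case: a a3 Hl' {Hl El Al} => [|[|[|//]]] // _ Hl'; have := Hl' y0 Hy0 => /=.
    by have [] := Usides _ (run_simplex ws w Hy0).
  by have [] := Usides _ (run_simplex ws w Hy0).
split=> //; rewrite a0 /= in Hl'; apply/eqP/negPn/negP => wn.
have Hfix y : in_simplex y -> run w y = y by move=> /Hl' /mkpt_inj [].
have [D HD] := run_shrink ws sep cusp (ltr01 : 0 < (1 : R)).
pose W := flatten (nseq D w).
have HW y : in_simplex y -> run W y = y.
  by move=> Hy; rewrite /W; elim: D {HD W} => //= D IH; rewrite run_cat IH Hfix.
have HsW : (D <= size W)%N.
  rewrite size_flatten /shape map_nseq sumn_nseq leq_pmull // lt0n size_eq0 //.
have := HD W HsW _ _ (delta_simp R ord0) (delta_simp R (tau ord0)).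
rewrite !HW; [|exact: delta_simp..]; apply/negP; rewrite -leNgt.
apply: le_trans (coord_dist1 _ _ ord0).
by rewrite /unit_pt eqxx [_ == tau _]eq_sym tau_neq subr0 normr1.
Qed.

End Limit.
End SphereAction.

(** * Continuity in the weights *)

Section Dependence.
Variables (R : realType) (n : nat) (G : gluing n).
Local Notation J := 'I_n.+1.
Local Notation pt := (J -> R).
Local Notation tau := (tau G).
Local Notation inX := (inX G).
Local Notation flip := (flip G).
Local Notation eps := (eps R n).
Local Notation beta := (beta R n).
Local Notation N := (n.+1%:R : R).

Lemma N_ge1 : 1 <= N. Proof. by rewrite ler1n. Qed.
Lemma eps_le1 : eps <= 1.
Proof. by rewrite invf_le1 ?ltr0n // N_ge1. Qed.
Lemma beta_le : beta * N <= 3.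
Proof.
have := sum_beta n (1 : R); rewrite sumr_const card_ord -[LHS]mulr_natr mulr1 => ->.
by have := eps_le1; lra.
Qed.

Lemma sum_le_N (P : pred J) (F : J -> R) eta : 0 <= eta -> (forall j, F j <= eta) ->
  \sum_(j | P j) F j <= eta * N.
Proof.
move=> e0 HF; rewrite big_mkcond /=.
have -> : eta * N = \sum_(j < n.+1) eta by rewrite sumr_const card_ord mulr_natr.
by apply: ler_sum => j _; case: ifP => _ //.
Qed.

Lemma ctot_close (q q' : J -> R * R * R) eta : (forall j, dist3 (q j) (q' j) <= eta) ->
  `|ctot G q - ctot G q'| <= eta * N.
Proof.
move=> H; have e0 : 0 <= eta by apply: le_trans (H ord0); rewrite !addr_ge0.
rewrite /ctot -sumrB; apply: le_trans (ler_norm_sum _ _ _) _; apply: sum_le_N => // j.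
apply: le_trans (H j); rewrite /dist3 lerDr.
by rewrite addr_ge0.
Qed.

Lemma bend_close (q q' : J -> R * R * R) eta : (forall j, dist3 (q j) (q' j) <= eta) ->
  dist1 (bend G q) (bend G q') <= 5 * eta * N.
Proof.
move=> H; have e0 : 0 <= eta by apply: le_trans (H ord0); rewrite !addr_ge0.
apply: sum_le_N; first by lra.
move=> j; have Hj := H j; have HC := ctot_close H.
have Hu : `|ucoord G q j - ucoord G q' j| <= eta.
  move: Hj; rewrite /dist3 /ucoord; have := normr_ge0 ((q j).1.1 - (q' j).1.1).
  have := normr_ge0 ((q j).1.2 - (q' j).1.2); have := normr_ge0 ((q j).2 - (q' j).2).
  by case: (inX j); lra.
have Hc : `|(q j).2 - (q' j).2| <= eta.
  move: Hj; rewrite /dist3; have := normr_ge0 ((q j).1.1 - (q' j).1.1).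
  by have := normr_ge0 ((q j).1.2 - (q' j).1.2); lra.
have -> : bend G q j - bend G q' j = (ucoord G q j - ucoord G q' j)
    - eps * ((q j).2 - (q' j).2) + beta * (ctot G q - ctot G q').
  by rewrite /bend; ring.
apply: le_trans (ler_normD _ _) _.
have H1 : `|beta * (ctot G q - ctot G q')| <= 3 * eta.
  have b0 := ltW (beta_gt0 R n); rewrite normrM (ger0_norm b0).
  apply: le_trans (ler_wpM2l b0 HC) _; rewrite mulrCA mulrC ler_wpM2r //.
  exact: beta_le.
have H2 : `|eps * ((q j).2 - (q' j).2)| <= eta.
  rewrite normrM (gtr0_norm (eps_gt0 R n)); apply: le_trans Hc.
  by rewrite ler_piMl // eps_le1.
have := ler_normB (ucoord G q j - ucoord G q' j) (eps * ((q j).2 - (q' j).2)).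
by lra.
Qed.

Lemma sdist_cross t t' (x y : pt) i eta e : in_simplex x -> in_simplex y -> x i <= eta ->
  4 * eta + dist1 x y < e -> sdist_lt (mkpt t x) (mkpt t' y) e.
Proof.
move=> [x0 x1] Hy xi He; right.
(* A short path to the other side through the boundary: the small coordinate [i] is emptied into
   [tau i], at l1 cost 2 x_i, which enters twice. *)
pose z : pt := fun j => if j == i then 0 else if j == tau i then x (tau i) + x i else x j.
have ti : (tau i == i) = false by apply: tau_neq.
have Ez : dist1 x z = 2 * x i.
  rewrite /dist1 (bigD1 i) //= (bigD1 (tau i)) /= ?ti //.
  rewrite /z !eqxx ti big1; last first.
    by move=> j /andP[/negbTE -> /negbTE ->]; rewrite subrr normr0.
  by rewrite subr0 (ger0_norm (x0 i)) opprD addNKr normrN (ger0_norm (x0 i)); ring.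
exists z; split; last split.
- split=> [j|]; first by rewrite /z; do 2![case: ifP => _ //]; rewrite addr_ge0.
  rewrite -[RHS]x1 (bigD1 i) //= (bigD1 (tau i)) /= ?ti //.
  rewrite [RHS](bigD1 i) //= [in RHS](bigD1 (tau i)) /= ?ti //.
  rewrite {1 2}/z !eqxx ti.
  rewrite (eq_bigr x); last by move=> j /andP[/negbTE H1 /negbTE H2]; rewrite /z H1 H2.
  by ring.
- by exists i; rewrite /z eqxx.
- rewrite /=; apply: le_lt_trans He.
  have := enorm_dist1 x z; have := enorm_dist1 z y.
  have := dist1_triangle x z y; rewrite (dist1C z x) Ez.
  by lra.
Qed.

Lemma sdist_sym (p q : spt R n) e : sdist_lt p q e -> sdist_lt q p e.
Proof.
have E (x y : pt) : enorm (dvec x y) = enorm (dvec y x).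
  by rewrite /enorm; congr Num.sqrt; apply: eq_bigr => i _; rewrite /dvec -sqrrN opprB.
case=> [[E1 H]|[z [H1 [H2 H3]]]]; first by left; rewrite E.
by right; exists z; do 2!split=> //; rewrite addrC E [X in _ + X]E.
Qed.

(** The delicate case is a change of side. The total of third entries is then at most eta (n + 1) on
    one side and zero on the other, and where it is positive some first or second entry vanishes, so
    a coordinate is at most 3 eta. The cost is at most 12 eta + 5 eta (n + 1). *)
Lemma theta_close (q q' : J -> R * R * R) eta e : conf G q -> conf G q' ->
  (forall j, dist3 (q j) (q' j) <= eta) -> 20 * eta * N < e ->
  sdist_lt (theta G q) (theta G q') e.
Proof.
move=> cq cq' H He; have e0 : 0 <= eta by apply: le_trans (H ord0); rewrite !addr_ge0.
have N1 := N_ge1; have eN : eta <= eta * N by rewrite ler_peMr.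
have Hb := bend_close H; have HC := ctot_close H.
have cross (r r' : J -> R * R * R) : conf G r -> conf G r' ->
    `|ctot G r - ctot G r'| <= eta * N -> dist1 (bend G r) (bend G r') <= 5 * eta * N ->
    0 < ctot G r -> ctot G r' = 0 ->
    sdist_lt (mkpt true (bend G r)) (mkpt false (bend G r')) e.
  move=> cr cr' HCr Hbr Hp E0; rewrite E0 subr0 (gtr0_norm Hp) in HCr.
  have [rt rtau _] := cr.
  have [j Xj cj] : exists2 j, inX j & 0 < (r j).2.
    apply: contrapT => Hn; move: Hp; rewrite /ctot big1 ?ltxx // => j Xj.
    apply/eqP; rewrite eq_le; have [_ _ -> _] := rt j.
    by rewrite andbT leNgt; apply/negP => Hj; apply: Hn; exists j.
  have [i ui] : exists i, ucoord G r i = 0.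
    have [_ _ _ [E|E|E]] := rt j; [exists j|exists (tau j)|by rewrite E ltxx in cj].
      by rewrite /ucoord Xj.
    by rewrite /ucoord inX_tau Xj rtau.
  apply: (@sdist_cross true false _ _ i (3 * eta)) => //; [exact: bend_simplex..| |].
    rewrite /bend ui sub0r.
    have c0 : 0 <= (r i).2 by have [] := rt i.
    have : 0 <= eps * (r i).2 by rewrite mulr_ge0 // ltW // eps_gt0.
    have : beta * ctot G r <= 3 * eta.
      apply: le_trans (ler_wpM2l (ltW (beta_gt0 R n)) HCr) _.
      by rewrite mulrCA mulrC ler_wpM2r // beta_le.
    by lra.
  by lra.
have C0 := ctot_ge0 cq; have C0' := ctot_ge0 cq'; rewrite /theta.
have same t : sdist_lt (mkpt t (bend G q)) (mkpt t (bend G q')) e.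
  by apply: sdist_mkpt; [exact: bend_simplex..|]; lra.
case: ltP => H1; case: ltP => H2 //.
  by apply: cross => //; apply/eqP; rewrite eq_le H2.
apply: sdist_sym; apply: cross; rewrite // ?[_ - ctot G q]distrC ?[dist1 _ (bend G q)]dist1C //.
  by rewrite distrC.
by apply/eqP; rewrite eq_le H1.
Qed.

Lemma rhoU_dep (s s' : pt) d e p : weights G s -> weights G s' ->
  (forall j, `|s j - s' j| <= d) -> 20 * (420 * d) * N < e -> Sn p ->
  sdist_lt (rhoU G s p) (rhoU G s' p) e.
Proof.
move=> ws ws' Hd He Sp; have cq := psi_conf G Sp.
apply: (theta_close (eta := 420 * d)) => //; [exact: turn_confP..|].
move=> j; have [s0 s4 _ _] := ws; have [s0' s4' _ _] := ws'; have [qt qtau qm] := cq.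
have m1 i : mass (psi G p i) <= 1.
  have m0 l : 0 <= mass (psi G p l) by have [? ? ? _] := qt l; rewrite /mass !addr_ge0.
  wlog Xi : i / inX i.
    by move=> W; case Xi: (inX i); [apply: W|rewrite -qtau; apply: W; rewrite inX_tau Xi].
  by rewrite -qm (bigD1 i) //= lerDl sumr_ge0.
apply: le_trans (turn_dep (s0 j) (s4 j) (s0' j) (s4' j) (qt j)) _.
rewrite ler_pM2l ?ltr0n //; apply: le_trans (Hd j).
by rewrite ler_piMr.
Qed.

Lemma step_dep (s s' : pt) d b y : weights G s -> weights G s' ->
  (forall j, `|s j - s' j| <= d) -> in_simplex y ->
  dist1 (step G s b y) (step G s' b y) <= 10 * d * N.
Proof.
move=> ws ws' Hd Hy; have [y0 y1] := Hy.
have Ef : dist1 (step G s b y) (step G s' b y) = dist1 (bend G (tq G s b y)) (bend G (tq G s' b y)).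
  exact: dist1_flip.
rewrite Ef; apply: le_trans (_ : 5 * (2 * d) * N <= _); last by lra.
have Hbl j : `|blend G s y j - blend G s' y j| <= d.
  have -> : blend G s y j - blend G s' y j = (s j - s' j) * (y (tau j) - y j).
    by rewrite /blend; ring.
  rewrite normrM; apply: le_trans (Hd j); rewrite ler_piMr // ler_norml.
  have yle i : y i <= 1 by rewrite -y1 (bigD1 i) //= lerDl sumr_ge0.
  by have := y0 j; have := y0 (tau j); have := yle j; have := yle (tau j); lra.
apply: bend_close => j; rewrite /tq /dist3.
by case: b {Ef}; case: (inX j) => /=; rewrite subrr normr0;
  have := Hbl j; have := Hbl (tau j); lra.
Qed.

Lemma run_dep (s s' : pt) d w y : weights G s -> weights G s' ->
  (forall j, `|s j - s' j| <= d) -> in_simplex y ->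
  dist1 (run G s w y) (run G s' w y) <= (size w)%:R * (10 * d * N).
Proof.
move=> ws ws' Hd Hy; elim: w => [|b w IH]; first by rewrite /= dist1xx mul0r.
apply: le_trans (dist1_triangle (step G s b (run G s' w y)) _ _) _.
have H1 := run_dist_le ws [:: b] (run_simplex ws w Hy) (run_simplex ws' w Hy).
have H2 := step_dep b ws ws' Hd (run_simplex ws' w Hy).
rewrite [size _]/= -natr1 mulrDl mul1r; apply: lerD => //.
exact: le_trans H1 IH.
Qed.

(** The depth D comes from contraction at the fixed weights alone; the tail of the path may then be
    anything, and only D steps have to be compared between the two weights, which costs a multiple
    of D d. *)
Lemma Lam_dep (s : pt) e : weights G s -> separated G -> (exists v, s v = 0) -> 0 < e ->
  exists2 d : R, 0 < d & forall s', weights G s' -> (exists v, s' v = 0) ->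
    (forall j, `|s j - s' j| <= d) -> hclose (Lam G s) (Lam G s') e.
Proof.
move=> ws sep cu e0; have e2 : 0 < e / 2 by lra.
have [D HD] := run_shrink ws sep cu e2.
pose K : R := D%:R * (10 * N) + 1.
have K0 : 0 < K by rewrite ltr_wpDl // !mulr_ge0.
exists (e / 2 / K); first by rewrite divr_gt0.
move=> s' ws' cu' Hd.
have key c : dist1 (xi G s c) (xi G s' c) < e.
  have Hs := xi_simplex ws sep cu (shift c D); have Hs' := xi_simplex ws' sep cu' (shift c D).
  rewrite (xi_run ws sep cu c D) (xi_run ws' sep cu' c D).
  apply: le_lt_trans (dist1_triangle (run G s (mkseq c D) (xi G s' (shift c D))) _ _) _.
  have H1 : dist1 (run G s (mkseq c D) (xi G s (shift c D)))
                  (run G s (mkseq c D) (xi G s' (shift c D))) < e / 2.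
    by apply: HD => //; rewrite size_mkseq.
  have H2 := run_dep (mkseq c D) ws ws' Hd Hs'; rewrite size_mkseq in H2.
  have H3 : D%:R * (10 * (e / 2 / K) * N) <= e / 2.
    have -> : D%:R * (10 * (e / 2 / K) * N) = (K - 1) * (e / 2 / K).
      by rewrite /K; ring.
    have E : K * (e / 2 / K) = e / 2 by rewrite mulrC divfK ?gt_eqF.
    have : 0 <= e / 2 / K by rewrite divr_ge0 // ltW.
    by rewrite mulrBl mul1r E; lra.
  by lra.
have HS (t : pt) c : weights G t -> (exists v, t v = 0) -> in_simplex (xi G t c).
  by move=> wt ct; apply: xi_simplex.
split=> p [o [c ->]].
  exists (place G o (xi G s' c)); split; first by exists o, c.
  by apply: sdist_place; rewrite ?key //; apply: HS.
exists (place G o (xi G s c)); split; first by exists o, c.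
by apply: sdist_place; rewrite 1?dist1C ?key //; apply: HS.
Qed.

End Dependence.

(** * Stern-Brocot intervals of the projective line *)

Section ProjectiveLine.
Variable R : realType.
Local Notation P1 := (P1 R).
Implicit Types (p q z : P1) (x y : R).

Definition mS p : P1 :=
  if p is Some x then (if x == 0 then None else Some (- x^-1)) else Some 0.
Definition mU p : P1 :=
  if p is Some x then (if x + 1 == 0 then None else Some (- (x + 1)^-1)) else Some 0.

Lemma mob_S p : mob genS p = mS p.
Proof.
case: p => [x|]; rewrite /mob /ent !mxE /=.
  by rewrite mul1r addr0 mul0r add0r mulN1r.
by rewrite oner_eq0 mul0r.
Qed.

Lemma mob_U p : mob genU p = mU p.
Proof.
case: p => [x|]; rewrite /mob /ent !mxE /=.
  by rewrite mul1r mul0r add0r mulN1r.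
by rewrite oner_eq0 mul0r.
Qed.

Lemma mSK : involutive mS.
Proof.
case=> [x|] /=; last by rewrite eqxx.
case: (eqVneq x 0) => [->//|x0] /=; rewrite oppr_eq0 invr_eq0 (negbTE x0).
by rewrite invrN opprK invrK.
Qed.

Lemma mU3 p : mU (mU (mU p)) = p.
Proof.
case: p => [x|] /=; last first.
  by rewrite add0r oner_eq0 /= invr1 addNr eqxx.
case: (eqVneq (x + 1) 0) => [E|x1] /=.
  by rewrite add0r oner_eq0 invr1; congr Some; lra.
have -> : - (x + 1)^-1 + 1 = x / (x + 1) by field.
rewrite mulf_eq0 invr_eq0 (negbTE x1) orbF; case: (eqVneq x 0) => [->//|x0] /=.
have -> : - (x / (x + 1))^-1 + 1 = - x^-1 by field; rewrite x0 x1.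
rewrite oppr_eq0 invr_eq0 (negbTE x0); congr Some.
by rewrite invrN opprK invrK.
Qed.

Lemma mS_inj : injective mS. Proof. exact: inv_inj mSK. Qed.
Lemma mU_inj : injective mU.
Proof. by move=> p q E; rewrite -(mU3 p) E mU3. Qed.

Definition nonneg p : Prop := if p is Some x then 0 <= x else True.

(** On [0, oo] these are the Stern-Brocot moves x -> x + 1 and x -> x / (x + 1), onto [1, oo] and
    [0, 1]. *)
Definition tm (b : bool) p : P1 := if b then mS (mU p) else mS (mU (mU p)).

Lemma tm_inj b : injective (tm b).
Proof. by case: b => p q /mS_inj /mU_inj => [|/mU_inj]. Qed.

Lemma tm_true x : 0 <= x -> tm true (Some x) = Some (x + 1).
Proof.
move=> x0; rewrite /tm /=; have x1 : x + 1 != 0 by rewrite gt_eqF //; lra.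
by rewrite (negbTE x1) /= oppr_eq0 invr_eq0 (negbTE x1) invrN opprK invrK.
Qed.

Lemma tm_false x : 0 <= x -> tm false (Some x) = Some (x / (x + 1)).
Proof.
move=> x0; rewrite /tm /=; have x1 : x + 1 != 0 by rewrite gt_eqF //; lra.
rewrite (negbTE x1) /=; have -> : - (x + 1)^-1 + 1 = x / (x + 1) by field.
rewrite mulf_eq0 invr_eq0 (negbTE x1) orbF; case: (eqVneq x 0) => [->|xn] /=.
  by rewrite mul0r.
rewrite oppr_eq0 invr_eq0 mulf_eq0 invr_eq0 (negbTE x1) (negbTE xn) /=; congr Some.
by field; rewrite x1 xn.
Qed.

Lemma tm_trueN : tm true None = None.
Proof. by rewrite /tm /= eqxx. Qed.

Lemma tm_falseN : tm false None = Some 1.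
Proof. by rewrite /tm /= add0r oner_eq0 invr1 /= oppr_eq0 oner_eq0 invrN invr1 opprK. Qed.

Lemma tm_nonneg b q : nonneg q -> nonneg (tm b q).
Proof.
case: q => [x x0|_]; case: b; rewrite ?tm_trueN ?tm_falseN ?tm_true ?tm_false //=.
  by rewrite addr_ge0.
by rewrite divr_ge0 // addr_ge0.
Qed.

Definition ge1 p : bool := if p is Some x then 1 <= x else true.
Definition untm p : P1 :=
  if p is Some x then Some (if 1 <= x then x - 1 else x / (1 - x)) else None.

Lemma untm_nonneg p : nonneg p -> nonneg (untm p).
Proof.
case: p => //= x x0; case: (leP 1 x) => x1; first by rewrite subr_ge0.
by rewrite divr_ge0 // subr_ge0 ltW.
Qed.

Lemma untmK p : nonneg p -> tm (ge1 p) (untm p) = p.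
Proof.
move=> /[dup] /untm_nonneg; case: p => [x|]; last by move=> _ _; exact: tm_trueN.
rewrite /ge1 /untm /nonneg; case: (leP 1 x) => x1 y0 x0; first by rewrite tm_true // subrK.
rewrite tm_false //; congr Some; have x1' : 1 - x != 0 by rewrite gt_eqF //; lra.
by field; rewrite x1' /= addrCA subrr addr0 oner_eq0.
Qed.

Definition tmw (w : seq bool) q : P1 := foldr tm q w.

Lemma tmw_cat w w' q : tmw (w ++ w') q = tmw w (tmw w' q).
Proof. exact: foldr_cat. Qed.

Lemma tmw_nonneg w q : nonneg q -> nonneg (tmw w q).
Proof. by move=> q0; elim: w => //= b w; apply: tm_nonneg. Qed.

Lemma tmw_inj w : injective (tmw w).
Proof. by elim: w => //= b w IH p q /tm_inj /IH. Qed.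

Definition sbarc (w : seq bool) p : Prop := exists2 q, nonneg q & p = tmw w q.

Lemma arc_cat w w' p : sbarc (w ++ w') p -> sbarc w p.
Proof. by move=> [q q0 ->]; exists (tmw w' q); [apply: tmw_nonneg|rewrite tmw_cat]. Qed.

Lemma arc_nonneg w p : sbarc w p -> nonneg p.
Proof. by move=> [q q0 ->]; apply: tmw_nonneg. Qed.

(** A relation and not a function of the point, because a positive rational has two such paths. *)
Definition adm (c : nat -> bool) p : Prop := forall i, sbarc (mkseq c i) p.

Definition sbpath p (i : nat) : bool := ge1 (iter i untm p).

Lemma adm_path p : nonneg p -> adm (sbpath p) p.
Proof.
move=> p0 i; exists (iter i untm p).
  by elim: i => // i IH; apply: untm_nonneg.
elim: i => // i IH; rewrite mkseqS -cats1 tmw_cat [LHS]IH; congr tmw.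
rewrite /= /sbpath untmK //.
by elim: i {IH} => // i IH; apply: untm_nonneg.
Qed.

Lemma adm_shift c p i : adm c p -> exists2 q, adm (shift c i) q & p = tmw (mkseq c i) q.
Proof.
move=> Hc; have [q q0 E] := Hc i; exists q => // j.
have := Hc (i + j)%N; rewrite mkseqD => -[r r0]; rewrite tmw_cat E => /tmw_inj ->.
by exists r.
Qed.

Lemma adm_cat c i q : adm (shift c i) q -> adm c (tmw (mkseq c i) q).
Proof.
move=> Hq j; have [ij|/ltnW ji] := leqP i j.
  have [r r0 ->] := Hq (j - i)%N; exists r => //.
  by rewrite -tmw_cat -mkseqD subnKC.
have [r r0 ->] := Hq 0%N; rewrite -(subnKC ji) mkseqD tmw_cat.
by exists (tmw (mkseq (shift c j) (i - j)) (tmw [::] r)) => //; apply: tmw_nonneg.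
Qed.

(** The two halves of [0, oo] share only the point 1. This is the sole source of double paths. *)
Lemma tm_meet p q : nonneg p -> nonneg q -> tm true p = tm false q ->
  p = Some 0 /\ q = None.
Proof.
case: p => [x x0|_]; case: q => [y y0|_]; rewrite ?tm_trueN ?tm_falseN ?tm_true ?tm_false //.
  rewrite /nonneg in x0 y0; move=> [E]; exfalso; have y1 : 0 < y + 1 by rewrite ltr_wpDl.
  have : y / (y + 1) < 1 by rewrite ltr_pdivrMr //; lra.
  by rewrite -E; lra.
by move=> [E]; split=> //; congr Some; lra.
Qed.

Lemma adm_zero c : adm c (Some 0) -> forall i, c i = false.
Proof.
move=> H i; have [q Hq] := adm_shift i.+1 H; have q0 := arc_nonneg (Hq 0%N).
have key w r : nonneg r -> Some 0 = tmw w r -> r = Some 0 /\ forall b, b \in w -> b = false.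
  elim: w r => [|b w IH] r r0 /= E; first by rewrite E.
  have Hb : b = false /\ tmw w r = Some 0.
    have := tmw_nonneg w r0; case: (tmw w r) E => [y|] E; rewrite /nonneg => y0.
      case: (b) E => E; [rewrite tm_true // in E|rewrite tm_false // in E]; case: E => E.
        by exfalso; clear -E y0; lra.
      split=> //; congr Some; move/esym/eqP: E; rewrite mulf_eq0 invr_eq0.
      by case/orP => /eqP // E; exfalso; clear -E y0; lra.
    case: (b) E => E; first by rewrite tm_trueN in E.
    by rewrite tm_falseN in E; case: E => /esym /eqP; rewrite oner_eq0.
  have [bF E'] := Hb; have [-> Hw] := IH r r0 (esym E'); split=> // b'.
  by rewrite inE => /orP[/eqP ->|/Hw].
by move=> /(key _ _ q0) [_ Hw]; apply: Hw; rewrite mkseqS mem_rcons inE eqxx.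
Qed.

Lemma adm_infty c : adm c None -> forall i, c i = true.
Proof.
move=> H i; have [q Hq] := adm_shift i.+1 H; have q0 := arc_nonneg (Hq 0%N).
have key w r : nonneg r -> None = tmw w r -> forall b, b \in w -> b = true.
  elim: w => [|b w IH] r0 //= E.
  have Hb : b = true /\ tmw w r = None.
    have := tmw_nonneg w r0; case: (tmw w r) E => [y|] E y0; case: (b) E;
      by rewrite ?tm_trueN ?tm_falseN ?tm_true ?tm_false.
  have [bT E'] := Hb; move=> b'.
  by rewrite inE => /orP[/eqP ->|/(IH r0 (esym E'))].
by move=> /(key _ _ q0) Hw; apply: Hw; rewrite mkseqS mem_rcons inE eqxx.
Qed.

(* Entries (a, b, c, d) of the matrix of [tmw w], with non-negative entries. *)
Definition mulT (m : nat * nat * nat * nat) (b : bool) : nat * nat * nat * nat :=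
  let: (a, b', c, d) := m in
  if b then (a, a + b', c, c + d)%N else (a + b', b', c + d, d)%N.
Definition mat (w : seq bool) := foldl mulT (1, 0, 0, 1)%N w.
Definition mapp (m : nat * nat * nat * nat) q : P1 :=
  let: (a, b, c, d) := m in
  match q with
  | Some y => Some ((a%:R * y + b%:R) / (c%:R * y + d%:R))
  | None => if c == 0%N then None else Some (a%:R / c%:R)
  end.

Definition mdet (m : nat * nat * nat * nat) : Prop :=
  let: (a, b, c, d) := m in (a * d = 1 + b * c)%N.

Lemma mat_rcons w b : mat (rcons w b) = mulT (mat w) b.
Proof. by rewrite /mat -cats1 foldl_cat. Qed.

Lemma mdet_mat w : mdet (mat w).
Proof.
elim/last_ind: w => [|w b IH] //; rewrite mat_rcons.
by case: (mat w) IH => -[[a b'] c] d /= IH; case: b => /=; nia.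
Qed.

Lemma mapp_mat w q : nonneg q -> tmw w q = mapp (mat w) q.
Proof.
elim/last_ind: w q => [|w b IH] q q0.
  by rewrite /mapp; case: q {q0} => //= y; rewrite mul1r addr0 mul0r add0r divr1.
rewrite mat_rcons -cats1 tmw_cat /= IH; last exact: tm_nonneg.
have := mdet_mat w.
case: (mat w) => -[[a b'] c] d /= Hdet.
have d0 : (0 < d)%N by rewrite lt0n; apply/negP => /eqP d0; nia.
have d0' : 0 < d%:R :> R by rewrite ltr0n.
case: q q0 => [y y0|_]; case: b; rewrite ?tm_trueN ?tm_falseN ?tm_true ?tm_false //=.
- by congr Some; rewrite !natrD; congr (_ / _); ring.
- have y1 : y + 1 != 0 by rewrite gt_eqF // ltr_wpDl.
  have cy : 0 <= c%:R * y by rewrite mulr_ge0.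
  congr Some; rewrite !natrD; field; rewrite y1 andbT.
  by rewrite gt_eqF // ltr_wpDl // mulr_ge0 // addr_ge0.
- have -> : (c + d == 0)%N = false by apply/eqP; lia.
  by rewrite !mulr1 -!natrD.
Qed.

(** The interval of [w] is [b/d, a/c]; multiplying out the denominators includes the case c = 0,
    where its right end is infinity. *)
Lemma arcE w p : let: (a, b, c, d) := mat w in
  sbarc w p <-> if p is Some x then b%:R <= d%:R * x /\ c%:R * x <= a%:R else c = 0%N.
Proof.
have := mdet_mat w; have := mapp_mat w; case: (mat w) => -[[a b] c] d Hm /= Hdet.
have d0 : (0 < d)%N by rewrite lt0n; apply/negP => /eqP d0; nia.
have d0' : 0 < d%:R :> R by rewrite ltr0n.
have HR : a%:R * d%:R = 1 + b%:R * c%:R :> R by rewrite -!natrM Hdet natrD.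
split.
  move=> [q q0 ->]; rewrite Hm //; case: q q0 => [y y0|_] /=; last first.
    case: eqP => // /eqP cn; have c0 : 0 < c%:R :> R by rewrite ltr0n lt0n.
    rewrite mulrA ler_pdivlMr // [c%:R * (_ / _)]mulrC divfK ?gt_eqF //; split=> //.
    by rewrite mulrC; lra.
  have D0 : 0 < c%:R * y + d%:R by rewrite ltr_wpDl // mulr_ge0.
  have Hy : y * (a%:R * d%:R) = y * (1 + b%:R * c%:R) by rewrite HR.
  by rewrite /nonneg in y0; rewrite !mulrA ler_pdivlMr // ler_pdivrMr //; lra.
case: p => [x [H1 H2]|c0]; last by exists None => //; rewrite Hm //= c0.
have [E|Hne] := eqVneq (c%:R * x) a%:R.
  have cn : c != 0%N.
    apply/negP => /eqP c0; move: HR; rewrite -E c0; lra.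
  exists None => //; rewrite Hm //= (negbTE cn); congr Some.
  by rewrite -E [c%:R * x]mulrC mulfK // pnatr_eq0.
have Hlt : 0 < a%:R - c%:R * x by rewrite subr_gt0 lt_neqAle Hne.
exists (Some ((d%:R * x - b%:R) / (a%:R - c%:R * x))).
  by rewrite /= divr_ge0 ?(ltW Hlt) // subr_ge0.
rewrite Hm /=; last by rewrite divr_ge0 ?(ltW Hlt) // subr_ge0.
congr Some; set t := a%:R - c%:R * x in Hlt *.
have E1 : a%:R * ((d%:R * x - b%:R) / t) + b%:R = x / t.
  have -> : a%:R * ((d%:R * x - b%:R) / t) + b%:R = (a%:R * (d%:R * x - b%:R) + b%:R * t) / t.
    by field; rewrite gt_eqF.
  have Hx : x * (a%:R * d%:R) = x * (1 + b%:R * c%:R) by rewrite HR.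
  by congr (_ / _); rewrite /t; lra.
have E2 : c%:R * ((d%:R * x - b%:R) / t) + d%:R = 1 / t.
  have -> : c%:R * ((d%:R * x - b%:R) / t) + d%:R = (c%:R * (d%:R * x - b%:R) + d%:R * t) / t.
    by field; rewrite gt_eqF.
  by congr (_ / _); rewrite /t; lra.
by rewrite E1 E2; field; rewrite gt_eqF.
Qed.

Lemma arc_mkseq_le c i j p : (i <= j)%N -> sbarc (mkseq c j) p -> sbarc (mkseq c i) p.
Proof. by move=> ij; rewrite -(subnKC ij) mkseqD => /arc_cat. Qed.

(** The interval has length 1/(cd). As soon as one bit is [false] it is bounded, and each further
    bit increases cd by at least one. *)
Lemma mat_growth c i0 k : c i0 = false ->
  let: (_, _, c', d) := mat (mkseq c (i0.+1 + k)) in (0 < c')%N /\ (k <= c' * d)%N.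
Proof.
move=> Hc; elim: k => [|k IH].
  rewrite addn0 mkseqS mat_rcons Hc.
  have := mdet_mat (mkseq c i0); case: (mat _) => -[[a b] c'] d /= Hdet; split=> //.
  by rewrite lt0n; apply/negP => /eqP; nia.
rewrite addnS mkseqS mat_rcons.
have := mdet_mat (mkseq c (i0.+1 + k)); move: IH.
case: (mat _) => -[[a b] c'] d /= [c0 Hk] Hdet.
have d0 : (0 < d)%N by rewrite lt0n; apply/negP => /eqP d0; nia.
have cc : (0 < c' * c')%N by rewrite muln_gt0 c0.
have dd : (0 < d * d)%N by rewrite muln_gt0 d0.
by case: (c _) => /=; rewrite ?mulnDr ?mulnDl; split; lia.
Qed.

Lemma mat_true c i : (forall j, c j = true) -> mat (mkseq c i) = (1, i, 0, 1)%N.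
Proof.
move=> Hc; elim: i => // i IH; rewrite mkseqS mat_rcons IH Hc /=.
by rewrite add1n.
Qed.

(** The point is the supremum of the left ends of the intervals, except on the constant path [true],
    where the intervals are unbounded and the point is infinity. *)
Lemma adm_exists c : exists p, adm c p.
Proof.
have [Hc|Hn] := pselect (forall i, c i = true).
  by exists None => i; have := arcE (mkseq c i) None; rewrite mat_true // => ->.
have [i0 Hi0] : exists i, c i = false.
  by apply: contrapT => H; apply: Hn => i; apply/negPn/negP => Hi; apply: H; exists i; apply/negbTE.
pose l i : R := (fun m : nat * nat * nat * nat => let: (_, b, _, d) := m in b%:R / d%:R) (mat (mkseq c i)).
have Hl i : sbarc (mkseq c i) (Some (l i)).
  have := arcE (mkseq c i) (Some (l i)); have := mdet_mat (mkseq c i); rewrite /l.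
  case: (mat _) => -[[a b] c'] d /= Hdet ->.
  have d0 : (0 < d)%N by rewrite lt0n; apply/negP => /eqP d0; nia.
  have d0' : 0 < d%:R :> R by rewrite ltr0n.
  rewrite [d%:R * _]mulrC divfK ?gt_eqF // mulrA ler_pdivrMr //.
  by split=> //; rewrite -!natrM ler_nat; nia.
have lE i x : sbarc (mkseq c i) (Some x) -> l i <= x.
  have := arcE (mkseq c i) (Some x); have := mdet_mat (mkseq c i); rewrite /l.
  case: (mat _) => -[[a b] c'] d /= Hdet -> [H _].
  have d0 : (0 < d)%N by rewrite lt0n; apply/negP => /eqP d0; nia.
  by rewrite ler_pdivrMr ?ltr0n // mulrC.
have Hup i j x : (forall y, sbarc (mkseq c i) (Some y) -> y <= x) -> l j <= x.
  move=> Hx; have [ij|/ltnW ji] := leqP i j.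
    by apply: Hx; apply: arc_mkseq_le (Hl j).
  apply: le_trans (lE j (l i) _) (Hx _ (Hl i)).
  exact: arc_mkseq_le (Hl i).
pose E : set R := fun r => exists i, r = l i.
pose x0 := sup E.
have hub : has_sup E.
  split; first by exists (l 0%N), 0%N.
  have := mat_growth 0 Hi0; have := mdet_mat (mkseq c (i0.+1 + 0)).
  have := arcE (mkseq c (i0.+1 + 0)).
  case E1: (mat _) => [[[a b] c'] d] /= HA Hdet [c0 _].
  exists (a%:R / c'%:R) => _ [j ->]; apply: (@Hup (i0.+1 + 0)%N) => y.
  rewrite HA => -[_ H]; rewrite ler_pdivlMr ?ltr0n // mulrC.
  exact: H.
exists (Some x0) => i; have := arcE (mkseq c i) (Some x0).
have Hx0 : l i <= x0 by apply: ub_le_sup; [case: hub|exists i].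
have := mdet_mat (mkseq c i); have := @Hup i; have HlE : l i = l i by [].
move: Hx0; rewrite {1}/l; have := arcE (mkseq c i).
case E1: (mat (mkseq c i)) => [[[a b] c'] d] /= HA Hlx Hupi Hdet ->.
have d0 : (0 < d)%N by rewrite lt0n; apply/negP => /eqP d0; nia.
split; first by move: Hlx; rewrite ler_pdivrMr ?ltr0n // mulrC.
case: (posnP c') => [->|c0]; first by rewrite mul0r ler0n.
rewrite mulrC -ler_pdivlMr ?ltr0n //; apply: ge_sup; first by case: hub.
move=> _ [j ->]; apply: Hupi => y; rewrite HA => -[_ H].
by rewrite ler_pdivlMr ?ltr0n // mulrC; apply: H.
Qed.

Lemma adm_bound c p i0 k x x' : c i0 = false ->
  sbarc (mkseq c (i0.+1 + k)) (Some x) -> sbarc (mkseq c (i0.+1 + k)) (Some x') ->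
  k%:R * `|x - x'| <= 1.
Proof.
move=> Hc; have := mat_growth k Hc; have := mdet_mat (mkseq c (i0.+1 + k)).
have := arcE (mkseq c (i0.+1 + k)).
case: (mat _) => -[[a b] c'] d HA /= Hdet [c0 Hk]; rewrite !HA => -[H1 H2] [H3 H4].
have HR : a%:R * d%:R = 1 + b%:R * c'%:R :> R by rewrite -!natrM Hdet natrD.
have H5 : (c' * d)%:R * `|x - x'| <= 1 :> R.
  have -> : (c' * d)%:R * `|x - x'| = `|(c' * d)%:R * (x - x')|.
    by rewrite normrM ger0_norm ?ler0n.
  have e1 : c'%:R * b%:R <= c'%:R * (d%:R * x) by rewrite ler_wpM2l.
  have e2 : c'%:R * b%:R <= c'%:R * (d%:R * x') by rewrite ler_wpM2l.
  have e3 : d%:R * (c'%:R * x) <= d%:R * a%:R by rewrite ler_wpM2l.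
  have e4 : d%:R * (c'%:R * x') <= d%:R * a%:R by rewrite ler_wpM2l.
  by rewrite natrM ler_norml; lra.
apply: le_trans H5; rewrite ler_wpM2r // ler_nat //.
Qed.

End ProjectiveLine.

(** * Stern-Brocot intervals and the chordal topology of the circle *)

Section CircleTopology.
Variable R : realType.
Local Notation P1 := (P1 R).
Implicit Types (p q z : P1) (x y : R).

Lemma sq1_gt0 x : 0 < 1 + x ^+ 2.
Proof. by rewrite ltr_wpDr // sqr_ge0. Qed.

Lemma cdist_real x y : cdist (Some x) (Some y) =
  Num.sqrt (4 * (x - y) ^+ 2 / ((1 + x ^+ 2) * (1 + y ^+ 2))).
Proof.
by rewrite /cdist /=; congr Num.sqrt; field; rewrite !gt_eqF ?sq1_gt0.
Qed.

Lemma cdist_infty y : cdist None (Some y) = Num.sqrt (4 / (1 + y ^+ 2)).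
Proof. by rewrite /cdist /=; congr Num.sqrt; field; rewrite gt_eqF ?sq1_gt0. Qed.

Lemma cdistC p q : cdist p q = cdist q p.
Proof.
rewrite /cdist; congr (Num.sqrt (_ + _)); by rewrite -sqrrN opprB.
Qed.

Lemma stereo_S p : stereo (mS p) = (- (stereo p).1, - (stereo p).2).
Proof.
case: p => [x|] /=; last by rewrite mulr0 mul0r expr0n /= addr0 sub0r divr1 oppr0.
case: (eqVneq x 0) => [->|x0] /=.
  by rewrite mulr0 mul0r expr0n /= addr0 sub0r divr1 oppr0 opprK.
by congr (_, _); field; rewrite x0 gt_eqF ?sq1_gt0 //= gt_eqF // addrC sq1_gt0.
Qed.

Lemma cdist_S p q : cdist (mS p) (mS q) = cdist p q.
Proof.
rewrite /cdist !stereo_S /=; congr Num.sqrt; ring.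
Qed.

Lemma sqrt_lt (a d : R) : 0 < d -> (Num.sqrt a < d) = (a < d ^+ 2).
Proof.
move=> d0; have -> : d = Num.sqrt (d ^+ 2) by rewrite sqrtr_sqr gtr0_norm.
by rewrite ltr_sqrt ?exprn_gt0 // sqr_sqrtr // sqr_ge0.
Qed.

Lemma near_real x (dl : R) : 0 < dl -> exists2 d : R, 0 < d &
  forall q, cdist (Some x) q < d -> exists2 y, q = Some y & `|x - y| < dl.
Proof.
move=> dl0; pose A := 1 + x ^+ 2; have A0 : 0 < A := sq1_gt0 x.
have A1 : 1 <= A by rewrite lerDl sqr_ge0.
pose d := Num.min 1 dl / A.
have m0 : 0 < Num.min 1 dl by rewrite lt_min dl0 ltr01.
have d0 : 0 < d by rewrite divr_gt0.
have dA : d * A = Num.min 1 dl by rewrite /d divfK // gt_eqF.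
have dA1 : d * A <= 1 by rewrite dA ge_min lexx.
have d1 : d <= 1 by apply: le_trans dA1; rewrite ler_peMr // ltW.
have dA0 : 0 <= d * A by apply: mulr_ge0; exact: ltW.
exists d => // -[y|]; last first.
  rewrite cdistC cdist_infty sqrt_lt // -/A ltr_pdivrMr // => H; exfalso.
  have : d ^+ 2 * A <= 1.
    by rewrite expr2 -mulrA; apply: mulr_ile1 => //; exact: ltW.
  by lra.
rewrite cdist_real sqrt_lt // -/A ltr_pdivrMr ?mulr_gt0 ?sq1_gt0 // => H.
exists y => //; set t := x - y in H *.
have dA2 : d ^+ 2 * A <= 1.
  by rewrite expr2 -mulrA; apply: mulr_ile1 => //; exact: ltW.
have Hy : 1 + y ^+ 2 <= 2 * A + 2 * t ^+ 2.
  by have := sqr_ge0 (2 * x - y); rewrite /A /t !expr2; lra.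
have H2 : d ^+ 2 * (A * (1 + y ^+ 2)) <= d ^+ 2 * A * (2 * A) + 2 * t ^+ 2.
  rewrite mulrA; apply: le_trans (ler_wpM2l _ Hy) _; first by rewrite mulr_ge0 ?sqr_ge0 // ltW.
  rewrite mulrDr lerD2l -[leRHS]mul1r; apply: ler_wpM2r => //.
  by rewrite mulr_ge0 // sqr_ge0.
have H3 : t ^+ 2 < (d * A) ^+ 2.
  have -> : (d * A) ^+ 2 = d ^+ 2 * A * A by ring.
  have := lt_le_trans H H2; have -> : d ^+ 2 * A * (2 * A) = 2 * (d ^+ 2 * A * A) by ring.
  by clear; move: (d ^+ 2 * A * A) (t ^+ 2) => u v; lra.
have H4 : `|t| < d * A.
  have : `|t| ^+ 2 < (d * A) ^+ 2 by rewrite real_normK ?num_real.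
  by rewrite ltr_pXn2r ?nnegrE.
by apply: lt_le_trans H4 _; rewrite dA ge_min lexx orbT.
Qed.

Lemma near_infty (M : R) : 0 < M -> exists2 d : R, 0 < d &
  forall q, cdist None q < d -> q = None \/ exists2 y, q = Some y & M < `|y|.
Proof.
move=> M0; exists (1 / (1 + M)); first by rewrite divr_gt0 // addr_gt0.
case=> [y|]; last by left.
have M1 : 0 < 1 + M by lra.
rewrite cdist_infty sqrt_lt ?divr_gt0 // ltr_pdivrMr ?sq1_gt0 // => H; right; exists y => //.
have {}H : 4 * (1 + M) ^+ 2 < 1 + y ^+ 2.
  move: H; have -> : (1 / (1 + M)) ^+ 2 * (1 + y ^+ 2) = (1 + y ^+ 2) / (1 + M) ^+ 2.
    by field; rewrite gt_eqF.
  by rewrite ltr_pdivlMr ?exprn_gt0.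
have : M ^+ 2 < `|y| ^+ 2.
  rewrite real_normK ?num_real //; move: H; rewrite sqrrD expr1n mul1r.
  have := sqr_ge0 M; rewrite !mulr2n; lra.
by rewrite ltr_pXn2r ?nnegrE // ltW.
Qed.

Lemma cdist_real_le x y (d : R) : 0 < d -> 2 * `|x - y| < d -> cdist (Some x) (Some y) < d.
Proof.
move=> d0 H; rewrite cdist_real sqrt_lt // ltr_pdivrMr ?mulr_gt0 ?sq1_gt0 //.
have Q : 1 <= (1 + x ^+ 2) * (1 + y ^+ 2).
  by rewrite -[X in X <= _]mulr1; apply: ler_pM => //; rewrite lerDl sqr_ge0.
have H1 : 4 * (x - y) ^+ 2 < d ^+ 2.
  have -> : 4 * (x - y) ^+ 2 = (2 * `|x - y|) ^+ 2 by rewrite exprMn real_normK ?num_real //; ring.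
  by rewrite ltr_pXn2r // ?nnegrE ?mulr_ge0 // ltW.
by apply: lt_le_trans H1 _; rewrite ler_peMr // sqr_ge0.
Qed.

Lemma cdist_infty_le y (d : R) : 0 < d -> 2 < d * y -> cdist None (Some y) < d.
Proof.
move=> d0 H; rewrite cdist_infty sqrt_lt // ltr_pdivrMr ?sq1_gt0 //.
have : 0 <= d ^+ 2 by apply: sqr_ge0.
have : 2 ^+ 2 < (d * y) ^+ 2 by rewrite ltr_pXn2r // ?nnegrE // ltW // (lt_trans _ H).
by rewrite exprMn mulrDr mulr1; lra.
Qed.

Lemma arch (x : R) : exists m : nat, x < m%:R.
Proof.
have [x0|x0] := leP 0 x; last by exists 0%N.
by exists (Num.bound x); apply: archi_boundP.
Qed.

Lemma all_true_or (c : nat -> bool) : (forall i, c i = true) \/ exists i, c i = false.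
Proof.
have [H|H] := pselect (exists i, c i = false); first by right.
by left=> i; apply/negPn/negP => Hi; apply: H; exists i; apply/negbTE.
Qed.

Lemma adm_true c p : (forall i, c i = true) -> adm c p -> p = None.
Proof.
move=> Hc; case: p => // x Ha; have [m Hm] := arch x.
have := arcE (mkseq c m) (Some x); rewrite mat_true // => -[HA _]; have [] := HA (Ha m).
by rewrite mul1r leNgt Hm.
Qed.

Lemma arc_not_infty c i0 k : c i0 = false -> ~ sbarc (mkseq c (i0.+1 + k)) (None : P1).
Proof.
move=> Hc; have := mat_growth k Hc; have := arcE (mkseq c (i0.+1 + k)) (None : P1).
by case: (mat _) => -[[a b] c'] d HA [c0 _] /HA E; rewrite E in c0.
Qed.

Lemma adm_uniq c p p' : adm c p -> adm c p' -> p = p'.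
Proof.
move=> Hp Hp'; have [Hc|[i0 Hc]] := all_true_or c.
  by rewrite (adm_true Hc Hp) (adm_true Hc Hp').
case: p Hp => [x|] Hp; last by have := arc_not_infty (k := 0) Hc (Hp _).
case: p' Hp' => [x'|] Hp'; last by have := arc_not_infty (k := 0) Hc (Hp' _).
congr Some; apply/eqP/negPn/negP => xx; have t0 : 0 < `|x - x'| by rewrite normr_gt0 subr_eq0.
have [m Hm] := arch (1 / `|x - x'|); rewrite ltr_pdivrMr // in Hm.
have := @adm_bound R c None i0 m x x' Hc (Hp _) (Hp' _).
by rewrite leNgt Hm.
Qed.

(** The intervals of a path form a neighbourhood base from their own side only, which is why both
    the constant path [true] (large positive numbers) and the bounded paths are treated apart. *)
Lemma adm_shrink c p (V : set P1) : adm c p -> openP V -> V p ->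
  exists i, forall p', sbarc (mkseq c i) p' -> V p'.
Proof.
move=> Hp Vo Vp; have [d d0 Hd] := Vo p Vp; have [Hc|[i0 Hc]] := all_true_or c.
  rewrite (adm_true Hc Hp) in Vp Hd; have [m Hm] := arch (2 / d); exists m => -[x|//].
  have := arcE (mkseq c m) (Some x); rewrite mat_true // => -> [H _]; apply: Hd.
  apply: cdist_infty_le => //; rewrite mul1r in H.
  by rewrite mulrC -ltr_pdivrMr //; apply: lt_le_trans H.
case: p Hp Vp Hd => [x|] Hp Vp Hd; last by have := arc_not_infty (k := 0) Hc (Hp _).
have [m Hm] := arch (2 / d); exists (i0.+1 + m)%N => -[x'|] Ha; last first.
  by have := arc_not_infty (k := m) Hc Ha.
have H := @adm_bound R c None i0 m x x' Hc (Hp _) Ha.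
apply: Hd; apply: cdist_real_le => //.
have m0 : 0 < m%:R :> R by apply: lt_trans Hm; rewrite divr_gt0.
rewrite ltr_pdivrMr // in Hm; rewrite -(ltr_pM2l m0) mulrCA; lra.
Qed.

Lemma arc_closed w p : ~ sbarc w p ->
  exists2 d : R, 0 < d & forall q, cdist p q < d -> ~ sbarc w q.
Proof.
have HA := arcE w; have := mdet_mat w; move: HA.
case: (mat w) => -[[a b] c] d HA /= Hdet.
have d0 : (0 < d)%N by rewrite lt0n; apply/negP => /eqP d0; nia.
have d0' : 0 < d%:R :> R by rewrite ltr0n.
case: p => [x|]; rewrite HA.
  move=> Hn; have [H1|H1] := leP b%:R (d%:R * x).
    have [H2|H2] := leP (c%:R * x) a%:R; first by case: Hn.
    have c0 : 0 < c%:R :> R.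
      rewrite ltr0n lt0n; apply/negP => /eqP c0; move: H2; rewrite c0 mul0r.
      by rewrite ltNge ler0n.
    have t0 : 0 < c%:R * x - a%:R by rewrite subr_gt0.
    have [e e0 He] := near_real x (divr_gt0 t0 c0).
    exists e => // q /He [y -> Hy]; rewrite HA => -[_ H3].
    move: Hy; rewrite ltr_pdivlMr // => Hy.
    have := ler_norm (x - y) => /(ler_wpM2r (ltW c0)); lra.
  have t0 : 0 < b%:R - d%:R * x by rewrite subr_gt0.
  have [e e0 He] := near_real x (divr_gt0 t0 d0').
  exists e => // q /He [y -> Hy]; rewrite HA => -[H3 _].
  move: Hy; rewrite ltr_pdivlMr // => Hy.
  have := ler_norm (y - x) => /(ler_wpM2r (ltW d0')); rewrite distrC; lra.
move=> /eqP cn; have c1 : 1 <= c%:R :> R by rewrite ler1n lt0n.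
have [e e0 He] := @near_infty (1 + a%:R) (ltr_pwDl ltr01 (ler0n _ _)).
exists e => // q /He [->|[y -> Hy]]; rewrite HA; first by move/eqP: cn.
have d1 : 1 <= d%:R :> R by rewrite ler1n.
move=> [H1 H2]; have [y0|y0] := leP 0 y.
  by rewrite ger0_norm // in Hy; have : 1 * y <= c%:R * y by [rewrite ler_wpM2r]; lra.
rewrite ltr0_norm // in Hy; have : d%:R * y < 0 by rewrite pmulr_rlt0.
by have := ler0n R b; lra.
Qed.

End CircleTopology.

(** * Where the images of the two steps meet *)

Section StepMeeting.
Variables (R : realType) (n : nat) (G : gluing n).
Local Notation J := 'I_n.+1.
Local Notation pt := (J -> R).
Local Notation tau := (tau G).
Local Notation inX := (inX G).
Local Notation flip := (flip G).
Local Notation delta := (@unit_pt R n).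
Variable s : pt.
Hypothesis ws : weights G s.
Local Notation step := (step G s).

(** For weight 0 the two turned vertices are the same third vertex of their triangle: U applied to
    the second end of the base edge equals U U applied to the first. *)
Lemma step_meet v : inX v -> s v = 0 -> step true (delta (tau v)) = step false (delta v).
Proof.
move=> Xv sv; have [_ _ st _] := ws.
have Hb i j : s i = 0 -> blend G s (delta i) j = (j == i)%:R.
  by move=> si; rewrite blend_delta // si subr0; case: eqP => // _; case: ifP.
have stv : s (tau v) = 0 by rewrite st.
rewrite /step; suff -> : tq G s true (delta (tau v)) = tq G s false (delta v) by [].
apply/funext => j; rewrite /tq !Hb //; case Xj: (inX j).
  have -> : (j == tau v) = false by apply/eqP => E; move: Xj; rewrite E inX_tau Xv.
  have -> : (tau j == v) = false by apply/eqP => E; move: Xv; rewrite -E inX_tau Xj.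
  by rewrite (inj_eq (inv_inj (tauK G))).
have -> : (tau j == tau v) = false.
  by apply/eqP => /(inv_inj (tauK G)) E; move: Xv; rewrite -E Xj.
have -> : (j == v) = false by apply/eqP => E; move: Xv; rewrite -E Xj.
by have -> : (j == tau v) = (tau j == v) by apply/eqP/eqP => [->|<-]; rewrite tauK.
Qed.

(** Cancelling S U leaves y = U y' in the sphere. The left side is in the base copy and the right
    side in the other one, so they meet on the boundary, which forces the third entries to vanish;
    as 1 - s is positive, so does a coordinate of [y']. *)
Lemma step_eq y y' : in_simplex y -> in_simplex y' -> step true y = step false y' ->
  [/\ on_bdry y, on_bdry y', y = bend G (tq G s true y') & ctot G (tq G s true y') = 0].
Proof.
move=> Hy Hy' E; have [s0 s4 _ _] := ws.
have Sy := mkpt_Sn false Hy; have Sy' := mkpt_Sn false Hy'.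
have E1 : rhoU G s (mkpt false y) = rhoU G s (rhoU G s (mkpt false y')).
  have := rhoU_place ws true Hy; rewrite E -(rhoU_place ws false Hy').
  exact.
have E2 : mkpt false y = rhoU G s (mkpt false y').
  have SU := rhoU_Sn ws Sy'.
  by rewrite -(rhoU3 ws Sy) E1 (rhoU3 ws SU).
rewrite rhoU_false // in E2; have [Ey Hb] := mkpt_inj E2.
have By : on_bdry y by apply: Hb.
have cq := conf_tq ws true Hy'.
have C0 : ctot G (tq G s true y') = 0.
  have [i Ei] := By; have := bend_ge i cq; rewrite -Ey Ei => Hle.
  have be : 0 < beta R n - eps R n by rewrite subr_gt0 eps_lt_beta.
  by apply/eqP; rewrite eq_le ctot_ge0 // andbT -(pmulr_rle0 _ be).
split=> //; exists (tau (Xpoint G)).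
have := conf_c_le (Xpoint G) cq; rewrite C0 /tq inX_Xpoint /blend /= tauK.
have [y0 _] := Hy'; set u := y' _; set v := y' (Xpoint G); set r := s _.
have u0 : 0 <= u by apply: y0.
have rv0 : 0 <= r * v by apply: mulr_ge0; [apply: s0|apply: y0].
have ru0 : 0 <= (1 / 4 - r) * u by apply: mulr_ge0 => //; rewrite subr_ge0; apply: s4.
by clear -u0 rv0 ru0; move: u v r u0 rv0 ru0 => u v r; lra.
Qed.

(** Vertices lie on the common boundary of the two copies, so each is reached from both sides, with
    labels exchanged by [flip]. *)
Lemma place_vertex v : place G true (delta (flip v)) = place G false (delta v).
Proof.
rewrite place_true; have -> : (fun j => delta (flip v) (flip j)) = delta v.
  by apply/funext => j; rewrite /unit_pt (inj_eq (inv_inj (flipK G))).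
apply: mkpt_bdry; exists (tau v).
by rewrite /unit_pt tau_neq.
Qed.

Lemma delta_bdry v : on_bdry (delta v).
Proof. by exists (tau v); rewrite /unit_pt tau_neq. Qed.

Lemma run_inj w y y' : in_simplex y -> in_simplex y' -> run G s w y = run G s w y' -> y = y'.
Proof.
move=> Hy Hy' E; have := gact_code ws w Hy; rewrite E -(gact_code ws w Hy').
move=> /(congr1 (act (@rhoS R n G) (rhoU G s) (invw (code w)))).
rewrite !gact_invw //; [|exact: mkpt_Sn..].
by move=> /mkpt_inj [].
Qed.

End StepMeeting.

(** * Geodesics of the pattern crossing the base edge *)

Section Images.
Variables (T : Type).
Implicit Types (A : set T) (h : T -> T).

Lemma im_im h h' A : h @` (h' @` A) = (fun z => h (h' z)) @` A.
Proof.
apply/seteqP; split=> z; first by move=> [_ [t At <-] <-]; exists t.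
by move=> [t At <-]; exists (h' t) => //; exists t.
Qed.

Lemma im_id h A : (forall z, h z = z) -> h @` A = A.
Proof.
move=> E; apply/seteqP; split=> z; first by move=> [t At <-]; rewrite E.
by move=> Az; exists z.
Qed.
End Images.

Lemma int_unit (x y : int) : x * y = 1 -> x = 1 \/ x = -1.
Proof.
move=> E; have /eqP : (`|x| * `|y| = 1)%N by rewrite -abszM E.
by rewrite muln_eq1 => /andP[/eqP Hx _]; lia.
Qed.

(** The two matrices are involutions exchanging the same pair of points. Their product fixes
    infinity, hence is upper triangular; its diagonal entries are [e] and [e'], integers with
    product 1. *)
Lemma swap_unique (a b c a0 b0 c0 : int) : c != 0 -> c0 != 0 -> a * c0 = a0 * c ->
  - (a * a) - b * c = 1 -> - (a0 * a0) - b0 * c0 = 1 ->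
  [/\ a = a0, b = b0 & c = c0] \/ [/\ a = - a0, b = - b0 & c = - c0].
Proof.
move=> c1 c01 H H1 H2; pose e := a * a0 + b * c0; pose e' := a * a0 + b0 * c.
have E1 : e * c = - c0.
  have -> : e * c = a * (a0 * c) + b * c * c0 by rewrite /e; ring.
  rewrite -H; have -> : a * (a * c0) + b * c * c0 = (a * a + b * c) * c0 by ring.
  have -> : a * a + b * c = -1 by lia.
  by rewrite mulN1r.
have E2 : e' * c0 = - c.
  have -> : e' * c0 = a0 * (a * c0) + b0 * c0 * c by rewrite /e'; ring.
  rewrite H; have -> : a0 * (a0 * c) + b0 * c0 * c = (a0 * a0 + b0 * c0) * c by ring.
  have -> : a0 * a0 + b0 * c0 = -1 by lia.
  by rewrite mulN1r.
have E3 : e * e' = 1.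
  apply: (mulIf c01); rewrite mul1r -mulrA E2 mulrN E1 opprK //.
have [Ee|Ee] := int_unit E3; rewrite Ee in E1.
  right; have Ec : c = - c0 by lia.
  have Ea : a = - a0 by apply: (mulIf c01); rewrite H Ec; ring.
  split=> //; apply: (mulIf c1).
  have -> : b * c = b0 * c0 by move: H1; rewrite Ea; lia.
  by rewrite Ec; ring.
left; have Ec : c = c0 by lia.
have Ea : a = a0 by apply: (mulIf c01); rewrite H Ec.
split=> //; apply: (mulIf c1).
have -> : b * c = b0 * c0 by move: H1; rewrite Ea; lia.
by rewrite Ec.
Qed.

Section Pattern.
Variables (R : realType) (Gam : set (set (P1 R))).
Local Notation P1 := (P1 R).
Hypothesis HG : modular_pattern Gam.

Lemma im_geod (h : P1 -> P1) p q : h @` geod_of p q = geod_of (h p) (h q).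
Proof.
apply/seteqP; split=> z; first by move=> [t [->|->] <-]; [left|right].
by move=> [->|->]; [exists p => //; left|exists q => //; right].
Qed.

Lemma geodC (p q : P1) : geod_of p q = geod_of q p.
Proof. by apply/seteqP; split=> z [->|->]; [right|left|right|left]. Qed.

Lemma geod_two (g : set P1) z z' : is_geod g -> g z -> g z' -> z <> z' -> g = geod_of z z'.
Proof.
move=> [p [q [_ ->]]] [->|->] [->|->] // _; exact: geodC.
Qed.

Lemma gactS (g : set P1) : gact genS g = @mS R @` g.
Proof. by rewrite /gact; congr image; apply/funext => p; rewrite mob_S. Qed.
Lemma gactU (g : set P1) : gact genU g = @mU R @` g.
Proof. by rewrite /gact; congr image; apply/funext => p; rewrite mob_U. Qed.

Lemma Gam_S g : Gam g -> Gam (@mS R @` g).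
Proof. by move=> Gg; rewrite -gactS; have [_ [H _]] := HG; apply: H => //; apply: isSL_S. Qed.
Lemma Gam_U g : Gam g -> Gam (@mU R @` g).
Proof. by move=> Gg; rewrite -gactU; have [_ [H _]] := HG; apply: H => //; apply: isSL_U. Qed.

Lemma imSS (g : set P1) : @mS R @` (@mS R @` g) = g.
Proof. by rewrite im_im; apply: im_id => z; apply: mSK. Qed.
Lemma imUUU (g : set P1) : @mU R @` (@mU R @` (@mU R @` g)) = g.
Proof. by rewrite !im_im; apply: im_id => z; apply: mU3. Qed.

(** If infinity is fixed so is [t], and an integral upper triangular matrix of determinant 1 is up
    to sign a translation, hence trivial. Otherwise the two ends are exchanged and the trace
    vanishes. *)
Lemma stab_infty (A : 'M[int]_2) (t : R) : isSL A ->
  gact A (geod_of None (Some t)) = geod_of None (Some t) ->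
  psl_eq A 1%:M \/ [/\ A 1 0 != 0, (A 0 0)%:~R = t * (A 1 0)%:~R & A 1 1 = - A 0 0].
Proof.
move=> SLA HA; have Hin z : geod_of None (Some t) z -> geod_of None (Some t) (mob A z).
  by move=> Hz; rewrite -HA; exists z.
have Hsur z : geod_of None (Some t) z -> exists2 z', geod_of None (Some t) z' & mob A z' = z.
  by move=> Hz; move: (Hz); rewrite -{1}HA => -[z' Hz' E]; exists z'.
move: SLA; rewrite /isSL {1}(mx2E A) mx2_det => Hdet.
have [Hm|Hm] := Hin None (or_introl erefl).
  left; have c0 : A 1 0 = 0.
    by move: Hm; rewrite /= /ent; case: eqP => // /eqP; rewrite intr_eq0 => /eqP.
  have [z' [->|->]] := Hsur (Some t) (or_intror erefl); first by rewrite Hm.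
  rewrite /= /ent c0 mul0r add0r; case: eqP => // d0 [Ht].
  have Had : A 0 0 * A 1 1 = 1 by move: Hdet; rewrite c0 mulr0 subr0.
  have Hd : A 0 0 = A 1 1 /\ (A 0 0 = 1 \/ A 0 0 = -1).
    by have [E|E] := int_unit Had; rewrite E in Had *; split; [lia|left|lia|right].
  have b0 : A 0 1 = 0.
    have [Ea Eu] := Hd; rewrite -Ea in Ht d0.
    have : (A 0 0)%:~R * t + (A 0 1)%:~R = t * (A 0 0)%:~R.
      by rewrite -[RHS](congr1 (fun u => u * (A 0 0)%:~R) Ht) divfK //; apply/eqP.
    rewrite mulrC => /eqP; rewrite -subr_eq0 addrAC subrr add0r intr_eq0 => /eqP //.
  have [Ea Eu] := Hd; rewrite (mx2E A) mx2_1 c0 b0 -Ea.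
  by case: Eu => ->; [left|right; rewrite mx2_opp oppr0].
right; move: Hm; rewrite /= /ent; case: eqP => // /eqP c0 [Ht].
have cn : A 1 0 != 0 by move: c0; rewrite intr_eq0.
have Et : (A 0 0)%:~R = t * (A 1 0)%:~R by rewrite -Ht divfK.
have [z' [->|->]] := Hsur None (or_introl erefl); first by rewrite /= /ent (negbTE c0).
rewrite /= /ent; case: eqP => // Hd _; split=> //.
apply/eqP; rewrite -addr_eq0 -(intr_eq0 R) rmorphD /= Et mulrC addrC [X in X + _]mulrC.
by rewrite mulrC Hd.
Qed.

(** A geodesic ending at the cusp would have a stabiliser with at most two elements, the identity
    and one involution, against the assumption of an infinite one. *)
Lemma Gam_infty g : Gam g -> ~ g None.
Proof.
move=> Gg gN; have [Hgeo [_ [_ Hst]]] := HG.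
have [t Et] : exists t, g = geod_of None (Some t).
  have [p [q [pq E]]] := Hgeo g Gg; rewrite E in gN *.
  case: gN => E'; rewrite -E' in pq *.
    by case: q pq {E} => [t|//] _; exists t.
  by case: p pq {E} => [t|//] _; exists t; apply: geodC.
apply: (Hst g Gg); rewrite Et.
pose sw (A : 'M[int]_2) := [/\ isSL A, A 1 0 != 0, (A 0 0)%:~R = t * (A 1 0)%:~R & A 1 1 = - A 0 0].
have [[A0 [SL0 c0 E0 D0]]|Hno] := pselect (exists A0, sw A0); last first.
  exists [:: 1%:M] => A SLA HA; exists 1%:M; rewrite ?inE //.
  by have [//|[c E D]] := stab_infty SLA HA; case: Hno; exists A.
exists [:: 1%:M; A0] => A SLA HA; have [H|[c E D]] := stab_infty SLA HA.
  by exists 1%:M; rewrite ?inE ?eqxx.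
exists A0; first by rewrite !inE eqxx orbT.
have Ecc : A 0 0 * A0 1 0 = A0 0 0 * A 1 0.
  apply: (@intr_inj R); rewrite !rmorphM /= E E0; ring.
move: SLA SL0; rewrite /isSL {1}(mx2E A) {1}(mx2E A0) !mx2_det D D0 !mulrN => H1 H2.
rewrite (mx2E A) (mx2E A0) D D0.
by have [[-> -> ->]|[-> -> ->]] := swap_unique c c0 Ecc H1 H2; [left|right; rewrite mx2_opp].
Qed.

Lemma Gam_zero g : Gam g -> ~ g (Some 0).
Proof.
by move=> /Gam_S /Gam_infty H g0; apply: H; exists (Some 0) => //=; rewrite eqxx.
Qed.

Lemma Gam_m1 g : Gam g -> ~ g (Some (-1)).
Proof.
by move=> /Gam_U /Gam_infty H g0; apply: H; exists (Some (-1)) => //=; rewrite addNr eqxx.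
Qed.

Definition sInf : set P1 := fun z => z = None.
Definition sZero : set P1 := fun z => z = Some 0.

Lemma im_one (h : P1 -> P1) (a : P1) : h @` (fun z => z = a) = (fun z => z = h a).
Proof. by apply/seteqP; split=> z; [move=> [t -> <-]|move=> ->; exists a]. Qed.

(** The labels of the vertices. A cusp is represented by a singleton, so that the group acts on all
    labels by direct images. *)
Definition base (g : set P1) : Prop := [\/ g = sInf, g = sZero | Gam g /\ crosses_edge g].

(** A geodesic entering the triangle (0, -1, oo) through (0, oo) leaves it through (-1, oo) if q <
    -1 and through (-1, 0) otherwise; q = -1 is a cusp. With oo put in the first class and 0 in the
    second, U carries the first class onto the second. *)
Definition isXg (g : set P1) : Prop := g = sInf \/
  exists p q : R, [/\ 0 < p, q < -1 & g = geod_of (Some p) (Some q)].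
Definition isYg (g : set P1) : Prop := g = sZero \/
  exists p q : R, [/\ 0 < p, -1 < q, q < 0 & g = geod_of (Some p) (Some q)].

Lemma crossesP (g : set P1) : crosses_edge g ->
  exists p q : R, [/\ 0 < p, q < 0 & g = geod_of (Some p) (Some q)].
Proof.
move=> [p [q [pq ->]]]; have [p0|p0] := ltP 0 p.
  by exists p, q; split=> //; move: pq; rewrite pmulr_rlt0.
have q0 : 0 < q.
  rewrite ltNge; apply/negP => q0; move: pq; rewrite ltNge; apply/negP/negPn.
  exact: mulr_le0.
exists q, p; split=> //; last exact: geodC.
by move: pq; rewrite pmulr_llt0.
Qed.

Lemma crosses_intro (p q : R) : 0 < p -> q < 0 -> crosses_edge (geod_of (Some p) (Some q)).
Proof. by move=> p0 q0; exists p, q; split=> //; rewrite pmulr_rlt0. Qed.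

Lemma base_geod (p q : R) : 0 < p -> base (geod_of (Some p) (Some q)) ->
  Gam (geod_of (Some p) (Some q)).
Proof.
move=> p0 [E|E|[]//].
  have : sInf (Some p) by rewrite -E; left.
  by [].
have : sZero (Some p) by rewrite -E; left.
by move=> [Ep]; rewrite Ep ltxx in p0.
Qed.

Lemma base_XY g : base g -> isXg g \/ isYg g.
Proof.
move=> [->|->|[Gg /crossesP [p [q [p0 q0 E]]]]]; [by left; left|by right; left|].
have [qm|qm|qm] := ltgtP q (-1).
- by left; right; exists p, q.
- by right; right; exists p, q.
- by case: (Gam_m1 Gg); rewrite E qm; right.
Qed.

Lemma XY_excl g : isXg g -> isYg g -> False.
Proof.
move=> [->|[p [q [p0 q1 ->]]]] [E|[p' [q' [p0' q1' q0' E]]]].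
- have : sZero None by rewrite -E.
  by [].
- have : sInf (Some p') by rewrite E; left.
  by [].
- have : sZero (Some p) by rewrite -E; left.
  by move=> [Ep]; rewrite Ep ltxx in p0.
- have : geod_of (Some p') (Some q') (Some q) by rewrite -E; right.
  by move=> [[Eq]|[Eq]]; clear -p0 q1 p0' q1' q0' Eq; lra.
Qed.

Lemma mS_some (x : R) : x != 0 -> mS (Some x) = Some (- x^-1).
Proof. by rewrite /mS => /negbTE ->. Qed.
Lemma mU_some (x : R) : x + 1 != 0 -> mU (Some x) = Some (- (x + 1)^-1).
Proof. by rewrite /mU => /negbTE ->. Qed.
Lemma mS_zero : mS (Some (0 : R)) = None. Proof. by rewrite /mS eqxx. Qed.
Lemma mU_m1 : mU (Some (-1 : R)) = None. Proof. by rewrite /mU addNr eqxx. Qed.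

Lemma S_base g : base g -> base (@mS R @` g).
Proof.
move=> [->|->|[Gg /crossesP [p [q [p0 q0 E]]]]].
- by constructor 2; rewrite /sInf im_one.
- by constructor 1; rewrite /sZero im_one mS_zero.
- constructor 3; split; first exact: Gam_S.
  have pz : p != 0 by rewrite gt_eqF.
  have qz : q != 0 by rewrite lt_eqF.
  rewrite E im_geod (mS_some pz) (mS_some qz) geodC; apply: crosses_intro.
    by rewrite oppr_gt0 invr_lt0.
  by rewrite oppr_lt0 invr_gt0.
Qed.

Lemma U_X g : base g -> isXg g -> base (@mU R @` g) /\ isYg (@mU R @` g).
Proof.
move=> bg [E|[p [q [p0 q1 E]]]].
  by rewrite E /sInf im_one; split; [constructor 2|left].
have Gg : Gam g by rewrite E; apply: base_geod => //; rewrite -E.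
have p1 : 0 < p + 1 by lra.
have q1' : q + 1 < 0 by lra.
have EU : @mU R @` g = geod_of (Some (- (q + 1)^-1)) (Some (- (p + 1)^-1)).
  by rewrite E im_geod !mU_some ?(gt_eqF p1) ?(lt_eqF q1') // geodC.
have h1 : 0 < - (q + 1)^-1 by rewrite oppr_gt0 invr_lt0.
have h2 : - (p + 1)^-1 < 0 by rewrite oppr_lt0 invr_gt0.
have h3 : -1 < - (p + 1)^-1 by rewrite ltrN2 invf_lt1 //; lra.
split; last by right; rewrite EU; exists (- (q + 1)^-1), (- (p + 1)^-1).
by constructor 3; split; [apply: Gam_U|rewrite EU; apply: crosses_intro].
Qed.

Lemma U2_Y g : base g -> isYg g ->
  base (@mU R @` (@mU R @` g)) /\ isXg (@mU R @` (@mU R @` g)).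
Proof.
move=> bg [E|[p [q [p0 q1 q0 E]]]].
  rewrite E /sZero !im_one.
  have -> : mU (mU (Some (0 : R))) = None.
    by rewrite mU_some ?add0r ?oner_eq0 // invr1 mU_m1.
  by split; [constructor 1|left].
have Gg : Gam g by rewrite E; apply: base_geod => //; rewrite -E.
have p1 : 0 < p + 1 by lra.
have q1' : 0 < q + 1 by lra.
have pn := lt0r_neq0 p1; have qn := lt0r_neq0 q1'; have pz := lt0r_neq0 p0.
have qz : q != 0 by rewrite lt_eqF.
have Ep : - (p + 1)^-1 + 1 = p / (p + 1) by field.
have Eq : - (q + 1)^-1 + 1 = q / (q + 1) by field.
have hp : 0 < p / (p + 1) by rewrite divr_gt0.
have hq : q / (q + 1) < 0 by rewrite pmulr_llt0 // invr_gt0.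
have EU : @mU R @` (@mU R @` g) =
    geod_of (Some (- (q / (q + 1))^-1)) (Some (- (p / (p + 1))^-1)).
  rewrite E !im_geod (mU_some pn) (mU_some qn) !mU_some ?Ep ?Eq ?(gt_eqF hp) ?(lt_eqF hq) //.
  exact: geodC.
have h1 : 0 < - (q / (q + 1))^-1 by rewrite oppr_gt0 invr_lt0.
have h2 : - (p / (p + 1))^-1 < -1.
  by rewrite ltrN2 invf_div ltr_pdivlMr //; lra.
split; last by right; rewrite EU; exists (- (q / (q + 1))^-1), (- (p / (p + 1))^-1).
constructor 3; split; first by do 2!apply: Gam_U.
by rewrite EU; apply: crosses_intro => //; lra.
Qed.

End Pattern.

(** * The map from the circle to the limit set, and the family of representations *)

Section Quotient.
Variables (R : realType) (Gam : set (set (P1 R))) (k : nat).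
Local Notation P1 := (P1 R).
Local Notation J := 'I_k.+2.
Local Notation delta := (@unit_pt R k.+1).
Hypothesis HG : modular_pattern Gam.
Variable geo : 'I_k -> set P1.
Hypothesis geo_inj : injective geo.
Hypothesis geo_in : forall i, Gam (geo i) /\ crosses_edge (geo i).
Hypothesis geo_all : forall g, Gam g -> crosses_edge g -> exists i, geo i = g.

(* The vertices of the simplex are indexed by the cusps [oo] and [0] of the edge, followed by the
   geodesics crossing it. *)
Definition jinf : J := ord0.
Definition jzero : J := lift ord0 ord0.
Definition lab (j : J) : set P1 :=
  match unlift ord0 j with
  | None => @sInf R
  | Some j' => match unlift ord0 j' with None => @sZero R | Some i => geo i end
  end.

Lemma lab_inf : lab jinf = @sInf R.
Proof. by rewrite /lab /jinf unlift_none. Qed.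

Lemma lab_zero : lab jzero = @sZero R.
Proof. by rewrite /lab /jzero liftK unlift_none. Qed.

Lemma lab_geo i : lab (lift ord0 (lift ord0 i)) = geo i.
Proof. by rewrite /lab !liftK. Qed.

Lemma labP (j : J) : [\/ j = jinf, j = jzero | exists i : 'I_k, j = lift ord0 (lift ord0 i)].
Proof.
case: (unliftP ord0 j) => [j' ->|->]; last by constructor 1.
by case: (unliftP ord0 j') => [i ->|->]; [constructor 3; exists i|constructor 2].
Qed.

Lemma lab_base j : base Gam (lab j).
Proof.
have [->|->|[i ->]] := labP j.
- by rewrite lab_inf; constructor 1.
- by rewrite lab_zero; constructor 2.
- by rewrite lab_geo; constructor 3; apply: geo_in.
Qed.

Lemma base_lab g : base Gam g -> exists j, lab j = g.
Proof.
move=> [->|->|[Gg cg]]; [by exists jinf; apply: lab_inf|by exists jzero; apply: lab_zero|].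
have [i Ei] := geo_all Gg cg.
by exists (lift ord0 (lift ord0 i)); rewrite lab_geo.
Qed.

Lemma lab_inj : injective lab.
Proof.
have H1 : @sInf R <> @sZero R.
  move=> E; have : @sZero R None by rewrite -E.
  by [].
have H2 i : geo i <> @sInf R.
  by move=> E; apply: (Gam_infty HG (proj1 (geo_in i))); rewrite E.
have H3 i : geo i <> @sZero R.
  by move=> E; apply: (Gam_zero HG (proj1 (geo_in i))); rewrite E.
move=> j j'; have [->|->|[i ->]] := labP j; have [->|->|[i' ->]] := labP j';
  rewrite ?lab_inf ?lab_zero ?lab_geo => E //;
  by [case: (H1 E)|case: (H1 (esym E))|case: (H2 _ E)|case: (H2 _ (esym E))
     |case: (H3 _ E)|case: (H3 _ (esym E))|rewrite (geo_inj E)].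
Qed.

Lemma gluing_exists : exists G : gluing k.+1,
  [/\ forall j, inX G j <-> isXg (lab j), forall j, lab (flip G j) = @mS R @` lab j &
      forall j, inX G j -> lab (tau G j) = @mU R @` lab j].
Proof.
have Hf j : exists j', lab j' = @mS R @` lab j.
  by apply: base_lab; apply: (S_base HG); apply: lab_base.
have [fl Hfl] := choice Hf.
have Ht j : exists j', if `[<isXg (lab j)>] then lab j' = @mU R @` lab j
    else lab j' = @mU R @` (@mU R @` lab j).
  have bj := lab_base j; case: asboolP => HX; apply: base_lab.
    by have [] := U_X HG bj HX.
  have HY : isYg (lab j) by have [] := base_XY HG bj.
  by have [] := U2_Y HG bj HY.
have [ta Hta] := choice Ht.
have HtX j : isXg (lab j) -> lab (ta j) = @mU R @` lab j.
  by move=> HX; have := Hta j; rewrite (asboolT HX).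
have HtY j : ~ isXg (lab j) -> lab (ta j) = @mU R @` (@mU R @` lab j).
  by move=> HX; have := Hta j; rewrite (asboolF HX).
have XX j : isXg (lab j) -> ~ isXg (lab (ta j)).
  move=> HX HX'; rewrite (HtX _ HX) in HX'.
  by have [_ HY] := U_X HG (lab_base j) HX; apply: (XY_excl HX' HY).
have XY j : ~ isXg (lab j) -> isXg (lab (ta j)).
  move=> HX; rewrite (HtY _ HX).
  have HY : isYg (lab j) by have [] := base_XY HG (lab_base j).
  by have [] := U2_Y HG (lab_base j) HY.
have tK : involutive ta.
  move=> j; apply: lab_inj; have [HX|HX] := pselect (isXg (lab j)).
    by rewrite (HtY _ (XX _ HX)) (HtX _ HX) imUUU.
  by rewrite (HtX _ (XY _ HX)) (HtY _ HX) imUUU.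
have tX j : `[<isXg (lab (ta j))>] = ~~ `[<isXg (lab j)>].
  have [HX|HX] := pselect (isXg (lab j)).
    by rewrite (asboolT HX) (asboolF (XX _ HX)).
  by rewrite (asboolF HX) (asboolT (XY _ HX)).
have fK : involutive fl by move=> j; apply: lab_inj; rewrite !Hfl imSS.
exists (@Gluing k.+1 ta (fun j => `[<isXg (lab j)>]) fl tK tX fK).
by split=> /= j; [split=> /asboolP|exact: Hfl|move=> /asboolP /HtX].
Qed.

Variable G : gluing k.+1.
Hypothesis GX : forall j, inX G j <-> isXg (lab j).
Hypothesis GS : forall j, lab (flip G j) = @mS R @` lab j.
Hypothesis GU : forall j, inX G j -> lab (tau G j) = @mU R @` lab j.

Lemma lab_tauY j : ~~ inX G j -> lab (tau G j) = @mU R @` (@mU R @` lab j).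
Proof.
move=> NX; have Xt : inX G (tau G j) by rewrite inX_tau.
by have := GU Xt; rewrite tauK => ->; rewrite imUUU.
Qed.

(** The label [sgi v] is the preimage of [v] under S U or S U U, according to its class. Thus the
    itinerary of a vertex is the cutting sequence of its geodesic. *)
Lemma lab_step v : lab v = tm (inX G (sgi G v)) @` lab (sgi G v).
Proof.
have -> : lab v = @mS R @` lab (tau G (sgi G v)) by rewrite -GS /sgi tauK flipK.
case Xu: (inX G (sgi G v)).
  by rewrite (GU Xu) im_im.
by rewrite lab_tauY ?Xu // !im_im.
Qed.

Lemma pe_exists v : exists p,
  [/\ nonneg p, lab v p & forall q, nonneg q -> lab v q -> q = p].
Proof.
have [->|->|[Gg /crossesP [p [q [p0 q0 ->]]]]] := lab_base v.
- by exists None.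
- by exists (Some 0); split=> //=.
- exists (Some p); split; [exact: ltW|by left|move=> z Hz [//|Ez]].
  by move: Hz; rewrite Ez /= leNgt q0.
Qed.

Definition pe v : P1 := sval (cid (pe_exists v)).

Lemma pe_nonneg v : nonneg (pe v).
Proof. by rewrite /pe; case: cid => p []. Qed.
Lemma pe_lab v : lab v (pe v).
Proof. by rewrite /pe; case: cid => p []. Qed.
Lemma pe_uniq v q : nonneg q -> lab v q -> q = pe v.
Proof. by rewrite /pe; case: cid => p [_ _ H] /=; apply: H. Qed.

Lemma pe_step v : pe v = tm (inX G (sgi G v)) (pe (sgi G v)).
Proof.
apply/esym/pe_uniq; first by apply: tm_nonneg; apply: pe_nonneg.
by rewrite lab_step; exists (pe (sgi G v)) => //; apply: pe_lab.
Qed.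

Lemma nonneg_or_S (z : P1) : nonneg z \/ nonneg (mS z).
Proof.
case: z => [x|]; last by left.
have [x0|x0] := leP 0 x; first by left.
have xz : x != 0 by rewrite lt_eqF.
by right; rewrite (mS_some xz) /= oppr_ge0 invr_le0 ltW.
Qed.

Lemma nonneg_both (z : P1) : nonneg z -> nonneg (mS z) -> z = None \/ z = Some 0.
Proof.
case: z => [x|] /=; last by left.
case: eqP => [->|x0] h; first by right.
rewrite /= oppr_ge0 invr_le0 => h'; right; congr Some; apply/eqP.
by rewrite eq_le h h'.
Qed.

(** The non-positive end is obtained by S from the non-negative end of the flipped label; for a cusp
    the two ends coincide. *)
Lemma lab_mem v : lab v = geod_of (pe v) (mS (pe (flip G v))).
Proof.
apply/seteqP; split=> z.
  move=> Lz; have [h|h] := nonneg_or_S z; first by left; apply: pe_uniq.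
  right; rewrite -(@pe_uniq (flip G v) (mS z)) ?mSK //.
  by rewrite GS; exists z.
move=> [->|->]; first exact: pe_lab.
have -> : lab v = @mS R @` lab (flip G v) by rewrite -GS flipK.
by exists (pe (flip G v)) => //; apply: pe_lab.
Qed.

Definition itin v (i : nat) : bool := inX G (iter i.+1 (sgi G) v).

Lemma adm_pe c v : (forall i, c i = inX G (iter i.+1 (sgi G) v)) -> adm c (pe v).
Proof.
move=> Hc i; exists (pe (iter i (sgi G) v)); first exact: pe_nonneg.
elim: i => [//|i IH]; rewrite mkseq_rcons -cats1 tmw_cat {}IH.
suff -> : pe (iter i (sgi G) v) = tm (c i) (pe (iter i.+1 (sgi G) v)) by [].
by rewrite [LHS]pe_step Hc.
Qed.

Lemma adm_itin v : adm (itin v) (pe v).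
Proof. exact: adm_pe. Qed.

(** The itinerary is the path of the non-negative end, which it determines. By periodicity it also
    determines the itinerary in the opposite direction, which is up to negation the path of the end
    of the flipped label; so both ends are known. *)
Lemma separated_lab : separated G.
Proof.
move=> v v' Hv; have [L L0 HL] := sgi_period G.
have Hsig u : sig G u = iter L.-1 (sgi G) u.
  have E : u = sgi G (iter L.-1 (sgi G) u) by rewrite -iterS prednK ?HL.
  by rewrite {1}E sgiK.
have Hit i u : iter i (sig G) u = iter (i * L.-1 + L) (sgi G) u.
  rewrite iterD HL; elim: i => [//|i IH].
  by rewrite iterS IH Hsig mulSn iterD.
have Hm i : inX G (iter i (sig G) v) = inX G (iter i (sig G) v').
  rewrite !Hit; have -> : (i * L.-1 + L = (i * L.-1 + L.-1).+1)%N by lia.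
  exact: Hv.
have Hf i u : inX G (iter i.+1 (sgi G) (flip G u)) = ~~ inX G (iter i (sig G) u).
  suff -> : iter i.+1 (sgi G) (flip G u) = tau G (iter i (sig G) u) by rewrite inX_tau.
  elim: i => [|i IH]; first by rewrite /= /sgi flipK.
  by rewrite iterS IH.
have E1 : pe v = pe v'.
  have Ei : itin v = itin v' by apply/funext => i; exact: Hv.
  by apply: (adm_uniq (adm_itin v)); rewrite Ei; apply: adm_itin.
have E2 : pe (flip G v) = pe (flip G v').
  have Ei : itin (flip G v) = itin (flip G v').
    by apply/funext => i; rewrite /itin !Hf Hm.
  by apply: (adm_uniq (adm_itin (flip G v))); rewrite Ei; apply: adm_itin.
by apply: lab_inj; rewrite !lab_mem E1 E2.
Qed.

(** The factor 1/4 brings the weight into the range that [weights] requires; the value 0 off the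
    pattern is the weight of the cusps. *)
Definition gwt (f : set P1 -> R) (g : set P1) : R := if `[<Gam g>] then (1 - f g) / 4 else 0.
Definition sw (f : set P1 -> R) (j : J) : R := gwt f (lab j).

Lemma gwt_S f g : box Gam f -> gwt f (@mS R @` g) = gwt f g.
Proof.
move=> [_ Hf]; rewrite /gwt; case: asboolP => [G1|N1]; case: asboolP => [G2|N2] //.
- by rewrite -gactS Hf //; apply: isSL_S.
- by case: N2; rewrite -(imSS g); apply: (Gam_S HG).
- by case: N1; apply: (Gam_S HG).
Qed.

Lemma gwt_U f g : box Gam f -> gwt f (@mU R @` g) = gwt f g.
Proof.
move=> [_ Hf]; rewrite /gwt; case: asboolP => [G1|N1]; case: asboolP => [G2|N2] //.
- by rewrite -gactU Hf //; apply: isSL_U.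
- by case: N2; rewrite -(imUUU g); do 2!apply: (Gam_U HG).
- by case: N1; apply: (Gam_U HG).
Qed.

Lemma gwt_bounds f g : box Gam f -> 0 <= gwt f g <= 1 / 4.
Proof.
move=> [Hf _]; rewrite /gwt; case: asboolP => [/Hf /andP[h0 h1]|_]; apply/andP; split; lra.
Qed.

Lemma weights_sw f : box Gam f -> weights G (sw f).
Proof.
move=> bf; split=> j.
- by have /andP[] := gwt_bounds (lab j) bf.
- by have /andP[] := gwt_bounds (lab j) bf.
- rewrite /sw; have [Xj|NX] := boolP (inX G j); first by rewrite (GU Xj) gwt_U.
  by rewrite (lab_tauY NX) !gwt_U.
- by rewrite /sw GS gwt_S.
Qed.

Lemma sw_inf f : sw f jinf = 0.
Proof. by rewrite /sw lab_inf /gwt; case: asboolP => // /(Gam_infty HG) []. Qed.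
Lemma sw_zero f : sw f jzero = 0.
Proof. by rewrite /sw lab_zero /gwt; case: asboolP => // /(Gam_zero HG) []. Qed.

Lemma cusp_sw f : exists v, sw f v = 0.
Proof. by exists jinf; apply: sw_inf. Qed.

Lemma gwt_eq0 f g : Gam g -> gwt f g = 0 <-> f g = 1.
Proof. by move=> Gg; rewrite /gwt (asboolT Gg); split=> E; lra. Qed.

Lemma gwt_dist f g d l : 0 < d -> (forall gam, Gam gam -> `|f gam - g gam| < d) ->
  `|gwt f l - gwt g l| <= d.
Proof.
move=> d0 H; rewrite /gwt; case: asboolP => [/H|_]; last by rewrite subrr normr0 ltW.
by rewrite ltr_norml ler_norml => /andP[h1 h2]; apply/andP; split; lra.
Qed.

Lemma inX_inf : inX G jinf.
Proof. by apply/GX; rewrite lab_inf; left. Qed.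

Lemma tau_inf : tau G jinf = jzero.
Proof. by apply: lab_inj; rewrite (GU inX_inf) lab_inf lab_zero /sInf im_one. Qed.

Lemma flip_inf : flip G jinf = jzero.
Proof. by apply: lab_inj; rewrite GS lab_inf lab_zero /sInf im_one. Qed.

Lemma itin_inf i : inX G (iter i.+1 (sgi G) jinf) = true.
Proof.
have -> : iter i.+1 (sgi G) jinf = jinf; last exact: inX_inf.
by elim: i.+1 => [//|m IH]; rewrite iterS IH /sgi flip_inf -tau_inf tauK.
Qed.

Lemma itin_zero i : inX G (iter i.+1 (sgi G) jzero) = false.
Proof.
have -> : iter i.+1 (sgi G) jzero = jzero; last by rewrite -tau_inf inX_tau inX_inf.
by elim: i.+1 => [//|m IH]; rewrite iterS IH /sgi -{1}flip_inf flipK tau_inf.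
Qed.

Definition og (o : bool) (p : P1) : P1 := if o then mS p else p.

Lemma ogK o : involutive (og o).
Proof. by case: o => p //=; rewrite /og mSK. Qed.

Lemma cdist_og o p q : cdist (og o p) (og o q) = cdist p q.
Proof. by case: o => //=; apply: cdist_S. Qed.

Lemma adm_nonneg c (p : P1) : adm c p -> nonneg p.
Proof. by move=> H; exact: arc_nonneg (H 0%N). Qed.

Lemma place_inj o (y y' : J -> R) : place G o y = place G o y' -> y = y'.
Proof.
case: o; last by rewrite /place => /mkpt_inj [].
rewrite !place_true => /mkpt_inj [E _].
by apply/funext => j; have := congr1 (fun h => h (flip G j)) E; rewrite /= !flipK.
Qed.

Section FixedWeights.
Variable f : set P1 -> R.
Hypothesis bf : box Gam f.
Local Notation s := (sw f).
Local Notation xi := (xi G s).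
Local Notation run := (run G s).
Local Notation step := (step G s).
Local Notation L1 := (level1 Gam f).

Let ws : weights G s. Proof. exact: weights_sw. Qed.
Let sep : separated G. Proof. exact: separated_lab. Qed.
Let cusp : exists v, s v = 0. Proof. exact: cusp_sw. Qed.
Let xi_in c : in_simplex (xi c). Proof. exact: xi_simplex. Qed.

Lemma sw_tau v : s v = 0 -> s (tau G v) = 0.
Proof. by have [_ _ H _] := ws; rewrite H. Qed.
Lemma sw_flip v : s v = 0 -> s (flip G v) = 0.
Proof. by have [_ _ _ H] := ws; rewrite H. Qed.

Lemma xi_zero c : adm c (Some 0 : P1) -> xi c = delta jzero.
Proof.
move=> /adm_zero Hc; apply: xi_vertex => // [|i]; first exact: sw_zero.
by rewrite Hc itin_zero.
Qed.

Lemma xi_infty c : adm c (None : P1) -> xi c = delta jinf.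
Proof.
move=> /adm_infty Hc; apply: xi_vertex => // [|i]; first exact: sw_inf.
by rewrite Hc itin_inf.
Qed.

Lemma adm_head d (q : P1) : adm d q -> exists2 r, adm (shift d 1) r & q = tm (d 0%N) r.
Proof. by move=> Hd; have [r Ar Er] := adm_shift 1 Hd; exists r. Qed.

(** By [tm_meet] the common point is 1, with tails the cusps 0 and oo; these are sent to the
    vertices [jzero] and [jinf], which meet by [step_meet]. *)
Lemma xi_adm0 d d' (q : P1) : adm d q -> adm d' q -> d 0%N = true -> d' 0%N = false ->
  xi d = xi d'.
Proof.
move=> Hd Hd' E E'; have [r Ar Er] := adm_head Hd; have [r' Ar' Er'] := adm_head Hd'.
rewrite E in Er; rewrite E' in Er'.
have [r0 r0'] : r = Some 0 /\ r' = None.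
  by apply: tm_meet; [exact: adm_nonneg Ar|exact: adm_nonneg Ar'|rewrite -Er -Er'].
rewrite r0 in Ar; rewrite r0' in Ar'.
rewrite (xi_step ws sep cusp d) (xi_step ws sep cusp d') E E' (xi_zero Ar) (xi_infty Ar').
by rewrite -tau_inf; apply: (step_meet ws inX_inf (sw_inf f)).
Qed.

(** Distinct paths are cut at their first difference, since both [tmw] and [run] are injective along
    the common prefix; only the case of different first bits then has to be examined. *)
Lemma paths_split c c' (z z' : P1) : adm c z -> adm c' z' -> c <> c' ->
  exists w d d' q q', [/\ adm d q, adm d' q', d 0%N != d' 0%N,
    z = tmw w q /\ z' = tmw w q' & xi c = run w (xi d) /\ xi c' = run w (xi d')].
Proof.
move=> Hc Hc' cc; have ex : exists i, c i != c' i.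
  apply: contrapT => H; apply: cc; apply/funext => i; apply/eqP; apply: contraT => Hi.
  by case: H; exists i.
case: (ex_minnP ex) => i Hi Hmin.
have Em : mkseq c i = mkseq c' i.
  apply: (@eq_from_nth _ false); rewrite !size_mkseq // => j ji.
  by rewrite !nth_mkseq //; apply/eqP; apply: contraT => /Hmin; rewrite leqNgt ji.
have [q Aq Eq] := adm_shift i Hc; have [q' Aq' Eq'] := adm_shift i Hc'.
exists (mkseq c i), (shift c i), (shift c' i), q, q'; split=> //.
- by rewrite /shift addn0.
- by split=> //; rewrite Em.
- by split; [apply: xi_run|rewrite Em; apply: xi_run].
Qed.

Lemma xi_adm c c' (p : P1) : adm c p -> adm c' p -> xi c = xi c'.
Proof.
move=> Hc Hc'; have [->//|cc] := pselect (c = c').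
have [w [d [d' [q [q' [Aq Aq' dd [Ez Ez'] [-> ->]]]]]]] := paths_split Hc Hc' cc.
have qq : q' = q by apply: (@tmw_inj R w); rewrite -Ez -Ez'.
rewrite qq in Aq'; suff -> : xi d = xi d' by [].
case Ed: (d 0%N) dd; case Ed': (d' 0%N) => // _; first exact: (xi_adm0 Aq Aq' Ed Ed').
by rewrite (xi_adm0 Aq' Aq Ed' Ed).
Qed.

Lemma xi_pe c v : s v = 0 -> adm c (pe v) -> xi c = delta v.
Proof. by move=> sv Ac; rewrite (xi_adm Ac (adm_itin v)); apply: xi_vertex. Qed.

Definition phi (p : P1) : spt R k.+1 :=
  if `[<nonneg p>] then place G false (xi (sbpath p)) else place G true (xi (sbpath (mS p))).

(** The value depends neither on the path nor on the side: only 0 and oo lie on both sides, and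
    there the limit is a vertex shared by the two copies. *)
Lemma phi_adm o c p : adm c (og o p) -> phi p = place G o (xi c).
Proof.
move=> Hc; rewrite /phi; have np := adm_nonneg Hc; case: asboolP => Hp; last first.
  case: o Hc np => Hc np //=; rewrite (xi_adm (adm_path np) Hc) //.
case: o Hc np => Hc np; last by rewrite (xi_adm (adm_path np) Hc).
have [E|E] := nonneg_both Hp np; rewrite E in Hc Hp *.
  have -> : xi (sbpath (None : P1)) = delta jinf by apply: xi_infty; apply: adm_path.
  rewrite (xi_zero Hc) -flip_inf; exact/esym/place_vertex.
have -> : xi (sbpath (Some 0 : P1)) = delta jzero by apply: xi_zero; apply: adm_path.
rewrite /og mS_zero in Hc; rewrite (xi_infty Hc).
have -> : jinf = flip G jzero by rewrite -flip_inf flipK.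
exact/esym/place_vertex.
Qed.

Lemma phi_rep p : exists o c, adm c (og o p).
Proof.
have [h|h] := nonneg_or_S p.
  by exists false, (sbpath p); apply: adm_path.
by exists true, (sbpath (mS p)); apply: adm_path.
Qed.

Lemma phi_Lam p : Lam G s (phi p).
Proof. by have [o [c Hc]] := phi_rep p; exists o, c; apply: phi_adm. Qed.

Lemma phi_Sn p : Sn (phi p).
Proof.
by have [o [c Hc]] := phi_rep p; rewrite (phi_adm Hc); apply: place_Sn.
Qed.

Lemma phi_onto q : Lam G s q -> exists p, phi p = q.
Proof.
move=> [o [c ->]]; have [z Hz] := adm_exists R c.
by exists (og o z); apply: phi_adm; rewrite ogK.
Qed.

Lemma level1_S g : L1 g -> L1 (@mS R @` g).
Proof.
move=> [Gg fg]; split; first exact: (Gam_S HG).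
by rewrite -gactS; have [_ Hf] := bf; rewrite Hf //; apply: isSL_S.
Qed.

Lemma level1_U g : L1 g -> L1 (@mU R @` g).
Proof.
move=> [Gg fg]; split; first exact: (Gam_U HG).
by rewrite -gactU; have [_ Hf] := bf; rewrite Hf //; apply: isSL_U.
Qed.

Lemma pat_S p q : pat_rel L1 p q -> pat_rel L1 (mS p) (mS q).
Proof.
move=> [->|[g [Lg [pq Eg]]]]; first by left.
right; exists (@mS R @` g); split; first exact: level1_S.
by split; [move=> /mS_inj|rewrite Eg im_geod].
Qed.

Lemma pat_U p q : pat_rel L1 p q -> pat_rel L1 (mU p) (mU q).
Proof.
move=> [->|[g [Lg [pq Eg]]]]; first by left.
right; exists (@mU R @` g); split; first exact: level1_U.
by split; [move=> /mU_inj|rewrite Eg im_geod].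
Qed.

Lemma pat_sym p q : pat_rel L1 p q -> pat_rel L1 q p.
Proof.
move=> [->|[g [Lg [pq Eg]]]]; first by left.
by right; exists g; split=> //; split; [move=> E; apply: pq|rewrite geodC].
Qed.

Lemma pat_tm b p q : pat_rel L1 p q -> pat_rel L1 (tm b p) (tm b q).
Proof.
by case: b => H; rewrite /tm; apply: pat_S; apply: pat_U => //; apply: pat_U.
Qed.

Lemma pat_untm b p q : pat_rel L1 (tm b p) (tm b q) -> pat_rel L1 p q.
Proof.
rewrite /tm; case: b => /pat_S; rewrite !mSK; first by move=> /pat_U /pat_U; rewrite !mU3.
by move=> /pat_U; rewrite !mU3.
Qed.

Lemma pat_tmw w p q : pat_rel L1 p q -> pat_rel L1 (tmw w p) (tmw w q).
Proof. by move=> H; elim: w => [//|b w IH]; exact: (pat_tm b IH). Qed.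

Lemma pat_untmw w p q : pat_rel L1 (tmw w p) (tmw w q) -> pat_rel L1 p q.
Proof. by elim: w => [//|b w IH] H; apply: IH; exact: (pat_untm (b := b) H). Qed.

Lemma lab_pat v z z' : s v = 0 -> lab v z -> lab v z' -> pat_rel L1 z z'.
Proof.
move=> sv Hz Hz'; have [E|E|[Gv cv]] := lab_base v.
- have Ez : z = None by move: Hz; rewrite E.
  have Ez' : z' = None by move: Hz'; rewrite E.
  by left; rewrite Ez Ez'.
- have Ez : z = Some 0 by move: Hz; rewrite E.
  have Ez' : z' = Some 0 by move: Hz'; rewrite E.
  by left; rewrite Ez Ez'.
- have [->|zz] := pselect (z = z'); first by left.
  right; exists (lab v); split; first by split=> //; apply/(gwt_eq0 f Gv).
  by split=> //; apply: geod_two => //; have [H _] := HG; apply: H.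
Qed.

(** By [step_eq] and [xi_bdry] both tails are vertices of weight 0, namely some [v'] and [tau v'].
    Their non-negative ends, moved by U U for the second, are both on the label [v'], hence paired
    by a geodesic with f = 1 or equal. *)
Lemma xi_inj0 d d' (q q' : P1) : adm d q -> adm d' q' -> d 0%N = true -> d' 0%N = false ->
  xi d = xi d' -> pat_rel L1 q q'.
Proof.
move=> Hd Hd' E E' Exi; have [r Ar Er] := adm_head Hd; have [r' Ar' Er'] := adm_head Hd'.
rewrite E in Er; rewrite E' in Er'.
move: Exi; rewrite (xi_step ws sep cusp d) (xi_step ws sep cusp d') E E' => Exi.
have [By By' _ C0] := step_eq ws (xi_in _) (xi_in _) Exi.
have [v [sv Ev iv]] := xi_bdry ws sep cusp By.
have [v' [sv' Ev' iv']] := xi_bdry ws sep cusp By'.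
have Xv' : inX G v'.
  move: C0; rewrite Ev' ctot_tq_delta //; case: (inX G v') => //=; rewrite sv' subr0.
  by move=> /eqP; rewrite oner_eq0.
have Ev2 : v = tau G v'.
  suff /delta_inj : delta v = delta (tau G v') by [].
  apply: (run_inj ws (w := [:: true])); [exact: delta_simp..|].
  by rewrite /= (step_meet ws Xv' sv') -Ev -Ev'.
have Hr : r = pe (tau G v') by rewrite -Ev2; apply: (adm_uniq Ar); apply: adm_pe.
have Hr' : r' = pe v' by apply: (adm_uniq Ar'); apply: adm_pe.
have Lt : lab v' (mU (mU (pe (tau G v')))).
  have NX : ~~ inX G (tau G v') by rewrite inX_tau Xv'.
  have := lab_tauY NX; rewrite tauK => ->.
  exists (mU (pe (tau G v'))) => //; exists (pe (tau G v')) => //; exact: pe_lab.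
have Et : tm true (pe (tau G v')) = tm false (mU (mU (pe (tau G v')))) by rewrite /tm mU3.
rewrite Er Er' Hr Hr' Et; apply: pat_tm; apply: (lab_pat sv') => //; exact: pe_lab.
Qed.

Lemma xi_inj c c' (z z' : P1) : adm c z -> adm c' z' -> xi c = xi c' -> pat_rel L1 z z'.
Proof.
move=> Hc Hc'; have [E _|cc] := pselect (c = c').
  by left; rewrite E in Hc; exact: adm_uniq Hc Hc'.
have [w [d [d' [q [q' [Aq Aq' dd [-> ->] [-> ->]]]]]]] := paths_split Hc Hc' cc.
move=> /(run_inj ws (xi_in _) (xi_in _)) E; apply: pat_tmw.
case Ed: (d 0%N) dd; case Ed': (d' 0%N) => // _; first exact: (xi_inj0 Aq Aq' Ed Ed' E).
by apply: pat_sym; exact: (xi_inj0 Aq' Aq Ed' Ed (esym E)).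
Qed.

(** The two copies meet only on the boundary, so the common point is a vertex of weight 0, and the
    two points of the circle are the two ends of its label. *)
Lemma cross_inj c c' p p' : adm c p -> adm c' (mS p') ->
  place G false (xi c) = place G true (xi c') -> pat_rel L1 p p'.
Proof.
move=> Hc Hc' E.
have B1 : on_bdry (xi c).
  by move: E; rewrite place_true /place => /mkpt_inj [_ Hb]; apply: Hb.
have [v [sv Ev iv]] := xi_bdry ws sep cusp B1.
have E2 : xi c' = delta (flip G v).
  by apply: (@place_inj true); rewrite place_vertex -Ev -E.
have B2 : on_bdry (xi c') by rewrite E2; exact: (@delta_bdry R k.+1 G).
have [v' [sv' Ev' iv']] := xi_bdry ws sep cusp B2.
have Evv : flip G v = v' by move: Ev'; rewrite E2 => /delta_inj.
have Hp : p = pe v by apply: (adm_uniq Hc); apply: adm_pe.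
have Hp' : mS p' = pe (flip G v) by rewrite Evv; apply: (adm_uniq Hc'); apply: adm_pe.
have -> : p' = mS (pe (flip G v)) by rewrite -Hp' mSK.
rewrite Hp; apply: (lab_pat sv); first exact: pe_lab.
by rewrite lab_mem; right.
Qed.

(** The conclusion is the relation itself and not the equivalence it generates: at most two points
    of the circle are ever identified in a single step. *)
Lemma phi_inj p p' : phi p = phi p' -> pat_rel L1 p p'.
Proof.
have [o [c Hc]] := phi_rep p; have [o' [c' Hc']] := phi_rep p'.
rewrite (phi_adm Hc) (phi_adm Hc'); case: o Hc; case: o' Hc' => Hc' Hc E.
- by have := pat_S (xi_inj Hc Hc' (place_inj E)); rewrite /og !mSK.
- by apply: pat_sym; exact: (cross_inj Hc' Hc (esym E)).
- exact: (cross_inj Hc Hc' E).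
- exact: (xi_inj Hc Hc' (place_inj E)).
Qed.

Lemma lab_phi v z : s v = 0 -> lab v z -> phi z = place G false (delta v).
Proof.
move=> sv; rewrite lab_mem => -[->|->].
  have A := adm_itin v; rewrite (@phi_adm false (itin v)) //; congr place; exact: xi_pe.
have A := adm_itin (flip G v).
rewrite (@phi_adm true (itin (flip G v))); last by rewrite /og mSK.
by rewrite (xi_pe (sw_flip sv) A) place_vertex.
Qed.

(** Undoing [tm true], the geodesic joins r > 0 to U r' in [-1, 0). It therefore crosses the base
    edge and is the label of a vertex [v] of weight 0 in the second class; the tails are the
    vertices [v] and [tau v], which meet by [step_meet]. *)
Lemma same_side0 d d' (q q' : P1) : adm d q -> adm d' q' -> d 0%N = true -> d' 0%N = false ->
  L1 (geod_of q q') -> q <> q' -> xi d = xi d'.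
Proof.
move=> Hd Hd' E E' Lg qq; have [r Ar Er] := adm_head Hd; have [r' Ar' Er'] := adm_head Hd'.
rewrite E in Er; rewrite E' in Er'.
have r0 := adm_nonneg Ar; have r0' := adm_nonneg Ar'.
have Lr : L1 (geod_of r (mU r')).
  have Et : tm true (mU r') = tm false r' by [].
  have : pat_rel L1 (tm true r) (tm true (mU r')).
    by rewrite Et -Er -Er'; right; exists (geod_of q q').
  move=> /pat_untm [Erq|[g [Lg' [_ <-]]]] //.
  by case: qq; rewrite Er Er' Erq.
have [Gr fr] := Lr.
have rN : r <> None by move=> Er0; apply: (Gam_infty HG Gr); rewrite Er0; left.
have rZ : r <> Some 0 by move=> Er0; apply: (Gam_zero HG Gr); rewrite Er0; left.
have rN' : r' <> None by move=> Er0; apply: (Gam_zero HG Gr); rewrite Er0; right.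
have [a Ea a0] : exists2 a, r = Some a & 0 < a.
  clear -r0 rN rZ; case: r r0 rN rZ => [a|] //= a0 _ aZ; exists a => //.
  by rewrite lt_neqAle a0 andbT; apply/eqP => E0; apply: aZ; rewrite -E0.
have [x Ex x0] : exists2 x, r' = Some x & 0 <= x.
  by clear -r0' rN'; case: r' r0' rN' => [x|] //= x0 _; exists x.
have x1 : 0 < x + 1 by rewrite ltr_wpDl.
have EU : mU r' = Some (- (x + 1)^-1) by rewrite Ex (mU_some (lt0r_neq0 x1)).
have y0 : - (x + 1)^-1 < 0 by rewrite oppr_lt0 invr_gt0.
have y1 : -1 <= - (x + 1)^-1 by rewrite lerN2 invf_le1 // lerDr.
have Elr : geod_of r (mU r') = geod_of (Some a) (Some (- (x + 1)^-1)) by rewrite Ea EU.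
have [v Ev] : exists v, lab v = geod_of r (mU r').
  by apply: base_lab; constructor 3; split=> //; rewrite Elr; exact: crosses_intro.
have sv : s v = 0 by rewrite /sw Ev; apply/(gwt_eq0 f Gr).
have NX : ~~ inX G v.
  apply/negP => /GX; rewrite Ev Elr => -[E0|[p [q0 [p0 q1 E0]]]].
    have : sInf (Some a) by rewrite -E0; left.
    by [].
  have : geod_of (Some a) (Some (- (x + 1)^-1)) (Some q0) by rewrite E0; right.
  move=> [[Eq]|[Eq]]; rewrite Eq in q1.
    by have := lt_trans a0 q1; rewrite ltr0N1.
  by move: q1; rewrite ltNge y1.
have Er1 : r = pe v by apply: pe_uniq => //; rewrite Ev; left.
have Er2 : r' = pe (tau G v).
  by apply: pe_uniq => //; rewrite (lab_tauY NX) Ev !im_geod; right; rewrite mU3.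
rewrite Er1 in Ar; rewrite Er2 in Ar'.
have Xt : inX G (tau G v) by rewrite inX_tau.
have st := sw_tau sv.
rewrite (xi_step ws sep cusp d) (xi_step ws sep cusp d') E E' (xi_pe sv Ar) (xi_pe st Ar').
by have := step_meet ws Xt st; rewrite tauK.
Qed.

Lemma same_side c c' (z z' : P1) : adm c z -> adm c' z' -> L1 (geod_of z z') -> z <> z' ->
  xi c = xi c'.
Proof.
move=> Hc Hc' Lg zz; have cc : c <> c'.
  by move=> E; apply: zz; rewrite E in Hc; exact: adm_uniq Hc Hc'.
have [w [d [d' [q [q' [Aq Aq' dd [Ez Ez'] [-> ->]]]]]]] := paths_split Hc Hc' cc.
have : pat_rel L1 q q'.
  by apply: (@pat_untmw w); rewrite -Ez -Ez'; right; exists (geod_of z z').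
move=> [E|[g [Lg' [qq Eg]]]]; first by case: zz; rewrite Ez Ez' E.
rewrite Eg in Lg'; suff -> : xi d = xi d' by [].
case Ed: (d 0%N) dd; case Ed': (d' 0%N) => // _; first exact: (same_side0 Aq Aq').
apply/esym; apply: (same_side0 Aq' Aq) => //; first by rewrite geodC.
by move=> E; apply: qq.
Qed.

(** Such a geodesic crosses the base edge, so it is the label of a vertex of weight 0, and that
    vertex is the image of both ends. *)
Lemma opposite_sides z z' : nonneg z -> nonneg (mS z') -> L1 (geod_of z z') -> phi z = phi z'.
Proof.
move=> h h' Lg; have [Gg fg] := Lg.
have zN w : geod_of z z' w -> w <> None /\ w <> Some 0.
  by move=> Hw; split=> E; [apply: (Gam_infty HG Gg)|apply: (Gam_zero HG Gg)]; rewrite -E.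
have [z1 z2] := zN z (or_introl erefl); have [z1' z2'] := zN z' (or_intror erefl).
have cr : crosses_edge (geod_of z z').
  clear -h h' z1 z2 z1' z2'; case: z h z1 z2 => [x|] //= x0 _ x1.
  case: z' h' z1' z2' => [y|] //= y0 _ y1.
  exists x, y; split=> //.
  have x2 : 0 < x by rewrite lt_neqAle x0 andbT; apply/eqP => E; apply: x1; rewrite -E.
  have yn : y != 0 by apply/eqP => E; apply: y1; rewrite E.
  move: y0; rewrite (negbTE yn) /= oppr_ge0 invr_le0 => y0.
  by rewrite pmulr_rlt0 // lt_neqAle yn.
have [v Ev] : exists v, lab v = geod_of z z' by apply: base_lab; constructor 3.
have sv : s v = 0 by rewrite /sw Ev; apply/(gwt_eq0 f Gg).
have -> : phi z = place G false (delta v) by apply: lab_phi => //; rewrite Ev; left.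
by apply/esym; apply: lab_phi => //; rewrite Ev; right.
Qed.

Lemma level1_phi z z' : L1 (geod_of z z') -> z <> z' -> phi z = phi z'.
Proof.
move=> Lg zz; have [h|h] := nonneg_or_S z; have [h'|h'] := nonneg_or_S z'.
- rewrite (@phi_adm false _ _ (adm_path h)) (@phi_adm false _ _ (adm_path h')).
  by rewrite (same_side (adm_path h) (adm_path h') Lg zz).
- exact: opposite_sides.
- by apply/esym; apply: opposite_sides => //; rewrite geodC.
- rewrite (@phi_adm true _ _ (adm_path h)) (@phi_adm true _ _ (adm_path h')).
  rewrite (same_side (adm_path h) (adm_path h')) //; last by move=> /mS_inj.
  by rewrite -im_geod; apply: level1_S.
Qed.

Lemma phi_eqv p p' : phi p = phi p' <-> pat_eqv L1 p p'.
Proof.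
split=> [/phi_inj H|]; first exact: rst_step.
rewrite /pat_eqv; elim=> {p p'} [x y [->//|[g [Lg [xy Eg]]]]|x|x y _ ->|x y z _ -> _ ->] //.
by apply: level1_phi => //; rewrite -Eg.
Qed.

Lemma phi_tile o w p : sbarc w (og o p) -> tile G s o w (phi p).
Proof.
move=> [r r0 Er].
pose c i := if (i < size w)%N then nth false w i else sbpath r (i - size w).
have Ew : mkseq c (size w) = w.
  apply: (@eq_from_nth _ false); rewrite size_mkseq // => i iw.
  by rewrite nth_mkseq // /c iw.
have Es : shift c (size w) = sbpath r.
  by apply/funext => i; rewrite /shift /c ltnNge leq_addr /= addKn.
have H : adm (shift c (size w)) r by rewrite Es; apply: adm_path.
have Ac : adm c (og o p) by have := adm_cat H; rewrite Ew -Er.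
rewrite (phi_adm Ac) (xi_run ws sep cusp c (size w)) Ew.
by exists (xi (shift c (size w))).
Qed.

Lemma word_list (D : bool -> nat) o w : size w = D o ->
  (o, w) \in [seq (true, w) | w <- words (D true)] ++ [seq (false, w) | w <- words (D false)].
Proof.
move=> sz; have := mem_words w; rewrite sz mem_cat => Hw; apply/orP.
by case: o {sz} Hw => Hw; [left|right]; apply: map_f.
Qed.

(** Intervals are closed and there are finitely many of a given depth, so a nearby [q] lies only in
    intervals that contain [p] too; both images are then in one small tile. *)
Lemma phi_cont p (r : R) : 0 < r -> exists2 d : R, 0 < d &
  forall q, cdist p q < d -> sdist_lt (phi p) (phi q) r.
Proof.
move=> r0; have [D HD] := run_shrink ws sep cusp r0.
have Hl (L : seq (bool * seq bool)) : exists2 d : R, 0 < d & forall q, cdist p q < d ->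
    forall ow, ow \in L -> sbarc ow.2 (og ow.1 q) -> sbarc ow.2 (og ow.1 p).
  elim: L => [|[o w] L [d d0 IH]]; first by exists 1.
  have [H|H] := pselect (sbarc w (og o p)).
    exists d => // q pq ow; rewrite inE => /orP[/eqP -> //|]; exact: IH.
  have [d' d0' H'] := arc_closed H.
  exists (Num.min d d'); first by rewrite lt_min d0.
  move=> q; rewrite lt_min => /andP[h1 h2] ow; rewrite inE => /orP[/eqP -> /= Hq|].
    by case: (H' (og o q)) => //; rewrite cdist_og.
  exact: IH.
have [d d0 Hd] := Hl ([seq (true, w) | w <- words D] ++ [seq (false, w) | w <- words D]).
exists d => // q pq; have [o [c Hc]] := phi_rep q.
have sz : size (mkseq c D) = D by rewrite size_mkseq.
have Hp : sbarc (mkseq c D) (og o p).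
  by apply: (Hd q pq (o, mkseq c D)) (Hc D); exact: (@word_list (fun=> D)).
have [y Hy ->] := phi_tile Hp; have [y' Hy' ->] := phi_tile (Hc D).
have S1 := run_simplex ws (mkseq c D) Hy; have S2 := run_simplex ws (mkseq c D) Hy'.
by apply: sdist_place => //; apply: HD => //; rewrite sz.
Qed.

(** A bad word has a tile containing the image of [p] but an interval not inside [V]. Arbitrarily
    long bad words would yield a bad path, whose limit has the same image as [p] and so lies in [V],
    together with a small interval: a contradiction. Hence there is a depth without bad words, and
    nearby limit points meet only tiles that contain the image of [p]. *)
Lemma phi_open (V : set P1) : openP V -> (forall p p', pat_eqv L1 p p' -> V p -> V p') ->
  forall q, (phi @` V) q -> exists2 d : R, 0 < d &
    forall q', Lam G s q' -> sdist_lt q q' d -> (phi @` V) q'.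
Proof.
move=> oV sV q [p Vp <-].
pose bad o w := tile G s o w (phi p) /\ exists2 z, sbarc w z & ~ V (og o z).
have Hbad o : exists D, forall w, size w = D -> ~ bad o w.
  apply: contrapT => Hno.
  have [c Hc] : exists c, forall i, bad o (mkseq c i).
    apply: konig => [w b|m].
      rewrite -cats1 => -[Ht [z Hz Vz]]; split.
        by first [exact: (tile_cat ws Ht)|exact: (tile_cat Ht)].
      by exists z => //; exact: arc_cat Hz.
    by apply: contrapT => Hm; apply: Hno; exists m => w Ew Hw; apply: Hm; exists w.
  have Eq : phi p = place G o (xi c).
    by apply: (Lam_of_tiles ws sep cusp) => i; have [] := Hc i.
  have [z Hz] := adm_exists R c.
  have Ez : phi (og o z) = phi p by rewrite Eq; apply: phi_adm; rewrite ogK.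
  have oV' : openP [set z | V (og o z)].
    move=> z0 /oV [d d0 Hd]; exists d => // y zy; apply: Hd.
    by rewrite cdist_og.
  have Vz : V (og o z) by apply: (sV p) => //; apply: (phi_eqv _ _).1; rewrite Ez.
  have [i Hi] := adm_shrink Hz oV' Vz.
  by have [_ [z' Hz' Vz']] := Hc i; exact: Vz' (Hi _ Hz').
have [D HD] := choice Hbad.
pose L0 := [seq (true, w) | w <- words (D true)] ++ [seq (false, w) | w <- words (D false)].
have [d d0 Hd] : exists2 d : R, 0 < d & forall q, Sn q -> sdist_lt (phi p) q d ->
    forall ow, ow \in [seq ow <- L0 | `[<~ tile G s ow.1 ow.2 (phi p)>]] ->
      ~ tile G s ow.1 ow.2 q.
  apply: (open_forall ws); first exact: phi_Sn.
  by move=> ow; rewrite mem_filter => /andP[/asboolP].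
exists d => // q' [o [c Eq']] qq'.
have Sq' : Sn q' by rewrite Eq'; apply: place_Sn.
have Hw w : size w = D o -> tile G s o w q' -> tile G s o w (phi p).
  move=> Ew Tq'; apply: contrapT => NT; apply: (Hd q' Sq' qq' (o, w)) => //.
  by rewrite mem_filter; apply/andP; split; [apply/asboolP|apply: word_list].
have [z Hz] := adm_exists R c.
exists (og o z); last by rewrite Eq'; apply: phi_adm; rewrite ogK.
apply: contrapT => NV; apply: (HD o (mkseq c (D o))); first by rewrite size_mkseq.
split; last by exists z => //; exact: Hz.
apply: Hw; first by rewrite size_mkseq.
by rewrite Eq'; exact: (tile_xi ws sep cusp).
Qed.

Lemma phi_homeo : homeomorphic_to_quotient L1 (Lam G s).
Proof.
exists phi; split; first exact: phi_Lam.
split; first exact: phi_onto.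
split; first exact: phi_eqv.
by split; [exact: phi_cont|exact: phi_open].
Qed.

End FixedWeights.

Variable word : 'M[int]_2 -> seq bool.
Hypothesis wordE : forall A, isSL A -> psl_eq A (evalm (word A)).

(** The words are an arbitrary choice; on the sphere the result does not depend on it, by [rhoE]. *)
Definition rho (f : set P1 -> R) (A : 'M[int]_2) (p : spt R k.+1) : spt R k.+1 :=
  act (@rhoS R k.+1 G) (rhoU G (sw f)) (word A) p.

Lemma rhoE f A l p : box Gam f -> isSL A -> psl_eq A (evalm l) -> Sn p ->
  rho f A p = act (@rhoS R k.+1 G) (rhoU G (sw f)) l p.
Proof.
move=> bf SA H Sp; apply: (gact_presentation (weights_sw bf)) => //.
exact: psl_trans (psl_sym (wordE SA)) H.
Qed.

Lemma rho_mono f : box Gam f -> mono_PL (rho f).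
Proof.
move=> bf; have ws := weights_sw bf; split; [|split; [|split]].
- by move=> A SA; exact: (gact_PLS ws (word A)).
- move=> A SA p Sp; rewrite (rhoE (l := word A) bf (isSL_opp SA)) //.
  exact: psl_trans (psl_neg A) (wordE SA).
- move=> A B SA SB p Sp; rewrite (rhoE (l := word A ++ word B) bf (isSL_mul SA SB)) //.
    by rewrite act_cat.
  by rewrite evalm_cat; apply: psl_mul; apply: wordE.
- move=> A SA H; apply: psl_trans (wordE SA) _.
  exact: (gact_faithful ws separated_lab (cusp_sw f)).
Qed.

Lemma rho_limit f : box Gam f -> limit_set (rho f) (Lam G (sw f)).
Proof.
move=> bf; have ws := weights_sw bf; have sep := separated_lab; have cusp := cusp_sw f.
split; first exact: (Lam_compact ws sep cusp).
split; first by move=> A SA p Lp; exact: (Lam_gact ws sep cusp).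
split.
  move=> p q Lp Lq r r0; have [l Hl] := Lam_dense ws sep cusp Lp Lq r0.
  exists (evalm l); split; first exact: evalm_SL.
  rewrite (rhoE (l := l) bf) //; [exact: evalm_SL|exact: psl_refl|].
  exact: (Lam_Sn ws sep cusp Lp).
move=> K cK KL; have [D HD] := avoids_compact ws sep cusp cK KL.
(* By [nfword_bound], only normal forms with fewer than D + D bits can send a point of [K] into
   [K]. *)
pose W := flatten [seq words m | m <- iota 0 (D + D)].
exists [seq evalm (nfword x.1 x.2.1 x.2.2) |
  x <- allpairs pair (iota 0 3) (allpairs pair W [:: true; false])].
move=> A SA [p [Kp KAp]].
have Sp : Sn p by have [] := KL p Kp.
have [a [w [b [Ha Hp He]]]] : exists a w b, [/\ (a < 3)%N,
    psl_eq (evalm (word A)) (evalm (nfword a w b)) & forall p, Sn p ->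
    act (@rhoS R k.+1 G) (rhoU G (sw f)) (word A) p =
    act (@rhoS R k.+1 G) (rhoU G (sw f)) (nfword a w b) p].
  by apply: act_nfword => x Sx;
    first [exact: rhoS_Sn|exact: (rhoU_Sn ws)|exact: rhoS2|exact: (rhoU3 ws)].
have KA2 := KAp; rewrite /rho He // in KA2.
have sz := nfword_bound ws Ha Sp (HD p Kp) (HD _ KA2).
exists (evalm (nfword a w b)); last exact: psl_trans (wordE SA) Hp.
apply/mapP; exists (a, (w, b)) => //; apply: allpairs_f; first by rewrite mem_iota.
apply: allpairs_f; last by case: (b).
apply/flattenP; exists (words (size w)); last exact: mem_words.
by apply: map_f; rewrite mem_iota.
Qed.

Lemma sdist_refl (p : spt R k.+1) r : 0 < r -> sdist_lt p p r.
Proof.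
move=> r0; left; split=> //; rewrite /enorm big1 ?sqrtr0 // => i _.
by rewrite /dvec subrr expr0n.
Qed.

Lemma rho_dep f : box Gam f -> forall r : R, 0 < r ->
  exists2 d : R, 0 < d & forall g, box Gam g ->
    (forall gam, Gam gam -> `|f gam - g gam| < d) ->
    forall A, A = genS \/ A = genU ->
      forall p, Sn p -> sdist_lt (rho f A p) (rho g A p) r.
Proof.
move=> bf r r0; have N0 : 0 < (k.+2%:R : R) by rewrite ltr0n.
have dE (N : R) : 0 < N -> 20 * (420 * (r / (8400 * N) / 2)) * N = r / 2.
  by move=> /lt0r_neq0 Nn; field.
have d0 : 0 < r / (8400 * k.+2%:R) / 2 by rewrite !divr_gt0 // mulr_gt0.
(* The constant is 8400 = 20 . 420, from [theta_close] and [turn_dep]; the extra half makes the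
   inequality strict. *)
exists (r / (8400 * k.+2%:R) / 2) => // g bg fg A HA p Sp.
have ES : psl_eq genS (evalm [:: true]) by left; rewrite /evalm /= mulmx1.
have EU : psl_eq genU (evalm [:: false]) by left; rewrite /evalm /= mulmx1.
case: HA => ->.
  rewrite (rhoE bf isSL_S ES Sp) (rhoE bg isSL_S ES Sp); exact: sdist_refl.
rewrite (rhoE bf isSL_U EU Sp) (rhoE bg isSL_U EU Sp).
apply: (rhoU_dep (d := r / (8400 * k.+2%:R) / 2) (weights_sw bf) (weights_sw bg)) => //.
  by move=> j; exact: gwt_dist.
by rewrite dE //; lra.
Qed.

Lemma Lam_sw_dep f : box Gam f -> forall r : R, 0 < r ->
  exists2 d : R, 0 < d & forall g, box Gam g ->
    (forall gam, Gam gam -> `|f gam - g gam| < d) -> hclose (Lam G (sw f)) (Lam G (sw g)) r.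
Proof.
move=> bf r r0; have [d d0 Hd] := Lam_dep (weights_sw bf) separated_lab (cusp_sw f) r0.
exists d => // g bg fg; apply: Hd; [exact: weights_sw|exact: cusp_sw|].
by move=> j; exact: gwt_dist.
Qed.

Lemma pattern_family :
  exists (Lam : (set P1 -> R) -> set (spt R k.+1))
         (rho : (set P1 -> R) -> 'M[int]_2 -> spt R k.+1 -> spt R k.+1),
    (forall f, box Gam f -> forall e : R, 0 < e ->
       exists2 d : R, 0 < d & forall g, box Gam g ->
         (forall gam, Gam gam -> `|f gam - g gam| < d) -> hclose (Lam f) (Lam g) e) /\
    (forall f, box Gam f -> forall e : R, 0 < e ->
       exists2 d : R, 0 < d & forall g, box Gam g ->
         (forall gam, Gam gam -> `|f gam - g gam| < d) ->
         forall A, (A = genS \/ A = genU) ->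
           forall p, @Sn R k.+1 p -> sdist_lt (rho f A p) (rho g A p) e) /\
    (forall f, box Gam f ->
       closedS (Lam f) /\ mono_PL (rho f) /\ limit_set (rho f) (Lam f) /\
       homeomorphic_to_quotient (level1 Gam f) (Lam f)).
Proof.
exists (fun f => Lam G (sw f)), rho; split; first exact: Lam_sw_dep.
split; first exact: rho_dep.
move=> f bf; split; first exact: (Lam_closed (weights_sw bf) separated_lab (cusp_sw f)).
split; first exact: rho_mono.
by split; [exact: rho_limit|exact: phi_homeo].
Qed.

End Quotient.

(* n = |Gam| = k + 1 *)
Theorem theorem2 (R : realType) (Gam : set (set (P1 R))) (k : nat) :
  modular_pattern Gam -> crossing_count Gam k ->
  exists (Lam : (set (P1 R) -> R) -> set (spt R k.+1))
         (rho : (set (P1 R) -> R) -> 'M[int]_2 -> spt R k.+1 -> spt R k.+1),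
    (* continuity of Lam : square(Gam) -> CS(S^n) (Hausdorff topology) *)
    (forall f, box Gam f -> forall e : R, 0 < e ->
       exists2 d : R, 0 < d & forall g, box Gam g ->
         (forall gam, Gam gam -> `|f gam - g gam| < d) -> hclose (Lam f) (Lam g) e) /\
    (* continuity of rho : square(Gam) -> Mon(PSL_2(Z), PL(S^n)) (algebraic topology) *)
    (forall f, box Gam f -> forall e : R, 0 < e ->
       exists2 d : R, 0 < d & forall g, box Gam g ->
         (forall gam, Gam gam -> `|f gam - g gam| < d) ->
         forall A, (A = genS \/ A = genU) ->
           forall p, @Sn R k.+1 p -> sdist_lt (rho f A p) (rho g A p) e) /\
    (forall f, box Gam f ->
       closedS (Lam f) /\ mono_PL (rho f) /\ limit_set (rho f) (Lam f) /\
       homeomorphic_to_quotient (level1 Gam f) (Lam f)).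

Proof.
move=> HG [geo [geo_inj [geo_in geo_all]]].
have [G [GX GS GU]] := gluing_exists HG geo_inj geo_in geo_all.
have Hword (A : 'M[int]_2) : exists l, isSL A -> psl_eq A (evalm l).
  have [SA|NA] := pselect (isSL A); last by exists [::].
  by have [l Hl] := evalm_surj SA; exists l.
have [word wordE] := choice Hword.
exact: (pattern_family HG geo_inj geo_in geo_all GX GS GU wordE).
Qed.
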